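(* Fix integers $m\ge2$, $\ell\ge2$, $s\ge0$, $t_1,\dots,t_s\ge1$, and a connected unicyclic graph $\Lambda$ that is obtained from an $\ell$-cycle $\mathcal{C}_\ell$ by attaching rooted trees $\mathcal{T}_1,\dots,\mathcal{T}_s$, where $\mathcal{T}_i$ has $t_i$ edges, at $s$ distinct vertices of $\mathcal{C}_\ell$ (so $s\le\ell$), the root of $\mathcal{T}_i$ being identified with the vertex of $\mathcal{C}_\ell$ where it is attached. Let $W_n$ be the number of copies of $\Lambda$ in the uniform attachment graph $G^m_n$, let $\mu_n:=\mathbb{E}W_n$, $\sigma_n^2:=\mathrm{Var}(W_n)$, and $Y_n:=(W_n-\mu_n)/\sigma_n$. Let $t:=\sum_{i=1}^s t_i\ge0$. Then, as $n\to\infty$, $$\mu_n=\Theta\bigl((\log n)^{t+1}\bigr),\qquad \sigma_n^2=\Theta\bigl((\log n)^{2t+1}\bigr),$$ and there is a positive constant $C=C(m,\ell,t)$ such that, for all sufficiently large $n$, $$d_{\mathrm{W}}\bigl(\mathcal{L}(Y_n),\mathcal{N}(0,1)\bigr)\le C(\log n)^{-1/2}.$$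
   Context: Uniform attachment graph: for integers $m,n\ge1$, $G^m_n$ is the random loopless multigraph on vertex set $[n]=\{1,\dots,n\}$ in which, for every $j\in\{2,\dots,n\}$ and every label $a\in[m]$, there is exactly one edge $j^{(a)}$ with label $a$ from $j$ to a vertex chosen uniformly at random in $[j-1]$, all choices being independent. Parallel edges are allowed and are distinguished by their labels (equivalently, $G^m_n$ is a random subgraph of the multigraph $K^m_n$ on $[n]$ having, for every $1\le i<j\le n$, $m$ edges $ji^{(1)},\dots,ji^{(m)}$ between $j$ and $i$). Copies: graphs may be loopless multigraphs. A copy of a graph $H$ in $G^m_n$ is a (not necessarily induced) subgraph of $G^m_n$ isomorphic to $H$ as an undirected, unlabelled multigraph; two copies are different if they differ as subgraphs (also if they differ only in edge labels). An $\ell$-cycle is a cycle with $\ell$ edges and $\ell$ vertices; a pair of parallel edges is a 2-cycle. A graph is unicyclic if it contains exactly one cycle. $\mathcal{L}(X)$ is the law of $X$, $\mathcal{N}(0,1)$ the standard normal distribution. The Wasserstein distance is $d_{\mathrm{W}}(\nu_1,\nu_2)=\sup_f|\int f\,d\nu_1-\int f\,d\nu_2|$, supremum over all $f:\mathbb{R}\to\mathbb{R}$ with $|f(x)-f(y)|\le|x-y|$ for all $x,y$. $a_n=\Theta(b_n)$ means that there are constants $0<c\le C'<\infty$ not depending on $n$ with $cb_n\le a_n\le C'b_n$ for all sufficiently large $n$. *)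

(* Defs.v *)
From HB Require Import structures.
From mathcomp Require Import all_boot all_order all_algebra.

Set Implicit Arguments.
Unset Strict Implicit.
Unset Printing Implicit Defensive.

(* Finite loopless multigraphs: parallel edges are distinct elements of [edge]
   with the same pair of ends. *)
Record mgraph := MGraph {
  vertex : finType;
  edge : finType;
  ends : edge -> {set vertex};
  card_ends : forall e, #|ends e| = 2 }.

Arguments ends {m} e.

(* A subgraph of [G] is given by its vertex set and its edge set.  The last
   conjunct makes [(f, g)] an isomorphism from [H] onto [S]; it also implies
   that the ends of the edges in [S.2] belong to [S.1]. *)
Definition is_copy (H G : mgraph) (S : {set vertex G} * {set edge G}) : bool :=
  [exists f : {ffun vertex H -> vertex G},
   exists g : {ffun edge H -> edge G},
   [&& injectiveb f, injectiveb g, f @: [set: vertex H] == S.1,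
       g @: [set: edge H] == S.2 & [forall e, ends (g e) == f @: ends e]]].

Definition num_copies (H G : mgraph) : nat := #|[set S | is_copy H (G := G) S]|.

Definition isomorphic (H G : mgraph) : bool :=
  is_copy H (G := G) ([set: vertex G], [set: edge G]).

Definition adjacent (G : mgraph) : rel (vertex G) :=
  [rel u v | [exists e, ends e == [set u; v]]].

Definition connected_mgraph (G : mgraph) : Prop :=
  0 < #|vertex G| /\ forall u v, connect (@adjacent G) u v.

(* Edge [i] joins [i] to [i + 1] modulo [l]; for [l = 2] the two edges are
   parallel. *)
Definition cycle_ends (l : nat) (i : 'I_l) : {set 'I_l} := [set i; ordS i].

Lemma card_cycle_ends (l : nat) (l_gt1 : 1 < l) (i : 'I_l) :
  #|cycle_ends i| = 2.
Proof.
rewrite cards2; suff -> : i != ordS i by [].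
apply/eqP => /(congr1 val) /= eqi.
have := ltn_ord i; rewrite leq_eqVlt => /predU1P[il|il].
  by move: eqi l_gt1; rewrite il modnn => i0; rewrite -il i0.
by move: eqi; rewrite modn_small // => /eqP; rewrite ltn_eqF.
Qed.

Definition cycle_graph (l : nat) (l_gt1 : 1 < l) : mgraph :=
  MGraph (card_cycle_ends l_gt1).

Definition is_cycle_in (G : mgraph) (S : {set vertex G} * {set edge G}) : Prop :=
  exists (k : nat) (k_gt1 : 1 < k), is_copy (cycle_graph k_gt1) S.

Definition unicyclic (G : mgraph) : Prop := exists! S, is_cycle_in (G := G) S.

Definition is_tree (G : mgraph) : Prop :=
  connected_mgraph G /\ forall S, ~ is_cycle_in (G := G) S.

(* The disjoint union of [K] and the [T i], with the root [r i] of [T i]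
   identified with the vertex [p i] of [K]. *)
Section Attach.
Variables (K : mgraph) (s : nat) (T : 'I_s -> mgraph).
Variables (r : forall i, vertex (T i)) (p : 'I_s -> vertex K).

Definition attach_vertex : finType :=
  (vertex K + {i : 'I_s & {v : vertex (T i) | v != r i}})%type.

Definition attach_edge : finType := (edge K + {i : 'I_s & edge (T i)})%type.

Definition tree_vertex (i : 'I_s) (v : vertex (T i)) : attach_vertex :=
  if insub v is Some u
  then inr (Tagged (fun i => {v : vertex (T i) | v != r i}) u)
  else inl (p i).

Definition attach_ends (e : attach_edge) : {set attach_vertex} :=
  match e with
  | inl e => [set inl v | v in ends e]
  | inr (existT i e) => [set tree_vertex v | v in ends e]
  end.

Lemma tree_vertex_inj (i : 'I_s) : injective (@tree_vertex i).
Proof.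
move=> u v; rewrite /tree_vertex.
case: insubP => [u' _ <-|]; case: insubP => [v' _ <-|] //=.
  by move=> uv; have /eqP := inr_inj uv; rewrite eq_Tagged /= => /eqP ->.
by rewrite !negbK => /eqP -> /eqP ->.
Qed.

Lemma card_attach_ends (e : attach_edge) : #|attach_ends e| = 2.
Proof.
case: e => [e|[i e]] /=; rewrite card_imset ?card_ends //.
  by move=> u v [].
exact: tree_vertex_inj.
Qed.

Definition attach : mgraph := MGraph card_attach_ends.

End Attach.

(* The ordinal [i : 'I_n] stands for the vertex [i + 1] of {1, ..., n}, and the
   pair [(j, a)], with [j] not the first vertex, for the edge with label [a] from
   [j] to an older vertex. *)
Definition ua_edge (m n : nat) : finType :=
  {e : 'I_n * 'I_m | 0 < (e.1 : nat)}.

(* An outcome chooses, for each edge, its older endpoint; the vertices older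
   than [j] are the ordinals less than [j]. *)
Definition ua_space (m n : nat) : Type :=
  {dffun forall e : ua_edge m n, 'I_(val e).1}.

HB.instance Definition _ (m n : nat) := Finite.on (ua_space m n).

Definition ua_ends (m n : nat) (w : ua_space m n) (e : ua_edge m n) :
    {set 'I_n} :=
  [set (val e).1; widen_ord (ltnW (ltn_ord (val e).1)) (w e)].

Lemma card_ua_ends (m n : nat) (w : ua_space m n) (e : ua_edge m n) :
  #|ua_ends w e| = 2.
Proof.
rewrite cards2; suff -> : (val e).1 != widen_ord (ltnW (ltn_ord (val e).1)) (w e) by [].
by apply/eqP => /(congr1 val) /= /eqP; rewrite gtn_eqF.
Qed.

Definition ua_graph (m n : nat) (w : ua_space m n) : mgraph :=
  MGraph (card_ua_ends w).

From mathcomp Require Import all_classical all_reals all_analysis.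

Import Order.TTheory GRing.Theory Num.Theory.
Import numFieldNormedType.Exports.
Local Open Scope classical_set_scope.
Local Open Scope ring_scope.

HB.instance Definition _ (m n : nat) := isPointed.Build (ua_space m n)
  ([ffun e : ua_edge m n => Ordinal (valP e)] : {dffun _}).

HB.instance Definition _ (m n : nat) :=
  @isMeasurable.Build default_measure_display (ua_space m n)
    discrete_measurable discrete_measurable0
    discrete_measurableC discrete_measurableU.

(* The choices of the edges are independent, that of the edge [e] being uniform
   on a set of size [(val e).1]. *)
Definition ua_pmf (R : realType) (m n : nat) (w : ua_space m n) : R :=
  \prod_(e : ua_edge m n) ((val e).1 : nat)%:R^-1.

Definition ua_prob (R : realType) (m n : nat) (A : set (ua_space m n)) : \bar R :=
  (\sum_(w \in A) (ua_pmf R w)%:E)%E.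

Arguments ua_prob R m n A : clear implicits.

Section UaProb.
Variables (R : realType) (m n : nat).

Let P : set (ua_space m n) -> \bar R := ua_prob R m n.

Let pmf_ge0 (w : ua_space m n) : (0 <= (ua_pmf R w)%:E)%E.
Proof. by rewrite lee_fin; apply: prodr_ge0 => e _; rewrite invr_ge0. Qed.

Let P_esum A : P A = (\esum_(w in A) (ua_pmf R w)%:E)%E.
Proof. by rewrite esum_fset //; exact: finite_finset. Qed.

Let P0 : P set0 = 0%E.
Proof. by rewrite /P /ua_prob fsbig_set0. Qed.

Let P_ge0 A : (0 <= P A)%E.
Proof. by rewrite P_esum; apply: esum_ge0. Qed.

Let P_sigma_additive : semi_sigma_additive P.
Proof.
move=> F mF tF mUF; apply: cvg_toP.
  apply: ereal_nondecreasing_is_cvgn => i j ij.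
  by apply: lee_sum_nneg_natr => // k _ _; exact: P_ge0.
under eq_eseriesr do rewrite P_esum.
by rewrite -nneseries_sum_bigcup // P_esum.
Qed.

HB.instance Definition _ := isMeasure.Build _ _ _ (ua_prob R m n)
  P0 P_ge0 P_sigma_additive.

Let P_setT : P [set: ua_space m n] = 1%E.
Proof.
rewrite /P /ua_prob fsbig_finite /=; last exact: finite_finset.
rewrite sumEFin (perm_big (index_enum (ua_space m n))) /=; last first.
  apply: uniq_perm => [||w]; rewrite ?finmap.fset_uniq ?index_enum_uniq //.
  by rewrite mem_index_enum in_fset_set; [rewrite in_setT | exact: finite_finset].
congr EFin; rewrite /ua_pmf sumr_const card_dep_ffun.
rewrite foldrE big_map big_enum /= -[LHS]mulr_natr natr_prod -big_split /=.
by apply: big1 => e _; rewrite card_ord mulVf // pnatr_eq0 -lt0n (valP e).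
Qed.

HB.instance Definition _ :=
  @Measure_isProbability.Build _ _ R (ua_prob R m n) P_setT.

End UaProb.

Section Copies.
Variables (R : realType) (Lambda : mgraph) (m n : nat).

Definition W (w : ua_space m n) : R := (num_copies Lambda (ua_graph w))%:R.

Definition mu : R := fine 'E_(ua_prob R m n)[W].

Definition sigma2 : R := fine 'V_(ua_prob R m n)[W].

(* [normal_prob] is a probability on [measurableTypeR R], whose display is not
   the one of [R]; the measurable sets are the Borel sets in both cases. *)
Definition Y (w : ua_space m n) : measurableTypeR R :=
  (W w - mu) / Num.sqrt sigma2.

Lemma Y_measurable : measurable_fun [set: ua_space m n] Y.
Proof. by []. Qed.

HB.instance Definition _ := isMeasurableFun.Build _ _ _ _ Y Y_measurable.

Definition law_Y : probability (measurableTypeR R) R :=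
  distribution (ua_prob R m n) Y.

End Copies.

Definition is_Theta (R : realType) (a b : nat -> R) : Prop :=
  exists c c' : R, [/\ 0 < c, c <= c' &
    \forall n \near \oo, c * b n <= a n <= c' * b n].

Definition wasserstein (R : realType) (nu1 nu2 : probability (measurableTypeR R) R) :
    \bar R :=
  ereal_sup [set `| \int[nu1]_x (f x)%:E - \int[nu2]_x (f x)%:E |%E
            | f in [set f : R -> R | forall x y, `|f x - f y| <= `|x - y| ]].

(* Main.v *)
Require Import Defs.
From mathcomp Require Import all_boot all_order all_algebra.
From mathcomp Require Import zify.

(* Numbering the cycle first and then adding one vertex at a time, [Lambda] has
   vertices and edges [0, ..., l + t - 1], the edge [i] joining [i] to [V i],
   where [V i] is the next vertex of the cycle or an earlier vertex.  Up to the
   number of automorphisms, [W] is then the number of pairs of injections of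
   vertices and edges, that is, a sum of products of indicators of the choices
   of the edges.

   As an edge between [u] and [v] is present with probability about
   [1 / max u v], sums over the vertices are governed by the kernel
   [2 / (max u v + 1)], whose rows have sum [O(log n)] and which satisfies
   Schur's test with the weight [(u + 1)^(-1/2)]: closing the cycle costs [O(1)]
   except for one factor [log n], and each edge of a tree costs [O(log n)].  This
   also holds conditionally on boundedly many choices, except that a copy using
   one of these choices has its cycle pinned: the copies meeting a given one
   contribute [c = O((log n)^t)].  Hence the mean is [O((log n)^(t+1))], the
   variance is at most [c] times the mean, and Stein's method for locally
   dependent sums gives a Wasserstein error [O(c^2 mean / sd^3)].

   The lower bound for the mean comes from vertices in prescribed logarithmic
   scales, that for the variance from the Cauchy-Schwarz inequality applied to
   the covariance of [W] and the number of [l]-cycles. *)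

Set Implicit Arguments.
Unset Strict Implicit.
Unset Printing Implicit Defensive.

(** * Multigraphs: embeddings and enumerations *)

(** The rate is a count of logarithms: with c of order t, the mean of order t + 1 and the variance
    of order 2t + 1, the error c^2 mean / sd^3 has exponent 2t + (t + 1) - 3(2t + 1)/2 = -1/2. The
    obstacle is that the rows of the kernel sum to log n, so that bounding a cycle row by row would
    cost a logarithm per edge. The kernel reproduces the weight (u + 1)^(-1/2) up to a constant
    factor, which makes the diagonal of its l-th power O(1 / (u + 1)): one logarithm for the whole
    cycle, and none once a choice on it or in a tree is prescribed. For the variance from below,
    cycles are a good test variable because each copy contains its own cycle: the covariance is at
    least the mean, minus products of means over pairs sharing a choice, which are O((log n)^t). As
    the number of cycles has variance O(log n), Cauchy-Schwarz gives (log n)^(2t+2) / log n. *)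

Lemma uniq_full (T : finType) (s : seq T) :
  uniq s -> #|T| <= size s -> forall x, x \in s.
Proof.
move=> us Ts x; apply: contraT => xs; have : uniq (x :: s) by rewrite /= xs.
by move=> /card_uniqP cs; have := max_card (mem (x :: s)); rewrite cs leqNgt ltnS Ts.
Qed.

Lemma nth_map_enum_ord (T : Type) (l : nat) (c : 'I_l -> T) x0 (i : 'I_l) :
  nth x0 [seq c j | j <- enum 'I_l] i = c i.
Proof. by rewrite (nth_map i) ?size_enum_ord// nth_ord_enum. Qed.

Section Embeddings.

Definition emb (H G : mgraph) :
    {set {ffun vertex H -> vertex G} * {ffun edge H -> edge G}} :=
  [set p : {ffun vertex H -> vertex G} * {ffun edge H -> edge G} |
    [&& injectiveb p.1, injectiveb p.2 &
            [forall e, ends (p.2 e) == p.1 @: ends e]]].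

Lemma embP (H G : mgraph) (f : {ffun vertex H -> vertex G})
    (g : {ffun edge H -> edge G}) :
  reflect [/\ injective f, injective g & forall e, ends (g e) = f @: ends e]
          ((f, g) \in emb H G).
Proof.
rewrite inE; apply: (iffP and3P) => /= -[].
  by move=> /injectiveP ? /injectiveP ? /forallP h; split => // e; apply/eqP.
move=> ? ? h; split; [exact/injectiveP|exact/injectiveP|].
by apply/forallP => e; rewrite h.
Qed.

Definition emb_image (H G : mgraph)
    (q : {ffun vertex H -> vertex G} * {ffun edge H -> edge G}) :=
  (q.1 @: [set: vertex H], q.2 @: [set: edge H]).

Lemma is_copyP (H G : mgraph) (S : {set vertex G} * {set edge G}) :
  reflect (exists2 q, q \in emb H G & emb_image q = S) (is_copy H S).
Proof.
apply: (iffP existsP) => [[f /existsP[g]]|[[f g] /embP[fi gi h] <-]].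
  case/and5P => fi gi /eqP f1 /eqP g1 h; exists (f, g).
    by rewrite inE fi gi.
  by rewrite /emb_image /= f1 g1; case: (S).
exists f; apply/existsP; exists g; rewrite !eqxx /=.
apply/and3P; split; [exact/injectiveP|exact/injectiveP|].
by apply/forallP => e; rewrite h.
Qed.

Lemma emb_id (H : mgraph) : ([ffun v => v], [ffun e => e]) \in emb H H.
Proof.
apply/embP; split => [u v|u v|e]; rewrite ?ffunE //.
by apply/setP => v; rewrite (eq_imset (g := id)) ?imset_id// => u; rewrite ffunE.
Qed.

(** Composition with [q0] is injective on the automorphisms of [H], and its range is the fibre,
    since an embedding with the same image factors through [q0]. *)
Lemma card_emb_fibre (H G : mgraph) q0 : q0 \in emb H G ->
  #|[set q in emb H G | emb_image q == emb_image q0]| = #|emb H H|.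
Proof.
case: q0 => f0 g0 /embP[f0i g0i h0].
pose comp (q : {ffun vertex H -> vertex H} * {ffun edge H -> edge H}) :
    {ffun vertex H -> vertex G} * {ffun edge H -> edge G} :=
  ([ffun v => f0 (q.1 v)], [ffun e => g0 (q.2 e)]).
have comp_inj : injective comp.
  move=> [a b] [a' b'] /= [/ffunP ha /ffunP hb]; congr (_, _).
    by apply/ffunP => v; have := ha v; rewrite !ffunE => /f0i.
  by apply/ffunP => v; have := hb v; rewrite !ffunE => /g0i.
rewrite -(card_imset (mem (emb H H)) comp_inj); apply/eq_card => -[f g].
rewrite inE; apply/andP/imsetP => [[/embP[fi gi h] /eqP[fS gS]]|[[a b] /embP[ai bi hab] [-> ->]]].
  have fx v : exists v', f0 v' == f v.
    have : f v \in f0 @: setT by rewrite -fS imset_f.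
    by case/imsetP => v' _ ->; exists v'.
  have gx e : exists e', g0 e' == g e.
    have : g e \in g0 @: setT by rewrite -gS imset_f.
    by case/imsetP => v' _ ->; exists v'.
  have fxE v := eqP (xchooseP (fx v)); have gxE e := eqP (xchooseP (gx e)).
  exists ([ffun v => xchoose (fx v)], [ffun e => xchoose (gx e)]); last first.
    by congr (_, _); apply/ffunP => v; rewrite !ffunE ?fxE ?gxE.
  apply/embP; split.
  - by move=> u v; rewrite !ffunE => /(congr1 f0); rewrite !fxE => /fi.
  - by move=> u v; rewrite !ffunE => /(congr1 g0); rewrite !gxE => /gi.
  - move=> e; rewrite ffunE; apply: (imset_inj f0i).
    rewrite -h0 gxE h -imset_comp; apply: eq_imset => v /=.
    by rewrite ffunE fxE.
have im_onto (T : finType) (c : {ffun T -> T}) : injective c -> c @: setT = setT.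
  move=> ci; apply/eqP; rewrite eqEcard subsetT /=.
  by rewrite card_imset.
split; last first.
  apply/eqP; congr (_, _) => /=.
    rewrite (eq_imset (g := f0 \o a)); last by move=> v; rewrite ffunE.
    by rewrite imset_comp im_onto.
  rewrite (eq_imset (g := g0 \o b)); last by move=> v; rewrite ffunE.
  by rewrite imset_comp im_onto.
apply/embP; split.
- by move=> u v; rewrite !ffunE => /f0i /ai.
- by move=> u v; rewrite !ffunE => /g0i /bi.
- move=> e; rewrite ffunE h0 hab -imset_comp; apply: eq_imset => v /=.
  by rewrite ffunE.
Qed.

Lemma card_emb (H G : mgraph) : #|emb H G| = num_copies H G * #|emb H H|.
Proof.
rewrite /num_copies -sum1_card.
rewrite (partition_big (@emb_image H G) (fun S => is_copy H S)) /=; last first.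
  by move=> q qe; apply/is_copyP; exists q.
rewrite -[#|[set S | _]|]sum1_card big_distrl /=.
rewrite [RHS](eq_bigl (fun S => is_copy H S)); last by move=> S; rewrite inE.
apply: eq_bigr => S /is_copyP[q0 q0e <-].
rewrite mul1n -(card_emb_fibre q0e) -sum1_card.
by apply: eq_bigl => q; rewrite !inE.
Qed.

Lemma card_emb_gt0 (H : mgraph) : 0 < #|emb H H|.
Proof. by apply/card_gt0P; exists ([ffun v => v], [ffun e => e]); exact: emb_id. Qed.

End Embeddings.

(** * Growing a connected multigraph edge by edge *)

Section Enumeration.
Variable G : mgraph.
Hypothesis Gconn : connected_mgraph G.

Lemma adjacent_sym : symmetric (@adjacent G).
Proof. by move=> u v; apply: eq_existsb => e; rewrite setUC. Qed.

Lemma endsE (e : edge G) : exists u v, u != v /\ ends e = [set u; v].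
Proof.
have /eqP/cards2P[u [v [uv ->]]] := card_ends e.
by exists u, v.
Qed.

Lemma crossing_edge (S : pred (vertex G)) u v : S u -> ~~ S v ->
  exists e x y, [/\ S x, ~~ S y & ends e = [set x; y]].
Proof.
move=> Su Sv.
suff /existsP[x /existsP[y /and3P[Sx Sy /existsP[e /eqP he]]]] :
    [exists x, [exists y, [&& S x, ~~ S y & adjacent x y]]].
  by exists e, x, y.
apply: contraT; rewrite negb_exists => /forallP h.
have h' x y : S x -> adjacent x y -> S y.
  move=> Sx xy; have := h x; rewrite negb_exists => /forallP/(_ y).
  by rewrite Sx xy andbT negbK.
have cl : closed (@adjacent G) S.
  move=> x y xy; apply/idP/idP; first by move=> ?; exact: h' xy.
  by rewrite adjacent_sym in xy; move=> ?; exact: h' xy.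
have := closed_connect cl (Gconn.2 u v).
by rewrite -!topredE /= Su (negbTE Sv).
Qed.

(* Each edge [nth e0 es i] attaches a new vertex to an older one, as a vertex
   set which is not full can be left by some edge. *)
Lemma grow_enum (v0 : vertex G) (vs0 : seq (vertex G)) (es0 : seq (edge G)) d :
  uniq vs0 -> uniq es0 -> 0 < size vs0 ->
  (forall e, e \in es0 -> {subset ends e <= vs0}) ->
  size vs0 + d <= #|vertex G| ->
  exists (vs : seq (vertex G)) (es : seq (edge G)) (V : nat -> nat),
    [/\ uniq (vs0 ++ vs), uniq (es0 ++ es), size vs = d, size es = d &
        (forall e, e \in es0 ++ es -> {subset ends e <= vs0 ++ vs}) /\
        forall i, i < d -> V i < size vs0 + i /\ forall e0,
          ends (nth e0 es i) = [set nth v0 vs i; nth v0 (vs0 ++ vs) (V i)]].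
Proof.
move=> uv0 ue0 v00 sub0; elim: d => [|d IHd] dV.
  by exists [::], [::], id; rewrite !cats0; split.
have [|vs [es [V [uv ue sv se [sub step]]]]] := IHd; first by rewrite addnS in dV; exact: ltnW.
have [v vS] : exists v, v \notin vs0 ++ vs.
  apply/existsP; apply: contraLR dV; rewrite negb_exists => /forallP h.
  rewrite -ltnNge addnS ltnS -sv -size_cat -(card_uniqP uv).
  by apply/subset_leq_card/subsetP => x _; have := h x; rewrite negbK.
have uS : nth v0 vs0 0 \in vs0 ++ vs by rewrite mem_cat mem_nth.
have [e [x [y [xS yS he]]]] := crossing_edge (S := mem (vs0 ++ vs)) uS vS.
have enew : e \notin es0 ++ es.
  by apply: contra yS => /sub; apply; rewrite he !inE eqxx orbT.
exists (rcons vs y), (rcons es e), (fun i => if i < d then V i else index x (vs0 ++ vs)).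
split.
- by rewrite -rcons_cat rcons_uniq uv andbT.
- by rewrite -rcons_cat rcons_uniq ue andbT.
- by rewrite size_rcons sv.
- by rewrite size_rcons se.
split.
  move=> e'; rewrite -!rcons_cat mem_rcons inE => /predU1P[->|/sub h] z.
    rewrite he !inE mem_rcons inE => /orP[/eqP->|->//].
    by rewrite (_ : (x \in _) = true) ?orbT.
  by move=> /h zS; rewrite mem_rcons inE zS orbT.
move=> i; rewrite ltnS leq_eqVlt => /predU1P[->|id].
  rewrite ltnn; split.
    by rewrite -sv -size_cat index_mem.
  move=> e0; rewrite nth_rcons se ltnn eqxx he nth_rcons sv ltnn eqxx setUC.
  congr ([set _; _]).
  by rewrite -rcons_cat nth_rcons index_mem (_ : (x \in _) = true)// nth_index.
have [Vi hi] := step i id; rewrite id; split => // e0.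
rewrite nth_rcons se id nth_rcons sv id hi; congr ([set _; _]).
rewrite -rcons_cat nth_rcons size_cat sv.
by rewrite (ltn_trans Vi)// ltn_add2l.
Qed.

(** [F] keeps the closing edge [e] apart from the edges of the path. This matters when the path has
    a single edge: [e] is then parallel to it and closes a 2-cycle. *)
Lemma cycle_of_path (F : pred (edge G)) u p (e : edge G) :
  uniq (u :: p) -> path (fun x y => [exists e', F e' && (ends e' == [set x; y])]) u p ->
  0 < size p -> ends e = [set u; last u p] -> ~~ F e ->
  exists S, is_cycle_in (G := G) S.
Proof.
move=> up pathp p0 ee Fe.
pose k := (size p).+1; have k1 : 1 < k by [].
pose x i := nth u (u :: p) i.
have step i : i < size p -> exists e', F e' && (ends e' == [set x i; x i.+1]).
  by move=> ip; apply/existsP; have /pathP := pathp => /(_ u i ip).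
pose g (i : 'I_k) := if ltnP i (size p) is LtnNotGeq ip then xchoose (step i ip) else e.
have gP (i : 'I_k) : (i < size p -> F (g i) /\ ends (g i) = [set x i; x i.+1]) /\
     (i = size p :> nat -> g i = e).
  rewrite /g; case: ltnP => ip; split => //.
  - by move=> _; have /andP[? /eqP ?] := xchooseP (step i ip).
  - by move=> /eqP; rewrite ltn_eqF.
have xinj i j : i < k -> j < k -> x i = x j -> i = j.
  by move=> ik jk /eqP; rewrite nth_uniq// => /eqP.
have gends (i : 'I_k) : ends (g i) = [set x i; x (ordS i)].
  have := ltn_ord i; rewrite ltnS leq_eqVlt => /predU1P[ip|ip].
    rewrite (gP i).2// ee setUC /=; congr ([set _; _]).
      by rewrite /x ip -last_nth.
    by rewrite ip modnn.
  by rewrite ((gP i).1 ip).2 /= modn_small.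
exists ([ffun i : 'I_k => x i] @: setT, [ffun i : 'I_k => g i] @: setT), k, k1.
apply/is_copyP; exists ([ffun i : 'I_k => x i], [ffun i : 'I_k => g i]) => //.
apply/embP; split.
- move=> i j; rewrite !ffunE => h; apply/val_inj.
  exact: (xinj _ _ (ltn_ord i) (ltn_ord j) h).
- move=> i j; rewrite !ffunE => gij.
  have := ltn_ord i; rewrite ltnS leq_eqVlt => /predU1P[ip|ip];
  have := ltn_ord j; rewrite ltnS leq_eqVlt => /predU1P[jp|jp].
  + by apply/val_inj; rewrite /= ip jp.
  + by move: Fe; rewrite -((gP i).2 ip) gij ((gP j).1 jp).1.
  + by move: Fe; rewrite -((gP j).2 jp) -gij ((gP i).1 ip).1.
  have := ((gP i).1 ip).2; rewrite gij ((gP j).1 jp).2 => hs.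
  have ik : i < k := ltn_ord i; have jk : j < k := ltn_ord j.
  have : x j \in [set x i; x i.+1] by rewrite -hs !inE eqxx.
  rewrite !inE => /orP[/eqP/xinj h|/eqP/xinj h]; first by apply/val_inj; rewrite /= h.
  have : x j.+1 \in [set x i; x i.+1] by rewrite -hs !inE eqxx orbT.
  rewrite !inE => /orP[/eqP/xinj h'|/eqP/xinj h'].
    have : j.+1 = i by exact: h'.
    by rewrite (h jk) //; lia.
  by apply/val_inj => /=; have := h' jp ip; case.
- move=> i; rewrite ffunE gends /= /cycle_ends imsetU !imset_set1 !ffunE //.
Qed.

(** A spanning tree grown from one vertex has one edge less than there are vertices; any further
    edge would close a cycle with the tree path between its ends. *)
Lemma acyclic_card : (forall S, ~ is_cycle_in (G := G) S) -> #|edge G| < #|vertex G|.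
Proof.
move=> acyc; rewrite ltnNge; apply/negP => VE.
have [v0 _] := card_gt0P Gconn.1.
have [|||||vs [es [V [uv ue sv se [sub step]]]]] := @grow_enum v0 [:: v0] [::] #|vertex G|.-1 => //.
  by rewrite /= add1n prednK// Gconn.1.
have [e eS] : exists e, e \notin es.
  apply/existsP; apply: contraLR VE; rewrite negb_exists => /forallP h.
  rewrite -ltnNge -(prednK Gconn.1) ltnS -se -(card_uniqP ue).
  by apply/subset_leq_card/subsetP => x _; have := h x; rewrite negbK.
pose r := [rel x y | [exists e', (e' \in es) && (ends e' == [set x; y])]].
have rsym : symmetric r.
  by move=> x y; apply: eq_existsb => e'; rewrite setUC.
have Sall x : x \in v0 :: vs.
  by apply: uniq_full => //=; rewrite sv prednK// Gconn.1.
have conn i : i < #|vertex G| -> connect r v0 (nth v0 (v0 :: vs) i).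
  elim/ltn_ind: i => -[_|i IHi] iV; first exact: connect0.
  have id : i < #|vertex G|.-1 by rewrite -ltnS prednK// Gconn.1.
  have [Vi hi] := step i id; rewrite /= add1n in Vi.
  apply: connect_trans (IHi (V i) Vi (leq_trans Vi (ltnW iV))) _.
  apply: connect1; apply/existsP; exists (nth e es i).
  by rewrite mem_nth ?se// hi setUC /= eqxx.
have [u [v [uv' he]]] := endsE e.
have c : connect r u v.
  have nthS x : exists2 i, i < #|vertex G| & x = nth v0 (v0 :: vs) i.
    exists (index x (v0 :: vs)); last by rewrite nth_index.
    have : index x (v0 :: vs) < size (v0 :: vs) by rewrite index_mem.
    by rewrite [size _]/= sv prednK// Gconn.1.
  have [i iV ->] := nthS u; have [j jV ->] := nthS v.
  by apply: connect_trans (conn j jV); rewrite (sym_connect_sym rsym); exact: conn.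
case/connectP: c => p0 /shortenP[p pp up _] vE.
have [||||S SC] := @cycle_of_path (mem es) u p e up => //.
- by case: (p) vE => //= vu; rewrite vu eqxx in uv'.
- by rewrite -vE.
exact: acyc SC.
Qed.

End Enumeration.

(** * The standard numbering of the pattern *)

Section StandardForm.

Lemma attach_card (K : mgraph) (s : nat) (T : 'I_s -> mgraph)
  (r : forall i, vertex (T i)) (p : 'I_s -> vertex K) :
  #|vertex (attach r p)| = #|vertex K| + \sum_i #|vertex (T i)|.-1 /\
  #|edge (attach r p)| = #|edge K| + \sum_i #|edge (T i)|.
Proof.
split; rewrite /= card_sum card_tagged sumnE big_map big_enum /=; congr (_ + _) => //.
apply: eq_bigr => i _; rewrite card_sig -(cardC1 (r i)).
by apply: eq_card => v; rewrite !inE.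
Qed.

(* The cycle is followed by an enumeration of the other vertices in which each
   one is attached to an earlier one; since there are as many edges left as
   vertices left, the trees being acyclic, this exhausts [Lambda]. *)
Lemma standard_form (l t : nat) (l_gt1 : 1 < l) (s : nat) (ts : 'I_s -> nat)
    (T : 'I_s -> mgraph) (root : forall i, vertex (T i))
    (p : 'I_s -> vertex (cycle_graph l_gt1)) (Lambda : mgraph) :
  t = \sum_i ts i -> (forall i, is_tree (T i) /\ #|edge (T i)| = ts i) ->
  connected_mgraph Lambda -> isomorphic (attach root p) Lambda ->
  exists (V : nat -> nat) (ve : 'I_(l + t) -> vertex Lambda)
         (ed : 'I_(l + t) -> edge Lambda),
    [/\ forall i, i < l -> V i = i.+1 %% l,
        forall i, l <= i < l + t -> V i < i,
        bijective ve, bijective ed &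
        forall i j : 'I_(l + t), j = V i :> nat -> ends (ed i) = [set ve i; ve j]].
Proof.
move=> tE treeT conn /is_copyP[[f g] /embP[fi gi h]] [fS gS].
have [cV cE] := attach_card root p.
have Ecard : #|edge Lambda| = l + t.
  rewrite -cardsT -gS card_imset// cardsT cE card_ord tE; congr (_ + _).
  by apply: eq_bigr => i _; have [] := treeT i.
have Vcard : l + t <= #|vertex Lambda|.
  rewrite -(cardsT (vertex Lambda)) -fS card_imset// cardsT cV card_ord tE leq_add2l.
  apply: leq_sum => i _; have [[Tc Ta] <-] := treeT i.
  by have := acyclic_card Tc Ta; case: #|vertex (T i)|.
pose c (i : 'I_l) : vertex Lambda := f (inl i).
pose ce (i : 'I_l) : edge Lambda := g (inl i).
have c_inj : injective c by move=> i j /fi [].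
have ce_inj : injective ce by move=> i j /gi [].
have cends i : ends (ce i) = [set c i; c (ordS i)].
  rewrite h /= -imset_comp /cycle_ends imsetU !imset_set1 //.
have l0 : 0 < l by exact: ltnW.
pose v0 := c (Ordinal l0); pose e0 := ce (Ordinal l0).
pose vs0 := [seq c i | i <- enum 'I_l]; pose es0 := [seq ce i | i <- enum 'I_l].
have sv0 : size vs0 = l by rewrite size_map size_enum_ord.
have se0 : size es0 = l by rewrite size_map size_enum_ord.
have [|||||vs [es [V [uv ue sv se [sub step]]]]] := @grow_enum _ conn v0 vs0 es0 t.
- by rewrite map_inj_uniq ?enum_uniq.
- by rewrite map_inj_uniq ?enum_uniq.
- by rewrite sv0.
- move=> _ /mapP[i _ ->] x; rewrite cends !inE => /orP[] /eqP ->;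
  by apply: map_f; rewrite mem_enum.
- by rewrite sv0.
have esall e : e \in es0 ++ es.
  by apply: uniq_full => //; rewrite size_cat se se0 Ecard.
(* So far the number of vertices is only bounded from below. A vertex that is not listed would be
   separated by a crossing edge, but all edges are listed and have both ends among the listed
   vertices. *)
have vsall v : v \in vs0 ++ vs.
  apply: contraT => vS.
  have uS : v0 \in vs0 ++ vs by rewrite mem_cat map_f// mem_enum.
  have [e [x [y [xS yS he]]]] := crossing_edge conn (S := mem (vs0 ++ vs)) uS vS.
  by move: yS; rewrite /= (sub e (esall e) y)// he !inE eqxx orbT.
exists (fun i => if i < l then i.+1 %% l else V (i - l)).
exists (fun i => nth v0 (vs0 ++ vs) i), (fun i => nth e0 (es0 ++ es) i).
have sve : size (vs0 ++ vs) = l + t by rewrite size_cat sv0 sv.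
have see : size (es0 ++ es) = l + t by rewrite size_cat se0 se.
split.
- by move=> i ->.
- move=> i /andP[li ik]; have -> : (i < l) = false by rewrite ltnNge li.
  have [|Vi _] := step (i - l); first by rewrite ltn_subLR.
  by rewrite sv0 subnKC in Vi.
- apply: inj_card_bij.
    by move=> i j /eqP; rewrite nth_uniq ?sve// => /eqP/val_inj.
  rewrite card_ord; apply: leq_trans (_ : #|vs0 ++ vs| <= _).
    by apply/subset_leq_card/subsetP => v _; exact: vsall.
  by rewrite (card_uniqP uv) sve.
- apply: inj_card_bij.
    by move=> i j /eqP; rewrite nth_uniq ?see// => /eqP/val_inj.
  by rewrite card_ord Ecard.
move=> i j; case: (ltnP i l) => il jE.
  rewrite !nth_cat sv0 se0 il jE ltn_mod l0.
  rewrite -[i.+1 %% l]/(val (ordS (Ordinal il))) -[nat_of_ord i]/(val (Ordinal il)).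
  by rewrite !nth_map_enum_ord cends.
rewrite [nth e0 _ _]nth_cat [nth v0 _ i]nth_cat sv0 se0 ltnNge il /= jE.
have [|_ ->//] := step (i - l).
by rewrite ltn_subLR.
Qed.

End StandardForm.

(** The later end of an edge makes the choice and the earlier one is chosen. Ordering the ends thus
    separates a condition on the edge from one on the outcome. *)
Lemma pair_set_maxmin (n : nat) (a b u v : 'I_n) : b < a ->
  ([set a; b] == [set u; v]) = (a == maxn u v :> nat) && (b == minn u v :> nat).
Proof.
move=> ba; apply/eqP/andP => [h|[/eqP am /eqP bm]]; last first.
  case: (leqP u v) am bm => uv am bm.
    by rewrite (_ : a = v) 1?(_ : b = u) 1?setUC//; apply: val_inj.
  by rewrite (_ : a = u) 1?(_ : b = v)//; apply: val_inj.
have /set2P[au|av] : a \in [set u; v] by rewrite -h set21.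
  have /set2P[bu|bv] : b \in [set u; v] by rewrite -h set22.
    by move: ba; rewrite au bu ltnn.
  by rewrite -au -bv (maxn_idPl (ltnW ba)) (minn_idPr (ltnW ba)).
have /set2P[bu|bv] : b \in [set u; v] by rewrite -h set22.
  by rewrite -av -bu (maxn_idPr (ltnW ba)) (minn_idPl (ltnW ba)).
by move: ba; rewrite av bv ltnn.
Qed.

Section StandardEmbeddings.
Variables (k m n : nat) (H : mgraph) (ve : 'I_k -> vertex H) (ed : 'I_k -> edge H).
Variable U : 'I_k -> 'I_k.
Variables (ve' : vertex H -> 'I_k) (ed' : edge H -> 'I_k).
Hypotheses (veK : cancel ve ve') (ve'K : cancel ve' ve).
Hypotheses (edK : cancel ed ed') (ed'K : cancel ed' ed).
Hypothesis ends_ed : forall i, ends (ed i) = [set ve i; ve (U i)].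
Variable w : ua_space m n.

Definition emb_of_tuples (a : {ffun 'I_k -> 'I_n} * {ffun 'I_k -> ua_edge m n}) :
    {ffun vertex H -> vertex (ua_graph w)} * {ffun edge H -> edge (ua_graph w)} :=
  ([ffun v => a.1 (ve' v)], [ffun e => a.2 (ed' e)]).

Lemma emb_of_tuples_bij : bijective emb_of_tuples.
Proof.
exists (fun q : {ffun vertex H -> 'I_n} * {ffun edge H -> ua_edge m n} =>
  ([ffun i => q.1 (ve i)], [ffun i => q.2 (ed i)])) => [[x g]|[f g]].
  by congr (_, _); apply/ffunP => i; rewrite !ffunE /= ?veK ?edK.
by congr (_, _); apply/ffunP => i; rewrite !ffunE /= ?ve'K ?ed'K.
Qed.

Lemma emb_of_tuplesE a : (emb_of_tuples a \in emb H (ua_graph w)) =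
  [&& injectiveb a.1, injectiveb a.2 &
   [forall i, ((val (a.2 i)).1 == maxn (a.1 i) (a.1 (U i)) :> nat) &&
              (w (a.2 i) == minn (a.1 i) (a.1 (U i)) :> nat)]].
Proof.
have endsE i : (ua_ends w (a.2 i) == [set a.1 i; a.1 (U i)]) =
  ((val (a.2 i)).1 == maxn (a.1 i) (a.1 (U i)) :> nat) &&
              (w (a.2 i) == minn (a.1 i) (a.1 (U i)) :> nat).
  by rewrite /ua_ends pair_set_maxmin//=; exact: ltn_ord.
have imE i : [ffun v => a.1 (ve' v)] @: ends (ed i) = [set a.1 i; a.1 (U i)] :> {set 'I_n}.
  by rewrite ends_ed imsetU1 imset_set1 !ffunE !veK.
apply/embP/and3P => -[/= h1 h2 h3]; split.
- by apply/injectiveP => i j ij; rewrite -(veK i) -(veK j) (h1 (ve i) (ve j))// !ffunE !veK.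
- by apply/injectiveP => i j ij; rewrite -(edK i) -(edK j) (h2 (ed i) (ed j))// !ffunE !edK.
- apply/forallP => i; rewrite -endsE -imE -h3 ffunE edK; exact: eqxx.
- move=> u v; rewrite !ffunE => /(injectiveP _ h1) uv.
  by rewrite -(ve'K u) -(ve'K v) uv.
- move=> u v; rewrite !ffunE => /(injectiveP _ h2) uv.
  by rewrite -(ed'K u) -(ed'K v) uv.
- move=> e; rewrite -(ed'K e) imE ffunE edK; apply/eqP.
  by have /forallP/(_ (ed' e)) := h3; rewrite -endsE.
Qed.

End StandardEmbeddings.

From mathcomp Require Import all_classical all_reals all_analysis.
From mathcomp Require Import measurable_realfun ring lra.

Import Order.TTheory GRing.Theory Num.Theory.
Import numFieldNormedType.Exports.
Local Open Scope classical_set_scope.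
Local Open Scope ring_scope.

(** * Stein's equation for the normal law *)

Section NormalIntegral.
Variable R : realType.
Local Notation leb := (@lebesgue_measure R).
Local Notation nu := (@normal_prob R 0 1).

(** [normal_pdf] and the Radon-Nikodym derivative of [nu] have the same integrals over measurable
    sets, hence agree almost everywhere. The nonnegative case yields, in [integrable_normal_prob],
    the integrability that the next lemma assumes. *)
Lemma ge0_integral_normal_prob (f : R -> \bar R) :
  measurable_fun [set: R] f -> (forall x, 0 <= f x)%E ->
  (\int[nu]_x f x = \int[leb]_x (f x * (normal_pdf 0 1 x)%:E))%E.
Proof.
move=> mf f0; have dom := @normal_prob_dominates R 0 1.
rewrite -(Radon_Nikodym_SigmaFinite.change_of_variables dom)//.
have intg := Radon_Nikodym_SigmaFinite.f_integrable dom.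
apply: ae_eq_integral => //.
- by apply: emeasurable_funM => //; exact: (measurable_int leb).
- apply: emeasurable_funM => //=; apply/measurable_EFinP.
  exact: measurable_normal_pdf.
- apply: ae_eqe_mul2l; apply: integral_ae_eq => //=.
  + by apply/measurable_EFinP; exact: measurable_normal_pdf.
  + by move=> E _ mE; rewrite -Radon_Nikodym_SigmaFinite.f_integral.
Qed.

Lemma integral_normal_prob (f : R -> \bar R) :
  nu.-integrable [set: R] f ->
  (\int[nu]_x f x = \int[leb]_x (f x * (normal_pdf 0 1 x)%:E))%E.
Proof.
move=> intf; have dom := @normal_prob_dominates R 0 1.
have mf : measurable_fun [set: R] f by case/integrableP : intf.
rewrite -(Radon_Nikodym_change_of_variables dom)//=.
have intg : leb.-integrable [set: R]
    (Radon_Nikodym (charge_of_finite_measure nu) leb).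
  exact: Radon_Nikodym_integrable.
apply: ae_eq_integral => //.
- by apply: emeasurable_funM => //; exact: (measurable_int leb).
- apply: emeasurable_funM => //=; apply/measurable_EFinP.
  exact: measurable_normal_pdf.
- apply: ae_eqe_mul2l; apply: integral_ae_eq => //=.
  + by apply/measurable_EFinP; exact: measurable_normal_pdf.
  + by move=> E _ mE; rewrite -Radon_Nikodym_integral.
Qed.

Definition gauss (x : R) : R := expR (- x ^+ 2 / 2).

Lemma normal_pdf01E (x : R) : normal_pdf 0 1 x = normal_peak 1 * gauss x.
Proof.
rewrite normal_pdfE ?oner_eq0// /normal_fun /gauss subr0 expr1n.
by [].
Qed.

Lemma gauss_gt0 (x : R) : 0 < gauss x. Proof. exact: expR_gt0. Qed.

Lemma is_derive_gauss (x : R) : is_derive x 1 gauss (- (x * gauss x)).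
Proof.
rewrite /gauss.
apply: is_derive_eq.
rewrite /GRing.scale /=; by field.
Qed.

(** The polynomial factor is absorbed by doubling the variance, because
    [1 + x^2 <= 4 exp (x^2 / 4)]; integrability then comes from that of another normal density. *)
Lemma sq_normal_pdf_le (x : R) :
  (1 + x ^+ 2) * normal_pdf 0 1 x <=
  4 * normal_peak 1 / normal_peak (Num.sqrt 2) * normal_pdf 0 (Num.sqrt 2) x.
Proof.
have s0 : Num.sqrt 2 != 0 :> R by rewrite gt_eqF// sqrtr_gt0.
have p0 := normal_peak_gt0 s0.
have p1 := @normal_peak_gt0 R 1 (oner_neq0 _).
rewrite normal_pdf01E (normal_pdfE _ s0) /normal_fun subr0 sqr_sqrtr//.
rewrite -!mulrA (mulrA _^-1) mulVf ?gt_eqF// mul1r.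
rewrite mulrCA [leRHS]mulrCA ler_pM2l//.
have -> : gauss x = expR (- x ^+ 2 / (2 *+ 2)) * expR (- (x ^+ 2 / 4)).
  by rewrite -expRD /gauss; congr expR; lra.
have h : 1 + x ^+ 2 <= 4 * expR (x ^+ 2 / 4).
  have := @expR_ge1Dx R (x ^+ 2 / 4); nra.
rewrite mulrCA [leRHS]mulrC ler_pM2l ?expR_gt0//.
rewrite expRN -ler_pdivlMr ?invr_gt0 ?expR_gt0// invrK; exact: h.
Qed.

Lemma integrable_sq_normal_pdf :
  leb.-integrable [set: R] (fun x => ((1 + x ^+ 2) * normal_pdf 0 1 x)%:E).
Proof.
have H : leb.-integrable [set: R] (fun x => (4 * normal_peak 1 / normal_peak (Num.sqrt 2) * normal_pdf 0 (Num.sqrt 2) x)%:E).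
  under eq_fun do rewrite EFinM.
  by apply: integrableZl => //; exact: integrable_normal_pdf.
apply: (le_integrable _ _ _ H) => //.
  apply/measurable_EFinP; apply: measurable_funM; last exact: measurable_normal_pdf.
  by apply: measurable_funD => //; exact: measurable_funX.
move=> x _ /=; rewrite lee_fin ger0_norm.
  by apply: le_trans (ler_norm _); exact: sq_normal_pdf_le.
by rewrite mulr_ge0 ?normal_pdf_ge0// addr_ge0 ?sqr_ge0.
Qed.

Lemma integrable_mul_normal_pdf (h : R -> R) (a : R) :
  measurable_fun [set: R] h -> (forall x, `|h x| <= a * (1 + x ^+ 2)) ->
  leb.-integrable [set: R] (fun x => (h x * normal_pdf 0 1 x)%:E).
Proof.
move=> mh hle.
have H : leb.-integrable [set: R] (fun x => (a * ((1 + x ^+ 2) * normal_pdf 0 1 x))%:E).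
  under eq_fun do rewrite EFinM.
  by apply: integrableZl => //; exact: integrable_sq_normal_pdf.
apply: (le_integrable _ _ _ H) => //.
  apply/measurable_EFinP; apply: measurable_funM => //; exact: measurable_normal_pdf.
move=> x _ /=; rewrite lee_fin normrM (ger0_norm (normal_pdf_ge0 _ _ _)).
apply: le_trans (ler_norm _).
by rewrite mulrA ler_wpM2r ?normal_pdf_ge0.
Qed.

Lemma integrable_normal_prob (h : R -> R) (a : R) :
  measurable_fun [set: R] h -> (forall x, `|h x| <= a * (1 + x ^+ 2)) ->
  nu.-integrable [set: R] (EFin \o h).
Proof.
move=> mh hle; apply/integrableP; split; first exact/measurable_EFinP.
rewrite ge0_integral_normal_prob//; last first.
  by apply/measurable_EFinP; exact: measurableT_comp.
have /integrableP[_] := integrable_mul_normal_pdf mh hle.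
apply: le_lt_trans; rewrite le_eqVlt; apply/orP; left; apply/eqP.
apply: eq_integral => x _ /=.
by rewrite normrM (ger0_norm (normal_pdf_ge0 _ _ _)).
Qed.

Lemma integral_normal_probE (h : R -> R) (a : R) :
  measurable_fun [set: R] h -> (forall x, `|h x| <= a * (1 + x ^+ 2)) ->
  (\int[nu]_x (h x)%:E)%E =
  (\int[leb]_x (h x * normal_pdf 0 1 x))%:E.
Proof.
move=> mh hle; rewrite integral_normal_prob; last exact: integrable_normal_prob hle.
rewrite /Rintegral fineK; first by apply: eq_integral => x _; rewrite EFinM.
by apply: integrable_fin_num => //; exact: integrable_mul_normal_pdf hle.
Qed.

End NormalIntegral.

(** * Bounds for the solution of Stein's equation *)

Section SteinEquation.
Variable R : realType.
Implicit Types x y z C : R.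
Local Notation leb := (@lebesgue_measure R).
Local Notation phi := (@normal_pdf R 0 1).

Lemma normal_pdf01_gt0 (x : R) : 0 < phi x.
Proof.
by rewrite normal_pdf01E mulr_gt0 ?gauss_gt0// normal_peak_gt0// oner_eq0.
Qed.

Lemma normal_pdf01N (x : R) : phi (- x) = phi x.
Proof. by rewrite !normal_pdf01E /gauss sqrrN. Qed.

Lemma is_derive_normal_pdf01 (x : R) : is_derive x 1 phi (- (x * phi x)).
Proof.
have -> : phi = (fun x => normal_peak 1 *: gauss x) :> (R -> R).
  by apply/funext => y; rewrite normal_pdf01E.
have h := is_derive_gauss x.
by apply: is_derive_eq; rewrite /GRing.scale /=; ring.
Qed.

Lemma normal_pdf01_decay (y : R) : (1 + y ^+ 2) * phi y <= 2 * normal_peak 1.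
Proof.
rewrite normal_pdf01E mulrCA [leRHS]mulrC ler_pM2l ?normal_peak_gt0 ?oner_eq0//.
have := @expR_ge1Dx R (y ^+ 2 / 2).
have -> : gauss y = (expR (y ^+ 2 / 2))^-1 by rewrite -expRN /gauss mulNr.
move=> h; rewrite ler_pdivrMr ?expR_gt0//; lra.
Qed.

Lemma is_derive_continuous (f : R -> R) (df : R -> R) :
  (forall x : R, is_derive x 1 f (df x)) -> continuous f.
Proof.
move=> h x; apply/differentiable_continuous/derivable1_diffP.
by have [] := h x.
Qed.

Lemma derive_le0_nincr_pos (f df : R -> R) :
  (forall x : R, 0 < x -> is_derive x 1 f (df x)) ->
  (forall x, 0 < x -> df x <= 0) ->
  forall x y, 0 < x -> x <= y -> f y <= f x.
Proof.
move=> dfE df0 x y x0 xy.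
have [||c] := @MVT_segment R f df x y xy.
- move=> z; rewrite in_itv/= => /andP[xz _]; apply: dfE; exact: lt_trans xz.
- apply: derivable_within_continuous => z; rewrite in_itv/= => /andP[xz _].
  by have [] := dfE z (lt_le_trans x0 xz).
rewrite in_itv/= => /andP[xc _] fE.
rewrite -subr_le0 fE mulr_le0_ge0 ?subr_ge0// df0//; exact: lt_le_trans xc.
Qed.

(* [G + F] is nonincreasing, and its limit at infinity is nonnegative. *)
Lemma barrier_ge (F p G dG : R -> R) (C : R) :
  (forall x : R, 0 < x -> is_derive x 1 F (p x)) ->
  (forall x : R, 0 < x -> is_derive x 1 G (dG x)) ->
  (forall x, 0 < x -> p x <= - dG x) -> (forall x, 0 < x -> 0 <= G x) ->
  (forall y, 0 < y -> - (C / y) <= F y) ->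
  forall x, 0 < x -> 0 <= G x + F x.
Proof.
move=> dF dGE pG G0 FC x x0; rewrite leNgt; apply/negP => neg.
pose e := - (G x + F x); have e0 : 0 < e by rewrite oppr_gt0.
pose y := Num.max x ((`|C| + 1) / e).
have xy : x <= y by rewrite le_max lexx.
have y0 : 0 < y by apply: lt_le_trans xy.
have mono : G y + F y <= G x + F x.
  apply: (@derive_le0_nincr_pos (fun z => G z + F z) (fun z => dG z + p z)) => //.
  - by move=> z z0; have := dF z z0; have := dGE z z0; move=> ? ?; exact: is_deriveD.
  - by move=> z z0; have := pG z z0; lra.
have : C < e * y.
  have : (`|C| + 1) / e <= y by rewrite le_max lexx orbT.
  rewrite ler_pdivrMr// mulrC; have := ler_norm C; lra.
rewrite -ltr_pdivrMr//.
have := FC y y0; have := G0 y y0; rewrite /e; lra.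
Qed.

Lemma barrier (F p G dG : R -> R) (C : R) :
  (forall x : R, 0 < x -> is_derive x 1 F (p x)) ->
  (forall x : R, 0 < x -> is_derive x 1 G (dG x)) ->
  (forall x, 0 < x -> `|p x| <= - dG x) -> (forall x, 0 < x -> 0 <= G x) ->
  (forall y, 0 < y -> `|F y| <= C / y) ->
  forall x, 0 < x -> `|F x| <= G x.
Proof.
move=> dF dGE pG G0 FC x x0; rewrite ler_norml; apply/andP; split.
  rewrite -subr_ge0 opprK addrC; apply: (@barrier_ge _ p G dG C) x0 => //.
  - by move=> z z0; apply: le_trans (pG z z0); exact: ler_norm.
  - by move=> y y0; have := FC y y0; rewrite ler_norml => /andP[].
rewrite -subr_ge0.
apply: (@barrier_ge (fun z => - F z) (fun z => - p z) G dG C) x0 => //.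
- by move=> z z0; have := dF z z0 => ?; exact: is_deriveN.
- by move=> z z0; apply: le_trans (pG z z0); rewrite -normrN; exact: ler_norm.
- by move=> y y0; have := FC y y0; rewrite ler_norml lerN2 => /andP[].
Qed.

Section HalfLine.
Variables (F g dg : R -> R) (A C : R).
Hypothesis dF : forall x : R, is_derive x 1 F (g x * phi x).
Hypothesis dgE : forall x : R, is_derive x 1 g (dg x).
Hypothesis dg1 : forall x, `|dg x| <= 1.
Hypothesis A0 : 0 <= A.
Hypothesis gA : forall x, 0 < x -> `|g x| <= x + A.
Hypothesis FC : forall y, 0 < y -> `|F y| <= C / y.

(** As [F] is a primitive of [g * phi], this solves [f' - x f = g]; the decay of [F] selects the
    solution that stays bounded. *)
Definition stein_sol (x : R) : R := F x / phi x.
Definition stein_sol' (x : R) : R := x * stein_sol x + g x.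

Lemma is_derive_stein_sol (x : R) : is_derive x 1 stein_sol (stein_sol' x).
Proof.
have p0 : phi x != 0 by rewrite gt_eqF ?normal_pdf01_gt0.
have h1 := dF x; have h2 := is_derive_normal_pdf01 x.
have h3 := @is_deriveV _ phi x _ 1 p0 h2.
have := is_deriveM h1 h3 => h4.
apply: (@is_derive_eq _ _ _ (F * (fun y => (phi y)^-1)) x 1 _ _ h4).
by rewrite /stein_sol' /stein_sol /GRing.scale /=; field.
Qed.

Lemma is_derive_stein_sol' (x : R) :
  is_derive x 1 stein_sol' (stein_sol x + x * stein_sol' x + dg x).
Proof.
have h1 := is_derive_stein_sol x; have h2 := dgE x.
have h3 := is_deriveM (is_derive_id x (1 : R)) h1.
have h4 := is_deriveD h3 h2.
apply: (@is_derive_eq _ _ _ _ x 1 _ _ h4).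
by rewrite /GRing.scale /=; ring.
Qed.

(** The barrier for [F] is [(1 + 2 A / (1 + y)) phi y]. In minus its derivative, the term 1 accounts
    for [y], and the other term exceeds [A] by [A (1 + y^2) / (1 + y)^2 - 0 >= 0]. *)
Lemma stein_sol_bound x : 0 < x -> `|stein_sol x| <= 1 + 2 * A.
Proof.
move=> x0; rewrite /stein_sol normrM normfV (gtr0_norm (normal_pdf01_gt0 _)).
rewrite ler_pdivrMr ?normal_pdf01_gt0//.
pose G (y : R) := (1 + 2 * A / (1 + y)) * phi y.
pose dG (y : R) := (- (2 * A / (1 + y) ^+ 2) - y * (1 + 2 * A / (1 + y))) * phi y.
apply: (@le_trans _ _ (G x)).
  apply: (@barrier F (fun y => g y * phi y) G dG C) x0.
  - move=> y y0; have y1 : 1 + y != 0 by rewrite gt_eqF// addr_gt0.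
    have h2 := is_derive_normal_pdf01 y.
    have h3 : is_derive y 1 (fun z : R => 1 + z) 1.
      apply: (@is_derive_eq _ _ _ _ _ _ _ _ (is_deriveD (is_derive_cst (1:R) y 1) (is_derive_id y (1 : R)))).
      by rewrite add0r.
    have h4 := is_deriveV y1 h3.
    have h5 : is_derive y 1 (fun z : R => 1 + 2 * A / (1 + z)) (- (2 * A / (1 + y) ^+ 2)).
      apply: (@is_derive_eq _ _ _ _ _ _ _ _ (is_deriveD (is_derive_cst (1:R) y 1) (is_deriveZ (2 * A) h4))).
      by rewrite /GRing.scale /=; ring.
    apply: (@is_derive_eq _ _ _ _ _ _ _ _ (is_deriveM h5 h2)).
    by rewrite /dG /GRing.scale /=; field.
  - move=> y y0; rewrite normrM (gtr0_norm (normal_pdf01_gt0 _)) /dG -mulNr.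
    rewrite ler_pM2r ?normal_pdf01_gt0//.
    apply: le_trans (gA y0) _.
    have y1 : 1 + y != 0 by rewrite gt_eqF// addr_gt0.
    rewrite -subr_ge0.
    have -> : - (- (2 * A / (1 + y) ^+ 2) - y * (1 + 2 * A / (1 + y))) - (y + A) =
      A * (1 + y ^+ 2) / (1 + y) ^+ 2 by field.
    by rewrite divr_ge0 ?sqr_ge0// mulr_ge0// addr_ge0 ?sqr_ge0.
  - move=> y y0; rewrite mulr_ge0 ?(ltW (normal_pdf01_gt0 _))// addr_ge0//.
    by rewrite divr_ge0// ?mulr_ge0// addr_ge0 ?ltW.
  - exact: FC.
rewrite /G ler_pM2r ?normal_pdf01_gt0// lerD2l ler_pdivrMr ?addr_gt0//.
by rewrite ler_peMr ?mulr_ge0// lerDl ltW.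
Qed.

(** The derivative of [stein_sol' * phi] is [(stein_sol + dg) phi], as the terms in [y * stein_sol']
    cancel. It is at most [(2 + 2 A) phi], for which [(2 + 2 A) / y * phi] is a barrier. *)
Lemma stein_sol'_bound x : 0 < x -> `|x * stein_sol' x| <= 2 + 2 * A.
Proof.
move=> x0; rewrite normrM (gtr0_norm x0) mulrC -ler_pdivlMr//.
rewrite -(ler_pM2r (normal_pdf01_gt0 x)) -{1}(gtr0_norm (normal_pdf01_gt0 x)).
rewrite -normrM.
pose Q y := stein_sol' y * phi y.
pose p y := (stein_sol y + dg y) * phi y.
pose G (y : R) := (2 + 2 * A) / y * phi y.
pose dG (y : R) := (- ((2 + 2 * A) / y ^+ 2) - (2 + 2 * A)) * phi y.
apply: (@barrier Q p G dG (((2 + 2 * A) + A) * (2 * normal_peak 1))) x0.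
- move=> y y0; apply: (@is_derive_eq _ _ _ _ _ _ _ _
    (is_deriveM (is_derive_stein_sol' y) (is_derive_normal_pdf01 y))).
  by rewrite /p /GRing.scale /=; ring.
- move=> y y0; have y1 : y != 0 by rewrite gt_eqF.
  have h2 := is_derive_normal_pdf01 y.
  have h4 : is_derive y 1 (fun z : R => (2 + 2 * A) * z^-1) (- ((2 + 2 * A) / y ^+ 2)).
    apply: (@is_derive_eq _ _ _ _ _ _ _ _ (is_deriveZ (2 + 2 * A) (is_deriveV y1 (is_derive_id y (1 : R))))).
    by rewrite /GRing.scale /=; ring.
  apply: (@is_derive_eq _ _ _ _ _ _ _ _ (is_deriveM h4 h2)).
  by rewrite /dG /GRing.scale /=; field.
- move=> y y0; rewrite normrM (gtr0_norm (normal_pdf01_gt0 _)) /dG -mulNr.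
  rewrite ler_pM2r ?normal_pdf01_gt0//.
  apply: le_trans (ler_normD _ _) _.
  have := stein_sol_bound y0; have := dg1 y.
  have : 0 <= (2 + 2 * A) / y ^+ 2 by rewrite divr_ge0 ?sqr_ge0// addr_ge0// mulr_ge0.
  lra.
- move=> y y0; rewrite mulr_ge0 ?(ltW (normal_pdf01_gt0 _))// divr_ge0 ?(ltW y0)//.
  by rewrite addr_ge0// mulr_ge0.
- move=> y y0; rewrite ler_pdivlMr// /Q normrM (gtr0_norm (normal_pdf01_gt0 _)).
  have h : `|stein_sol' y| * y <= (2 + 2 * A + A) * (1 + y ^+ 2).
    rewrite -ler_pdivlMr//.
    apply: le_trans (ler_normD _ _) _; rewrite normrM (gtr0_norm y0).
    apply: (@le_trans _ _ (y * (1 + 2 * A) + (y + A))).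
      by rewrite lerD ?gA// ler_pM2l// stein_sol_bound.
    rewrite ler_pdivlMr//.
    have -> : (y * (1 + 2 * A) + (y + A)) * y = (2 + 2 * A) * y ^+ 2 + A * y by ring.
    have hA : 0 <= A * (1 + y ^+ 2 - y).
      by apply: mulr_ge0 => //; have := sqr_ge0 (y - 1); nra.
    have := A0; lra.
  rewrite mulrAC; apply: (@le_trans _ _ ((2 + 2 * A + A) * (1 + y ^+ 2) * phi y)).
    by rewrite ler_pM2r ?normal_pdf01_gt0.
  rewrite -mulrA; apply: ler_wpM2l; last exact: normal_pdf01_decay.
  by have := A0; lra.
Qed.

(** The second derivative is [stein_sol + x * stein_sol' + dg], and the three bounds add up to
    [(1 + 2 A) + (2 + 2 A) + 1]. *)
Lemma stein_sol'_lip x y : 0 <= x -> x <= y ->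
  `|stein_sol' y - stein_sol' x| <= (4 + 4 * A) * (y - x).
Proof.
move=> x0 xy.
have cv := is_derive_continuous is_derive_stein_sol'.
move: xy; rewrite le_eqVlt => /predU1P[->|xy]; first by rewrite !subrr normr0 mulr0.
have [|c] := @MVT R stein_sol' _ x y xy (fun z _ => is_derive_stein_sol' z).
  exact: continuous_subspaceT.
rewrite in_itv/= => /andP[xc _] ->.
have c0 : 0 < c by exact: le_lt_trans xc.
rewrite normrM (gtr0_norm (_ : 0 < y - x)) ?subr_gt0// ler_pM2r ?subr_gt0//.
have := stein_sol_bound c0; have := stein_sol'_bound c0; have := dg1 c.
have := ler_normD (stein_sol c + c * stein_sol' c) (dg c).
have := ler_normD (stein_sol c) (c * stein_sol' c); lra.
Qed.

End HalfLine.

Lemma lip1_continuous (h : R -> R) :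
  (forall x y, `|h x - h y| <= `|x - y|) -> continuous h.
Proof.
move=> hl x; apply/cvgrPdist_lt => e e0; near=> y.
apply: le_lt_trans (hl x y) _; near: y.
by have := @cvgr_dist_lt _ _ _ (nbhs x) _ id x; apply.
Unshelve. all: by end_near. Qed.

Lemma lip1_growth (h : R -> R) : (forall x y, `|h x - h y| <= `|x - y|) ->
  forall x, `|h x| <= (1 + `|h 0|) * (1 + x ^+ 2).
Proof.
move=> hl x; have := hl x 0; rewrite subr0 => h1.
have : `|h x| <= `|h 0| + `|x|.
  by rewrite -[h x](subrK (h 0)) addrC; apply: le_trans (ler_normD _ _) _; rewrite lerD2l.
have -> : x ^+ 2 = `|x| ^+ 2 by rewrite real_normK ?num_real.
have := normr_ge0 (h 0); have := normr_ge0 x; have := sqr_ge0 (`|x| - 1); nra.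
Qed.

Lemma derive_le1_lip1 (h dh : R -> R) :
  (forall x : R, is_derive x 1 h (dh x)) -> (forall x, `|dh x| <= 1) ->
  forall x y, `|h x - h y| <= `|x - y|.
Proof.
move=> dhE dh1.
have ch := is_derive_continuous dhE.
suff H x y : x <= y -> `|h y - h x| <= `|y - x|.
  move=> x y; have [xy|/ltW yx] := leP x y; last exact: H.
  by rewrite distrC [leRHS]distrC; exact: H.
move=> xy; have [|c _ ->] := @MVT_segment R h _ x y xy (fun z _ => dhE z).
  exact: continuous_subspaceT.
by rewrite normrM ler_piMl.
Qed.

Lemma ge0_Rintegral_subset (D : set R) (f : R -> R) : measurable D ->
  leb.-integrable [set: R] (EFin \o f) -> (forall x, 0 <= f x) ->
  \int[leb]_(x in D) f x <= \int[leb]_x f x.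
Proof.
move=> mD fi f0; rewrite -[X in _ <= X](congr1 (fun E => \int[leb]_(x in E) f x) (setUv D)) Rintegral_setU//; last 3 first.
- exact: measurableC.
- by rewrite setUv.
- by apply/disj_setPCl.
by rewrite lerDl Rintegral_ge0.
Qed.

Definition normal_abs_moment : R := \int[leb]_x (`|x| * phi x).

Lemma normal_abs_moment_ge0 : 0 <= normal_abs_moment.
Proof. by rewrite Rintegral_ge0// => x _; rewrite mulr_ge0// normal_pdf_ge0. Qed.

Lemma norm_integrable_normal : leb.-integrable [set: R] (fun x => (`|x| * phi x)%:E).
Proof.
apply: (@integrable_mul_normal_pdf _ _ 1); first exact: normr_measurable.
move=> x; rewrite normr_id mul1r.
have -> : x ^+ 2 = `|x| ^+ 2 by rewrite real_normK ?num_real.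
have := sqr_ge0 (`|x| - 1); have := normr_ge0 x; nra.
Qed.

Lemma Rintegral_normal_pdf : \int[leb]_x phi x = 1.
Proof. by rewrite /Rintegral integral_normal_pdf. Qed.

Lemma lip1_mean_dist (h : R -> R) (x : R) :
  (forall x y, `|h x - h y| <= `|x - y|) ->
  `|h x - \int[leb]_z (h z * phi z)| <= `|x| + normal_abs_moment.
Proof.
move=> hl; have ch := lip1_continuous hl.
have mh : measurable_fun [set: R] h by exact: continuous_measurable_fun.
have ih := integrable_mul_normal_pdf mh (lip1_growth hl).
have ip := @integrable_normal_pdf R 0 1.
have ic (c : R) : leb.-integrable [set: R] (fun z => (c * phi z)%:E).
  by under eq_fun do rewrite EFinM; exact: integrableZl.
have -> : h x - \int[leb]_z (h z * phi z) =
    \int[leb]_z (h x * phi z - h z * phi z).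
  rewrite RintegralB//; last exact: ic.
  by rewrite RintegralZl// Rintegral_normal_pdf mulr1.
have id : leb.-integrable [set: R] (EFin \o (fun t => h x * phi t - h t * phi t)).
  rewrite (_ : _ \o _ = (fun t => (h x * phi t)%:E - (h t * phi t)%:E)%E).
    by apply: integrableB => //; exact: ic.
  by apply/funext => t; rewrite /= EFinB.
apply: le_trans (le_normr_Rintegral _ _) _ => //.
have -> : `|x| + normal_abs_moment = \int[leb]_z (`|x| * phi z + `|z| * phi z).
  rewrite RintegralD//; [|exact: ic|exact: norm_integrable_normal].
  by rewrite RintegralZl// Rintegral_normal_pdf mulr1.
apply: le_Rintegral => //.
- exact: (integrable_norm id).
- rewrite (_ : _ \o _ = (fun t => (`|x| * phi t)%:E + (`|t| * phi t)%:E)%E).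
    by apply: integrableD => //; exact: norm_integrable_normal.
  by apply/funext => t; rewrite /= EFinD.
move=> z _; rewrite -mulrBl -mulrDl normrM (ger0_norm (normal_pdf_ge0 _ _ _)).
by rewrite ler_wpM2r ?normal_pdf_ge0// (le_trans (hl _ _))// ler_normB.
Qed.

(** Markov's inequality: on [D], [y |g|] is at most [|x| |g|], hence a multiple of [1 + x^2]. A
    decay in [1 / y] is all that [barrier] asks for. *)
Lemma normal_tail (g : R -> R) (a y : R) (D : set R) : measurable D ->
  measurable_fun [set: R] g -> 0 <= a -> (forall x, `|g x| <= a + `|x|) ->
  0 < y -> (forall x, D x -> y <= `|x|) ->
  `|\int[leb]_(x in D) (g x * phi x)| <=
    ((a + 1) * 2 * \int[leb]_x ((1 + x ^+ 2) * phi x)) / y.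
Proof.
move=> mD mg a0 ga y0 Dy.
have gb x : `|g x| <= (a + 1) * (1 + x ^+ 2).
  apply: le_trans (ga x) _.
  have -> : x ^+ 2 = `|x| ^+ 2 by rewrite real_normK ?num_real.
  have := sqr_ge0 (`|x| - 1); have := normr_ge0 x; nra.
have ig := integrable_mul_normal_pdf mg gb.
have igD : leb.-integrable D (EFin \o (fun x => g x * phi x)).
  exact: integrableS ig.
have i2 := @integrable_sq_normal_pdf R.
apply: le_trans (le_normr_Rintegral _ _) _ => //.
have inD : leb.-integrable D (EFin \o (fun x => `|g x * phi x|)) := integrable_norm igD.
rewrite ler_pdivlMr// mulrC.
have -> : y * \int[leb]_(t in D) `|g t * phi t| = \int[leb]_(t in D) (y * `|g t * phi t|).
  by rewrite RintegralZl.
apply: (@le_trans _ _ (\int[leb]_(x in D) ((a + 1) * 2 * ((1 + x ^+ 2) * phi x)))).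
  apply: le_Rintegral => //.
  - rewrite (_ : _ \o _ = (fun t => y%:E * (`|g t * phi t|)%:E)%E) //.
    exact: integrableZl.
  - rewrite (_ : _ \o _ = (fun t => ((a + 1) * 2)%:E * ((1 + t ^+ 2) * phi t)%:E)%E) //.
    by apply: integrableZl => //; exact: integrableS i2.
  move=> x Dx; rewrite normrM (ger0_norm (normal_pdf_ge0 _ _ _)) !mulrA.
  rewrite ler_wpM2r ?normal_pdf_ge0//.
  apply: (@le_trans _ _ (`|x| * (a + `|x|))).
    by apply: ler_pM; rewrite ?(ltW y0) ?Dy ?ga.
  have -> : x ^+ 2 = `|x| ^+ 2 by rewrite real_normK ?num_real.
  have := sqr_ge0 (`|x| - 1); have := normr_ge0 x; nra.
rewrite RintegralZl//; last exact: integrableS i2.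
rewrite ler_wpM2l ?mulr_ge0 ?addr_ge0//.
apply: ge0_Rintegral_subset => // x.
by rewrite mulr_ge0 ?normal_pdf_ge0// addr_ge0 ?sqr_ge0.
Qed.

Definition stein_const : R := 4 + 4 * normal_abs_moment.

Lemma stein_equation (h dh : R -> R) :
  (forall x : R, is_derive x 1 h (dh x)) -> (forall x, `|dh x| <= 1) ->
  exists f f' : R -> R, [/\ forall x : R, is_derive x 1 f (f' x),
    forall x y, `|f' x - f' y| <= stein_const * `|x - y| &
    forall x, f' x - x * f x = h x - \int[leb]_z (h z * phi z)].
Proof.
move=> dhE dh1; have hl := derive_le1_lip1 dhE dh1.
have ch := lip1_continuous hl.
have mh : measurable_fun [set: R] h by exact: continuous_measurable_fun.
have ih := integrable_mul_normal_pdf mh (lip1_growth hl).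
have ip := @integrable_normal_pdf R 0 1.
set c := \int[leb]_z (h z * phi z).
set A := normal_abs_moment; have A0 : 0 <= A := normal_abs_moment_ge0.
pose g x := h x - c.
have gA x : `|g x| <= A + `|x| by rewrite addrC; exact: lip1_mean_dist.
have mg : measurable_fun [set: R] g by exact: measurable_funB.
have dgE x : is_derive x 1 g (dh x).
  have h1 := dhE x; apply: is_derive_eq; by rewrite subr0.
have cg : continuous g by exact: is_derive_continuous dgE.
have cp : continuous phi by apply: continuous_normal_pdf; rewrite oner_eq0.
have ig : leb.-integrable [set: R] (EFin \o (fun x => g x * phi x)).
  rewrite (_ : _ \o _ = (fun x => (h x * phi x)%:E - (c * phi x)%:E)%E); last first.
    by apply/funext => x; rewrite /= /g mulrBl EFinB.
  apply: integrableB => //; under eq_fun do rewrite EFinM; exact: integrableZl.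
have igD D : measurable D -> leb.-integrable D (EFin \o (fun x => g x * phi x)).
  by move=> mD; exact: integrableS ig.
pose F y := \int[leb]_(t in `]-oo, y]) (g t * phi t).
(* With total mass 0, the primitive from the left is also minus the integral over the right tail, so
   that [F] decays at both ends. *)
have tot : \int[leb]_t (g t * phi t) = 0.
  under eq_Rintegral do rewrite /g mulrBl.
  have icp : leb.-integrable [set: R] (fun z => (c * phi z)%:E).
    by under eq_fun do rewrite EFinM; exact: integrableZl.
  rewrite RintegralB//.
  by rewrite RintegralZl// Rintegral_normal_pdf mulr1 subrr.
have dF x : is_derive x 1 F (g x * phi x).
  have [||||d1 d2] := @continuous_FTC1 R (fun t => g t * phi t) -oo%O x (x + 1).
  - by rewrite ltrDl.
  - exact: igD.
  - by rewrite ltNyr.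
  - by apply: continuousM; [exact: cg|exact: cp].
  by rewrite -d2 derive1E; apply: DeriveDef.
have [M FM] : exists M, forall y, 0 < y -> `|F y| <= M / y /\ `|F (- y)| <= M / y.
  exists ((A + 1) * 2 * \int[leb]_x ((1 + x ^+ 2) * phi x)) => y y0; split.
    have -> : F y = - \int[leb]_(t in `]y, +oo[) (g t * phi t).
      have := @Rintegral_itvB R (fun t => g t * phi t) -oo%O +oo%O y (igD _ (measurable_itv _)).
      by rewrite set_itvNyy tot sub0r => <- //; rewrite opprK.
    rewrite normrN; apply: normal_tail => // x /=; rewrite in_itv/= andbT => yx.
    by rewrite ler_normr ltW.
  apply: normal_tail => // x /=; rewrite in_itv/= => xy.
  by rewrite ler_normr; apply/orP; right; rewrite lerNr.
have gA1 x : 0 < x -> `|g x| <= x + A.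
  by move=> x0; rewrite addrC -{2}(gtr0_norm x0).
(* The bounds above concern the positive half-line. The reflection [x -> - x], under which [phi] is
   invariant, transports them to the negative one, and the two Lipschitz estimates are glued at
   0. *)
pose gm x := g (- x); pose Fm x := - F (- x); pose dgm x := - dh (- x).
have dFm x : is_derive x 1 Fm (gm x * phi x).
  have h1 := dF (- x).
  have h2 := @is_derive1_comp _ F (@GRing.opp R) x _ _ h1 (is_deriveN (is_derive_id x (1:R))).
  apply: (@is_derive_eq _ _ _ _ _ _ _ _ (is_deriveN h2)).
  by rewrite /gm -(normal_pdf01N x) /GRing.scale /=; ring.
have dgm1 x : `|dgm x| <= 1 by rewrite normrN.
have dgmE x : is_derive x 1 gm (dgm x).
  have h1 := dgE (- x).
  have h2 := @is_derive1_comp _ g (@GRing.opp R) x _ _ h1 (is_deriveN (is_derive_id x (1:R))).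
  apply: (@is_derive_eq _ _ _ _ _ _ _ _ h2).
  by rewrite /dgm /GRing.scale /=; ring.
have gmA1 x : 0 < x -> `|gm x| <= x + A.
  by move=> x0; have := gA (- x); rewrite normrN (gtr0_norm x0) addrC.
have FmM y : 0 < y -> `|Fm y| <= M / y.
  by move=> y0; rewrite normrN; have [] := FM y y0.
have FM1 y : 0 < y -> `|F y| <= M / y by move=> y0; have [] := FM y y0.
have L1 := stein_sol'_lip dF dgE dh1 A0 gA1 FM1.
have L2 := stein_sol'_lip dFm dgmE dgm1 A0 gmA1 FmM.
have solN x : stein_sol' Fm gm x = stein_sol' F g (- x).
  by rewrite /stein_sol' /stein_sol /Fm /gm normal_pdf01N; ring.
exists (stein_sol F), (stein_sol' F g); split.
- by move=> x; exact: is_derive_stein_sol.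
- suff H x y : x <= y -> `|stein_sol' F g y - stein_sol' F g x| <= stein_const * `|y - x|.
    move=> x y; have [xy|/ltW yx] := leP x y; last exact: H.
    by rewrite distrC [in leRHS]distrC; exact: H.
  move=> xy; rewrite (ger0_norm (_ : 0 <= y - x)) ?subr_ge0//.
  have [x0|/ltW x0] := leP 0 x; first exact: L1.
  have [y0|/ltW y0] := leP y 0.
    have := L2 (- y) (- x); rewrite !solN !opprK oppr_ge0 lerN2 distrC => h1.
    by rewrite [y - x]addrC; exact: h1.
  have h1 := L1 0 y (lexx _) y0.
  have := L2 0 (- x) (lexx _); rewrite !solN oppr0 opprK oppr_ge0 => /(_ x0).
  rewrite distrC => h2.
  have := ler_distD (stein_sol' F g 0) (stein_sol' F g y) (stein_sol' F g x).
  by rewrite /stein_const -/A; lra.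
- by move=> x; rewrite /stein_sol' /g; ring.
Qed.

(* [he] is the mean of [h] over [[x, x + e]]. *)
Lemma lip1_smoothing (h : R -> R) (e : R) : 0 < e ->
  (forall x y, `|h x - h y| <= `|x - y|) ->
  exists he dhe : R -> R, [/\ forall x : R, is_derive x 1 he (dhe x),
    forall x, `|dhe x| <= 1 & forall x, `|he x - h x| <= e].
Proof.
move=> e0 hl; have ch := lip1_continuous hl.
pose he x := e^-1 * \int[leb]_(t in `]x, (x + e)]) h t.
have intE a b : leb.-integrable `[a, b] (EFin \o h).
  apply: continuous_compact_integrable; first exact: segment_compact.
  exact: continuous_subspaceT.
pose H a y := \int[leb]_(t in `[a, y]) h t.
have dH a y : a < y -> is_derive y 1 (H a) (h y).
  move=> ay; have [||||d1 d2] := @continuous_FTC1 R h (BLeft a) y (y + 1).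
  - by rewrite ltrDl.
  - exact: intE.
  - by rewrite lte_fin.
  - exact: ch.
  by rewrite -d2 derive1E; apply: DeriveDef.
have heE a y : a < y -> he y = e^-1 * (H a (y + e) - H a y).
  move=> ay; rewrite /he /H Rintegral_itvB//.
  - by rewrite bnd_simp ltW.
  - by rewrite bnd_simp lerDl ltW.
exists he, (fun x => e^-1 * (h (x + e) - h x)); split=> [x|x|x].
- have h1 : is_derive x 1 (H (x - 1)) (h x) by apply: dH; rewrite ltrBlDr ltrDl.
  have h2 : is_derive (x + e) 1 (H (x - 1)) (h (x + e)).
    by apply: dH; rewrite ltrBlDr -addrA ltrDl addr_gt0.
  have h3 : is_derive x 1 (fun y : R => y + e) 1.
    apply: (@is_derive_eq _ _ _ _ _ _ _ _ (is_deriveD (is_derive_id x (1 : R)) (is_derive_cst e x 1))).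
    by rewrite addr0.
  have h4 := @is_derive1_comp _ (H (x - 1)) _ x _ _ h2 h3.
  have h5 : is_derive x 1 (fun y => e^-1 * (H (x - 1) (y + e) - H (x - 1) y))
      (e^-1 * (h (x + e) - h x)).
    apply: (@is_derive_eq _ _ _ _ _ _ _ _ (is_deriveZ e^-1 (is_deriveB h4 h1))).
    by rewrite /GRing.scale /= mulr1.
  apply: (near_eq_is_derive _ h5).
  near=> y; rewrite (@heE (x - 1))//; near: y.
  by apply: lt_nbhsr; rewrite ltrBlDr ltrDl.
- rewrite normrM (ger0_norm (_ : 0 <= e^-1)) ?invr_ge0 ?(ltW e0)// ler_pdivrMl// mulr1.
  by apply: le_trans (hl _ _) _; rewrite addrAC subrr add0r gtr0_norm.
- rewrite (@heE (x - 1)); last by rewrite ltrBlDr ltrDl.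
  have xe : x < x + e by rewrite ltrDl.
  have dd z : z \in `]x, (x + e)[ -> is_derive z 1 (H (x - 1)) (h z).
    by rewrite in_itv/= => /andP[xz _]; apply: dH; rewrite ltrBlDr (lt_trans xz)// ltrDl.
  have [|c] := MVT xe dd.
    apply: derivable_within_continuous => z; rewrite in_itv/= => /andP[xz _].
    have zx : x - 1 < z by rewrite ltrBlDr (le_lt_trans xz)// ltrDl.
    by have [] := dH _ _ zx.
  rewrite in_itv/= => /andP[xc ce] ->.
  rewrite addrAC subrr add0r mulrC mulfK ?gt_eqF//.
  apply: le_trans (hl _ _) _; rewrite ger0_norm ?subr_ge0 ?ltW//.
  by rewrite ltrBlDl.
Unshelve. all: by end_near. Qed.

(** Stein's equation is solved for a smoothed test function; smoothing costs [e / 2] under each of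
    the two laws, and [e] is arbitrary. *)
Lemma stein_lipschitz_bound (T : finType) (p Y : T -> R) (delta : R) :
  (forall w, 0 <= p w) -> \sum_w p w = 1 ->
  (forall f f' : R -> R, (forall x : R, is_derive x 1 f (f' x)) ->
     (forall x y, `|f' x - f' y| <= stein_const * `|x - y|) ->
     `|\sum_w p w * (f' (Y w) - Y w * f (Y w))| <= delta) ->
  forall h : R -> R, (forall x y, `|h x - h y| <= `|x - y|) ->
    `|\sum_w p w * h (Y w) - \int[leb]_z (h z * phi z)| <= delta.
Proof.
move=> p0 p1 H h hl; apply/ler_addgt0Pr => e e0.
have e20 : 0 < e / 2 by rewrite divr_gt0.
have [he [dhe [he1 he2 he3]]] := lip1_smoothing e20 hl.
have hel := derive_le1_lip1 he1 he2.
have [f [f' [f1 f2 f3]]] := stein_equation he1 he2.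
have mh : measurable_fun [set: R] h.
  by apply: continuous_measurable_fun; exact: lip1_continuous.
have mhe : measurable_fun [set: R] he.
  by apply: continuous_measurable_fun; exact: lip1_continuous.
have ih := integrable_mul_normal_pdf mh (lip1_growth hl).
have ihe := integrable_mul_normal_pdf mhe (lip1_growth hel).
have d1 : `|\sum_w p w * h (Y w) - \sum_w p w * he (Y w)| <= e / 2.
  rewrite -sumrB; apply: le_trans (ler_norm_sum _ _ _) _.
  rewrite (_ : e / 2 = \sum_w p w * (e / 2)); last by rewrite -mulr_suml p1 mul1r.
  apply: ler_sum => w _.
  by rewrite -mulrBr normrM ger0_norm// ler_wpM2l// distrC.
have d2 : `|\int[leb]_z (he z * phi z) - \int[leb]_z (h z * phi z)| <= e / 2.
  rewrite -RintegralB//.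
  have id : leb.-integrable [set: R] (EFin \o (fun t => he t * phi t - h t * phi t)).
    rewrite (_ : _ \o _ = (fun t => (he t * phi t)%:E - (h t * phi t)%:E)%E).
      exact: integrableB.
    by apply/funext => t; rewrite /= EFinB.
  apply: le_trans (le_normr_Rintegral _ _) _ => //.
  have -> : e / 2 = \int[leb]_z (e / 2 * phi z).
    by rewrite RintegralZl ?Rintegral_normal_pdf ?mulr1//; exact: integrable_normal_pdf.
  apply: le_Rintegral => //.
  - exact: (integrable_norm id).
  - rewrite (_ : _ \o _ = (fun t => (e / 2)%:E * (phi t)%:E)%E)//.
    by apply: integrableZl => //; exact: integrable_normal_pdf.
  move=> z _; rewrite -mulrBl normrM (ger0_norm (normal_pdf_ge0 _ _ _)).
  by rewrite ler_wpM2r ?normal_pdf_ge0.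
have d3 : `|\sum_w p w * he (Y w) - \int[leb]_z (he z * phi z)| <= delta.
  apply: le_trans (H f f' f1 f2); rewrite le_eqVlt; apply/orP; left; apply/eqP.
  congr `|_|; under [in RHS]eq_bigr do rewrite f3 mulrBr.
  by rewrite big_split /= sumrN -mulr_suml p1 mul1r.
set a := \sum_w _ in d1 *; set b := \sum_w _ in d1 d3; set c := Rintegral _ _ _ in d2 d3.
set d := Rintegral _ _ _ in d2 *.
have := ler_distD b a d; have := ler_distD c b d; lra.
Qed.

End SteinEquation.

(** * Expectation and resampling of the choices *)

Section Expectation.
Variables (R : realType) (m n : nat).
Local Notation Om := (ua_space m n).
Local Notation pmf := (@ua_pmf R m n).

Definition Ex (f : Om -> R) : R := \sum_w pmf w * f w.

Lemma pmf_ge0 w : 0 <= pmf w.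
Proof. by apply: prodr_ge0 => e _; rewrite invr_ge0. Qed.

Lemma pmf_sum1 : \sum_w pmf w = 1.
Proof.
have := @probability_setT _ (ua_space m n) R (ua_prob R m n).
rewrite /= /ua_prob fsbig_finite /=; last exact: finite_finset.
rewrite sumEFin => -[].
rewrite (perm_big (index_enum Om)) //=.
apply: uniq_perm => [||w]; rewrite ?finmap.fset_uniq ?index_enum_uniq //.
by rewrite mem_index_enum in_fset_set; [rewrite in_setT | exact: finite_finset].
Qed.

Lemma ExD f g : Ex (fun w => f w + g w) = Ex f + Ex g.
Proof. by rewrite /Ex -big_split; apply: eq_bigr => w _; rewrite mulrDr. Qed.

Lemma ExZ c f : Ex (fun w => c * f w) = c * Ex f.
Proof. by rewrite /Ex mulr_sumr; apply: eq_bigr => w _; rewrite mulrCA. Qed.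

Lemma ExZr c f : Ex (fun w => f w * c) = Ex f * c.
Proof. by rewrite /Ex mulr_suml; apply: eq_bigr => w _; rewrite mulrA. Qed.

Lemma ExN f : Ex (fun w => - f w) = - Ex f.
Proof. by rewrite /Ex -sumrN; apply: eq_bigr => w _; rewrite mulrN. Qed.

Lemma ExB f g : Ex (fun w => f w - g w) = Ex f - Ex g.
Proof. by rewrite ExD ExN. Qed.

Lemma Ex_cst c : Ex (fun=> c) = c.
Proof. by rewrite /Ex -mulr_suml pmf_sum1 mul1r. Qed.

Lemma Ex_sum (I : finType) (P : pred I) (f : I -> Om -> R) :
  Ex (fun w => \sum_(i | P i) f i w) = \sum_(i | P i) Ex (f i).
Proof.
rewrite /Ex exchange_big /=; apply: eq_bigr => w _; by rewrite mulr_sumr.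
Qed.

Lemma eq_Ex f g : f =1 g -> Ex f = Ex g.
Proof. by move=> fg; apply: eq_bigr => w _; rewrite fg. Qed.

Lemma Ex_ge0 f : (forall w, 0 <= f w) -> 0 <= Ex f.
Proof. by move=> f0; apply: sumr_ge0 => w _; rewrite mulr_ge0 ?pmf_ge0. Qed.

Lemma le_Ex f g : (forall w, f w <= g w) -> Ex f <= Ex g.
Proof. by move=> fg; apply: ler_sum => w _; rewrite ler_wpM2l ?pmf_ge0. Qed.

Lemma norm_Ex_le f : `|Ex f| <= Ex (fun w => `|f w|).
Proof.
apply: le_trans (ler_norm_sum _ _ _) _; apply: ler_sum => w _.
by rewrite normrM (ger0_norm (pmf_ge0 w)).
Qed.

Lemma Ex_integrable (f : Om -> R) :
  (ua_prob R m n).-integrable [set: Om] (fun w => (f w)%:E).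
Proof.
apply/integrableP; split => //.
apply: (@le_lt_trans _ _ (\int[ua_prob R m n]_w (\sum_w `|f w|)%:E)%E).
  apply: ge0_le_integral => //= w _; rewrite lee_fin.
  by rewrite (bigD1 w)//= lerDl sumr_ge0.
rewrite integral_cst//= [X in (_ * X)%E](_ : _ = 1%E) ?mule1 ?ltry//.
exact: (@probability_setT _ _ _ (ua_prob R m n)).
Qed.

Lemma integral_ua_prob (f : Om -> R) :
  (\int[ua_prob R m n]_w (f w)%:E)%E = (Ex f)%:E.
Proof.
have -> : (fun w => (f w)%:E) = (fun w => \sum_(v : Om) (f v * \1_[set v] w)%:E)%E.
  apply/funext => w; rewrite sumEFin (bigD1 w)//= indicE mem_set// mulr1.
  rewrite big1 ?addr0// => v vw; rewrite indicE memNset ?mulr0//=.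
  by move=> wv; rewrite wv eqxx in vw.
rewrite integral_sum//; last first.
  by move=> v; exact: (Ex_integrable (fun w => f v * \1_[set v] w)).
rewrite /Ex -sumEFin; apply: eq_bigr => v _.
under eq_integral do rewrite EFinM.
rewrite integralZl//; last exact: (Ex_integrable (fun w => \1_[set v] w)).
by rewrite integral_indic// setIT /= /ua_prob fsbig_set1 -EFinM mulrC.
Qed.

(** Averaging over [w] with [w0] fixed is the conditional expectation given the choices in [D]. *)
Definition mix (D : {set ua_edge m n}) (w0 w : Om) : Om :=
  [ffun e => if e \in D then w0 e else w e] : {dffun _}.

Lemma mixE D w0 w e : mix D w0 w e = if e \in D then w0 e else w e.
Proof. by rewrite ffunE. Qed.

Lemma mixK D w0 w : mix D (mix D w0 w) (mix D w w0) = w0.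
Proof. by apply/ffunP => e; rewrite !mixE; case: ifP => // ->. Qed.

Definition depends_on (D : {set ua_edge m n}) (f : Om -> R) :=
  forall w w' : Om, (forall e, e \in D -> w e = w' e) -> f w = f w'.

Lemma depends_onS (D D' : {set ua_edge m n}) f :
  D \subset D' -> depends_on D f -> depends_on D' f.
Proof. by move=> /fintype.subsetP DD' df w w' ww'; apply: df => e /DD' /ww'. Qed.

Lemma depends_onM D f g :
  depends_on D f -> depends_on D g -> depends_on D (fun w => f w * g w).
Proof. by move=> df dg w w' ww'; rewrite (df _ _ ww') (dg _ _ ww'). Qed.

Lemma depends_on_cst D c : depends_on D (fun=> c).
Proof. by []. Qed.

Lemma depends_on_comp D f (g : R -> R) :
  depends_on D f -> depends_on D (fun w => g (f w)).
Proof. by move=> df w w' ww'; rewrite (df _ _ ww'). Qed.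

Lemma depends_on_sum (I : finType) (P : pred I) D (f : I -> Om -> R) :
  (forall i, P i -> depends_on D (f i)) ->
  depends_on D (fun w => \sum_(i | P i) f i w).
Proof. by move=> df w w' ww'; apply: eq_bigr => i Pi; exact: df. Qed.

(* The swap [(w0, w) |-> (mix D w0 w, mix D w w0)] is an involution which
   preserves the (uniform) product measure. *)
Lemma Ex_resample D (h G : Om -> R) : depends_on D h ->
  Ex (fun w => h w * G w) =
  Ex (fun w0 => h w0 * Ex (fun w => G (mix D w0 w))).
Proof.
move=> dh; rewrite -[LHS]mulr1 -[in LHS](Ex_cst 1) /Ex mulr_suml.
under [RHS]eq_bigr do rewrite mulrA mulr_sumr.
under [LHS]eq_bigr do rewrite mulr_sumr.
rewrite !pair_big /=.
have bij : bijective (fun x : Om * Om => (mix D x.1 x.2, mix D x.2 x.1)).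
  by exists (fun x : Om * Om => (mix D x.1 x.2, mix D x.2 x.1)) => -[w0 w] /=;
     rewrite !mixK.
rewrite (reindex _ (onW_bij _ bij)) /=; apply: eq_bigr => -[w0 w] _ /=.
have -> : h (mix D w0 w) = h w0 by apply: dh => e eD; rewrite mixE eD.
by rewrite /ua_pmf; ring.
Qed.

Lemma Ex_indep D (f g : Om -> R) : depends_on D f -> depends_on (~: D) g ->
  Ex (fun w => f w * g w) = Ex f * Ex g.
Proof.
move=> df dg; rewrite (Ex_resample _ df) -ExZr; apply: eq_Ex => w0.
congr (_ * _); apply: eq_Ex => w; apply: dg => e.
by rewrite inE mixE => /negbTE ->.
Qed.

Definition hits (e : ua_edge m n) (v : nat) (w : Om) : R :=
  (w e == v :> nat)%:R.

Definition swap_choice (e : ua_edge m n) (v v' : nat) (w : Om) : Om :=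
  [ffun e' => if e' == e then
     insubd (w e') (if w e' == v :> nat then v' else
                    if w e' == v' :> nat then v else w e') else w e'] : {dffun _}.

Lemma swap_choiceE (e : ua_edge m n) (v v' : nat) (w : Om) : (v < (val e).1)%N -> (v' < (val e).1)%N ->
  swap_choice e v v' w e = (if w e == v :> nat then v' else
                    if w e == v' :> nat then v else w e) :> nat.
Proof.
move=> ve ve'; rewrite ffunE eqxx val_insubd.
by case: eqP => _; [rewrite ve'|case: eqP => _; [rewrite ve|rewrite ltn_ord]].
Qed.

Lemma swap_choiceK (e : ua_edge m n) (v v' : nat) : (v < (val e).1)%N -> (v' < (val e).1)%N ->
  involutive (swap_choice e v v').
Proof.
move=> ve ve' w; apply/ffunP => e'; apply/val_inj.
have [->|ne] := eqVneq e' e; last by rewrite /= !ffunE (negbTE ne).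
rewrite [LHS]/= swap_choiceE// swap_choiceE// [RHS]/=.
case: (eqVneq (w e : nat) v) => [->|h1].
  by case: (eqVneq v' v) => [->|]; rewrite ?eqxx.
case: (eqVneq (w e : nat) v') => [->|h2]; first by rewrite eqxx.
by rewrite (negbTE h1) (negbTE h2).
Qed.

(** Exchanging two values of one choice is an involution of the outcomes, which all have the same
    weight; so the possible values are equally likely, and their probabilities add up to 1. *)
Lemma Ex_hits (e : ua_edge m n) (v : nat) : (v < (val e).1)%N -> Ex (hits e v) = ((val e).1 : nat)%:R^-1.
Proof.
move=> ve.
have sym v' : (v' < (val e).1)%N -> Ex (hits e v') = Ex (hits e v).
  move=> ve'; rewrite /Ex (reindex_inj (inv_inj (swap_choiceK ve ve'))) /=.
  apply: eq_bigr => w _; congr (_ * _); rewrite /hits swap_choiceE//; congr (_%:R).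
  case: (eqVneq (w e : nat) v) => [_|h1]; first by rewrite eqxx.
  case: (eqVneq (w e : nat) v') => [h2|h2]; last by rewrite (negbTE h2).
  by rewrite -h2 eq_sym (negbTE h1).
have : \sum_(i < (val e).1) Ex (hits e i) = 1.
  rewrite -Ex_sum -[RHS](Ex_cst 1); apply: eq_Ex => w.
  rewrite (bigD1 (w e))//= /hits eqxx big1 ?addr0// => i.
  by rewrite eq_sym -val_eqE /= => /negbTE ->.
under eq_bigr do rewrite (sym _ (ltn_ord _)).
rewrite sumr_const card_ord => h.
have j0 : ((val e).1 : nat)%:R != 0 :> R by rewrite pnatr_eq0 -lt0n; exact: (valP e).
by apply: (mulfI j0); rewrite mulr_natl h divff.
Qed.

Lemma hits_ge0 e v w : 0 <= hits e v w. Proof. by rewrite ler0n. Qed.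

Lemma depends_on_hits e v : depends_on [set e] (hits e v).
Proof. by move=> w w' ww'; rewrite /hits ww' ?inE. Qed.

Lemma Ex_prod (I : eqType) (s : seq I) (g : I -> ua_edge m n) (F : I -> Om -> R) :
  uniq (map g s) -> (forall i, depends_on [set g i] (F i)) ->
  Ex (fun w => \prod_(i <- s) F i w) = \prod_(i <- s) Ex (F i).
Proof.
move=> us dF; elim: s us => [_|i s IHs /= /andP[gi us]].
  by rewrite big_nil -[RHS](Ex_cst 1); apply: eq_Ex => w; rewrite big_nil.
rewrite big_cons -IHs//; rewrite -(@Ex_indep [set g i])//.
  by apply: eq_Ex => w; rewrite big_cons.
move=> w w' ww'; apply: eq_big_seq => i' i's; apply: dF => e.
rewrite inE => /eqP ->; apply: ww'; rewrite !inE; apply: contraNneq gi => <-.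
exact: map_f.
Qed.

End Expectation.

(** * Kernels on an interval of integers *)

Section Kernels.
Variables (R : realType).

(* [kap] dominates the probability [1 / max u v] of an edge between [u] and [v]
   without its pole at [0]; [rsq] is the weight for which it satisfies Schur's
   test. *)
Definition kap (u v : nat) : R := 2 / (maxn u v).+1%:R.
Definition rsq (u : nat) : R := (Num.sqrt u.+1%:R)^-1.

Lemma kapC u v : kap u v = kap v u. Proof. by rewrite /kap maxnC. Qed.

Lemma kap_ge0 u v : 0 <= kap u v. Proof. by rewrite divr_ge0. Qed.

Lemma sqrtS_gt0 u : 0 < Num.sqrt (u.+1%:R : R). Proof. by rewrite sqrtr_gt0. Qed.

Lemma rsq_gt0 u : 0 < rsq u. Proof. by rewrite invr_gt0 sqrtS_gt0. Qed.

Lemma rsq_le1 u : rsq u <= 1.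
Proof. by rewrite invf_le1 ?sqrtS_gt0// -[X in X <= _]sqrtr1 ler_sqrt// ler1n. Qed.

Lemma rsq_sq u : rsq u * rsq u = u.+1%:R^-1.
Proof. by rewrite -invfM -expr2 sqr_sqrtr. Qed.

Lemma kap_le_rsq u v : kap u v <= 2 * (rsq u * rsq v).
Proof.
rewrite /kap ler_pM2l// /rsq -invfM lef_pV2 ?posrE ?mulr_gt0 ?sqrtS_gt0//.
have h w : (w <= maxn u v)%N -> Num.sqrt (w.+1%:R : R) <= Num.sqrt (maxn u v).+1%:R.
  by move=> hw; rewrite ler_sqrt// ler_nat ltnS.
have := ler_pM (sqrtr_ge0 _) (sqrtr_ge0 _) (h u (leq_maxl _ _)) (h v (leq_maxr _ _)).
by rewrite -expr2 sqr_sqrtr.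
Qed.

Lemma rsq_le_diff u : rsq u <= 2 * (Num.sqrt u.+1%:R - Num.sqrt u%:R).
Proof.
have s1 := sqrtS_gt0 u; have s0 := sqrtr_ge0 (u%:R : R).
have e1 : Num.sqrt (u.+1%:R : R) ^+ 2 = u%:R + 1 by rewrite sqr_sqrtr// -natr1.
have e0 : Num.sqrt (u%:R : R) ^+ 2 = u%:R by rewrite sqr_sqrtr.
rewrite /rsq -[X in X <= _]mul1r ler_pdivrMr//.
move: s1 s0 e1 e0; set a := Num.sqrt _; set b := Num.sqrt _ => s1 s0 e1 e0.
nra.
Qed.

Lemma sum_rsq n : \sum_(v < n) rsq v <= 2 * Num.sqrt n%:R.
Proof.
elim: n => [|n IHn]; first by rewrite big_ord0 mulr_ge0 ?sqrtr_ge0.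
rewrite big_ord_recr /=; have := rsq_le_diff n; lra.
Qed.

Lemma rsq3_le_diff u : rsq u.+1 * u.+2%:R^-1 <= 2 * (rsq u - rsq u.+1).
Proof.
rewrite /rsq; set a := Num.sqrt u.+1%:R; set b := Num.sqrt u.+2%:R.
have a0 : 0 < a by exact: sqrtS_gt0.
have b0 : 0 < b by exact: sqrtS_gt0.
have e1 : b ^+ 2 = a ^+ 2 + 1 by rewrite !sqr_sqrtr// -natr1.
have -> : u.+2%:R = b ^+ 2 :> R by rewrite sqr_sqrtr.
have ab : a <= b by rewrite ler_sqrt// ler_nat.
rewrite -subr_ge0.
have -> : 2 * (a^-1 - b^-1) - b^-1 * b ^- 2 = (2 * (b - a) * b ^+ 2 - a) / (a * b ^+ 3).
  by field; rewrite !gt_eqF.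
rewrite divr_ge0// ?mulr_ge0 ?exprn_ge0 ?(ltW a0) ?(ltW b0)//.
rewrite subr_ge0 -(ler_pM2r (_ : 0 < b + a)) ?addr_gt0//.
have -> : 2 * (b - a) * b ^+ 2 * (b + a) = 2 * (b ^+ 2 - a ^+ 2) * b ^+ 2 by ring.
rewrite e1; nra.
Qed.

Lemma sum_rsq3 u n : \sum_(u <= v < n) rsq v.+1 * v.+2%:R^-1 <= 2 * rsq u.
Proof.
have [un|nu] := leqP u n; last first.
  by rewrite big_geq ?mulr_ge0 ?(ltW (rsq_gt0 _)) 1?ltnW.
have : \sum_(u <= v < n) rsq v.+1 * v.+2%:R^-1 <= 2 * (rsq u - rsq n).
  rewrite (_ : rsq u - rsq n = \sum_(u <= v < n) (rsq v - rsq v.+1)).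
    by rewrite mulr_sumr; apply: ler_sum => v _; exact: rsq3_le_diff.
  rewrite -[LHS]opprB -telescope_sumr// -sumrN.
  by apply: eq_bigr => v _; rewrite opprB.
have := rsq_gt0 n; lra.
Qed.

(** Schur's test. Up to [u] the kernel is constant in [v] and the weights sum to order
    [sqrt (u + 1)]; beyond [u] the terms are of order [v^(-3/2)], whose tail is of order [rsq u]. *)
Lemma kap_rsq n u : \sum_(v < n) kap u v * rsq v <= 8 * rsq u.
Proof.
have H1 : \sum_(0 <= v < u.+1) kap u v * rsq v <= 4 * rsq u.
  apply: (@le_trans _ _ (\sum_(v < u.+1) (2 / u.+1%:R) * rsq v)).
    rewrite big_mkord; apply: ler_sum => v _; rewrite /kap.
    by have /maxn_idPl -> : (v <= u)%N by rewrite -ltnS.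
  rewrite -mulr_sumr; apply: (@le_trans _ _ (2 / u.+1%:R * (2 * Num.sqrt u.+1%:R))).
    by rewrite ler_wpM2l ?divr_ge0// sum_rsq.
  rewrite -rsq_sq /rsq; set a := Num.sqrt _.
  have a0 : a != 0 by rewrite gt_eqF// sqrtS_gt0.
  by rewrite le_eqVlt; apply/orP; left; apply/eqP; field.
have H2 : \sum_(u.+1 <= v < n.+1) kap u v * rsq v <= 4 * rsq u.
  rewrite big_add1 /=.
  apply: (@le_trans _ _ (2 * \sum_(u <= v < n) rsq v.+1 * v.+2%:R^-1)).
    rewrite mulr_sumr big_nat_cond [leRHS]big_nat_cond.
    apply: ler_sum => v /andP[/andP[uv _] _]; rewrite /kap.
    have /maxn_idPr -> : (u <= v.+1)%N by rewrite leqW.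
    by rewrite mulrAC -mulrA.
  have := sum_rsq3 u n; lra.
have kr v : 0 <= kap u v * rsq v by rewrite mulr_ge0 ?kap_ge0 ?(ltW (rsq_gt0 _)).
rewrite -(big_mkord predT (fun v => kap u v * rsq v)).
have [nu|un] := leqP n u.+1.
  apply: (@le_trans _ _ (\sum_(0 <= v < u.+1) kap u v * rsq v)).
    by rewrite [leRHS](big_cat_nat (n := n))//= lerDl sumr_ge0.
  have := rsq_gt0 u; lra.
rewrite (big_cat_nat (n := u.+1))//=; last exact: ltnW.
have : \sum_(u.+1 <= v < n) kap u v * rsq v <= \sum_(u.+1 <= v < n.+1) kap u v * rsq v.
  by rewrite [leRHS](big_cat_nat (n := n))//= ?lerDl ?sumr_ge0// ltnW.
lra.
Qed.

Lemma harmonic_ub n : (0 < n)%N -> \sum_(v < n) (v.+1%:R)^-1 <= 1 + ln n%:R :> R.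
Proof.
elim: n => [//|[|n] IHn] _.
  by rewrite big_ord_recr big_ord0 /= add0r invr1 ln1 addr0.
rewrite big_ord_recr /=; apply: (@le_trans _ _ (1 + ln n.+1%:R + n.+2%:R^-1)).
  by rewrite lerD2r IHn.
rewrite -addrA lerD2l.
have n2 : n.+2%:R != 0 :> R by rewrite pnatr_eq0.
have := @le_ln1Dx R (- n.+2%:R^-1); rewrite ltrN2 invf_lt1 ?ltr1n// => /(_ isT).
have -> : 1 - n.+2%:R^-1 = n.+1%:R / n.+2%:R :> R by apply: (mulIf n2); rewrite mulrBl mul1r mulVf// divfK// -natr1 addrK.
rewrite ln_div ?posrE ?ltr0n//; set x := _^-1; set y := ln _; set z := ln _.
lra.
Qed.

Lemma sum_rsq_inv n : \sum_(u < n) rsq u * u.+1%:R^-1 <= 3.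
Proof.
case: n => [|n]; first by rewrite big_ord0.
rewrite -(big_mkord predT (fun u => rsq u * u.+1%:R^-1)) big_nat_recl//= invr1 mulr1.
apply: (@le_trans _ _ (1 + 2 * 1)); last lra.
apply: lerD; first exact: rsq_le1.
by apply: le_trans (sum_rsq3 0 n) _; rewrite ler_pM2l// rsq_le1.
Qed.

Lemma harmonic_lb a b : (0 < a)%N -> (a <= b)%N ->
  ln b%:R - ln a%:R <= \sum_(a <= v < b) v%:R^-1 :> R.
Proof.
move=> a0 ab; rewrite -(telescope_sumr (fun v => ln v%:R)) //.
rewrite big_nat_cond [leRHS]big_nat_cond; apply: ler_sum => v /andP[/andP[av _] _].
have v0 : (0 : R) < v%:R by rewrite ltr0n (leq_trans a0).
rewrite -ln_div ?posrE//.
have -> : v.+1%:R / v%:R = 1 + v%:R^-1 :> R by rewrite -natr1; field; rewrite gt_eqF.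
by apply: le_ln1Dx; apply: lt_trans (_ : 0 < _); rewrite ?ltrN10// invr_gt0.
Qed.

Lemma kap_row n u : (0 < n)%N -> \sum_(v < n) kap u v <= 4 + 2 * ln n%:R.
Proof.
move=> n0; apply: (@le_trans _ _ (\sum_(v < n | (v <= u)%N) 2 / u.+1%:R + \sum_(v < n) 2 / v.+1%:R)).
  rewrite (bigID (fun v : 'I_n => (v <= u)%N)) /=; apply: lerD.
    apply: ler_sum => v vu; rewrite /kap; by have /maxn_idPl -> := vu.
  rewrite [leRHS](bigID (fun v : 'I_n => (v <= u)%N)) /= ler_wpDl ?sumr_ge0//.
  apply: ler_sum => v; rewrite -ltnNge => /ltnW vu; rewrite /kap; by have /maxn_idPr -> := vu.
have h2 := harmonic_ub n0; rewrite -[X in _ + X]mulr_sumr.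
have : \sum_(v < n | (v <= u)%N) 2 / u.+1%:R <= 2 :> R.
  rewrite sumr_const -[_ *+ #|_|]mulr_natr mulrAC ler_pdivrMr// ler_pM2l// ler_nat.
  rewrite cardE -(size_map val) -[leqRHS](size_iota 0).
  apply: uniq_leq_size; first by rewrite map_inj_uniq ?enum_uniq//; exact: val_inj.
  by move=> _ /mapP[v + ->]; rewrite mem_enum mem_iota /= add0n ltnS.
lra.
Qed.

End Kernels.

(** * Entries of powers of a kernel *)

Section KernelPowers.
Variables (R : realType) (n : nat).
Local Notation kernel := (nat -> nat -> R).
Local Notation rsq := (@rsq R).
Local Notation kap := (@kap R).

Definition kmx (M : kernel) : 'M[R]_n := \matrix_(i, j) M i j.

Definition kpow (M : kernel) q : 'M[R]_n := iter q (fun A => A *m kmx M) 1%:M.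

Lemma kmxE M (u v : 'I_n) : kmx M u v = M u v. Proof. exact: mxE. Qed.

Lemma kpowS M q : kpow M q.+1 = kpow M q *m kmx M. Proof. by []. Qed.

Lemma kpowSE M q (u v : 'I_n) : kpow M q.+1 u v = \sum_z kpow M q u z * M z v.
Proof. by rewrite kpowS [LHS]mxE; apply: eq_bigr => z _; rewrite kmxE. Qed.

Lemma kpowD M p q : kpow M (p + q) = kpow M p *m kpow M q.
Proof.
elim: q => [|q IHq]; first by rewrite addn0 mulmx1.
by rewrite addnS !kpowS IHq mulmxA.
Qed.

Lemma kpow1 M : kpow M 1 = kmx M. Proof. by rewrite kpowS mul1mx. Qed.

(** The first factor is bounded by [kap_le_rsq]; each further one is summed against [rsq] by Schur's
    test, at a cost of [8 c]. On the diagonal this is [O(1 / (u + 1))], whatever the exponent. *)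
Lemma kpow_rsq (M : kernel) (c : R) q : 0 <= c ->
  (forall u v, 0 <= M u v <= c * kap u v) ->
  forall u v : 'I_n, 0 <= kpow M q.+1 u v <= 2 * c * (8 * c) ^+ q * (rsq u * rsq v).
Proof.
move=> c0 M1; elim: q => [|q IHq] u v.
  rewrite kpow1 kmxE expr0 mulr1; have /andP[-> h] := M1 u v.
  apply: le_trans h _; rewrite (mulrC 2) -mulrA ler_wpM2l// ?kap_le_rsq//.
rewrite kpowSE; apply/andP; split.
  apply: sumr_ge0 => z _; rewrite mulr_ge0//; first by have /andP[] := IHq u z.
  by have /andP[] := M1 z v.
set C := 2 * c * (8 * c) ^+ q in IHq.
have C0 : 0 <= C by rewrite !mulr_ge0// exprn_ge0// mulr_ge0.
apply: (@le_trans _ _ (\sum_(z < n) C * rsq u * c * (kap v z * rsq z))).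
  apply: ler_sum => z _.
  have /andP[h1 h2] := IHq u z; have /andP[h3 h4] := M1 z v.
  apply: (@le_trans _ _ ((C * (rsq u * rsq z)) * (c * kap z v))); first exact: ler_pM.
  by rewrite (kapC R v z) le_eqVlt; apply/orP; left; apply/eqP; ring.
rewrite -mulr_sumr.
apply: (@le_trans _ _ (C * rsq u * c * (8 * rsq v))).
  by rewrite ler_wpM2l ?kap_rsq// mulr_ge0// mulr_ge0// ltW// rsq_gt0.
by rewrite exprS /C le_eqVlt; apply/orP; left; apply/eqP; ring.
Qed.

(* Functions bounded by a multiple of [rsq] plus an integrable function: this
   class is stable under [kap] (Schur test) and under summable kernels. *)
Definition schur (c : R) (g : nat -> R) := exists g1 g2 : nat -> R,
  [/\ forall v, (v < n)%N -> 0 <= g v <= g1 v + g2 v,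
      forall v, (v < n)%N -> 0 <= g1 v <= c * rsq v,
      forall v, (v < n)%N -> 0 <= g2 v & \sum_(v < n) g2 v <= c].

Lemma schur_bound c g v : schur c g -> (v < n)%N -> 0 <= g v <= 2 * c.
Proof.
move=> [g1 [g2 [h h1 h2 h3]]] vn.
have /andP[-> hv] := h v vn; apply: le_trans hv _.
have : g2 v <= c.
  apply: le_trans h3; rewrite (bigD1 (Ordinal vn))//= lerDl sumr_ge0// => i _.
  exact: h2.
have /andP[h10 h1v] := h1 v vn.
have c0 : 0 <= c by have := le_trans h10 h1v; rewrite pmulr_lge0 ?rsq_gt0.
have : c * rsq v <= c by rewrite ler_piMr ?rsq_le1.
lra.
Qed.

(** The part through [kap] lands in the first class: Schur's test costs 8 on [g1] and [kap_le_rsq]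
    costs 2 on the summable [g2], whence [10 a]. The part through [Q] lands in the second one, as
    [g] is at most [2 c], whence [2 B]. *)
Lemma schur_op (M Q : kernel) (a B c : R) (g : nat -> R) : 0 <= a -> 0 <= c ->
  (forall u v, (u < n)%N -> (v < n)%N -> 0 <= M u v <= a * kap u v + Q u v) ->
  (forall u v, (u < n)%N -> (v < n)%N -> 0 <= Q u v) ->
  \sum_(u < n) \sum_(v < n) Q u v <= B ->
  schur c g -> schur (c * (10 * a + 2 * B)) (fun v => \sum_(z < n) g z * M z v).
Proof.
move=> a0 c0 MQ Q0 QB sg; have gb v := schur_bound sg (v := v).
have B0 : 0 <= B.
  by apply: le_trans QB; apply: sumr_ge0 => u _; apply: sumr_ge0 => v _; exact: Q0.
case: sg => g1 [g2 [h h1 h2 h3]].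
exists (fun v => \sum_(z < n) g z * (a * kap z v)), (fun v => \sum_(z < n) g z * Q z v).
split.
- move=> v vn; rewrite -big_split /=; apply/andP; split.
    apply: sumr_ge0 => z _; have /andP[hz _] := h z (ltn_ord z).
    by have /andP[hM _] := MQ z v (ltn_ord z) vn; exact: mulr_ge0.
  apply: ler_sum => z _; rewrite -mulrDr; have /andP[hz _] := h z (ltn_ord z).
  by rewrite ler_wpM2l//; have /andP[] := MQ z v (ltn_ord z) vn.
- move=> v vn; apply/andP; split.
    apply: sumr_ge0 => z _; have /andP[hz _] := h z (ltn_ord z).
    by rewrite !mulr_ge0 ?kap_ge0.
  apply: (@le_trans _ _ (\sum_(z < n) (a * c * (kap v z * rsq z) + 2 * a * rsq v * g2 z))).
    apply: ler_sum => z _; have /andP[hz0 hz] := h z (ltn_ord z).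
    have k0 := kap_ge0 R z v; have k1 := kap_le_rsq R z v; have k2 := kapC R v z.
    have /andP[g10 g11] := h1 z (ltn_ord z); have g20 := h2 z (ltn_ord z).
    apply: (@le_trans _ _ ((g1 z + g2 z) * (a * kap z v))).
      by rewrite ler_wpM2r// mulr_ge0.
    rewrite mulrDl lerD//.
      apply: (@le_trans _ _ (c * rsq z * (a * kap z v))).
        by rewrite ler_wpM2r// mulr_ge0.
      by rewrite k2 le_eqVlt; apply/orP; left; apply/eqP; ring.
    apply: (@le_trans _ _ (g2 z * (a * (2 * (rsq z * rsq v))))).
      by rewrite ler_wpM2l// ler_wpM2l.
    have r1 := rsq_le1 R z; have r0 := rsq_gt0 R v.
    have -> : g2 z * (a * (2 * (rsq z * rsq v))) = (2 * a * rsq v * g2 z) * rsq z by ring.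
    by rewrite ler_piMr// !mulr_ge0// ltW.
  rewrite big_split /= -!mulr_sumr.
  have k8 := kap_rsq R n v; have r0 := rsq_gt0 R v.
  apply: (@le_trans _ _ (a * c * (8 * rsq v) + 2 * a * rsq v * c)).
    by rewrite lerD// ler_wpM2l// !mulr_ge0// ltW.
  have -> : a * c * (8 * rsq v) + 2 * a * rsq v * c = c * (10 * a) * rsq v by ring.
  rewrite ler_pM2r// ler_wpM2l// lerDl mulr_ge0//.
- move=> v vn; apply: sumr_ge0 => z _; have /andP[hz _] := h z (ltn_ord z).
  by rewrite mulr_ge0// Q0.
- rewrite exchange_big /=.
  apply: (@le_trans _ _ (\sum_(z < n) \sum_(v < n) 2 * c * Q z v)).
    apply: ler_sum => z _; apply: ler_sum => v _; rewrite ler_wpM2r ?Q0//.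
    by have /andP[] := gb z (ltn_ord z).
  under eq_bigr do rewrite -mulr_sumr.
  rewrite -mulr_sumr; apply: (@le_trans _ _ (2 * c * B)).
    by rewrite ler_wpM2l// mulr_ge0.
  have -> : 2 * c * B = c * (2 * B) by ring.
  by rewrite ler_wpM2l// lerDr mulr_ge0.
Qed.

(** A row of the 0-th power is the indicator of a point, which is summable; each further factor is
    an instance of [schur_op]. *)
Lemma kpow_bounded (M Q : kernel) (a B : R) q : 0 <= a ->
  (forall u v, (u < n)%N -> (v < n)%N -> 0 <= M u v <= a * kap u v + Q u v) ->
  (forall u v, (u < n)%N -> (v < n)%N -> 0 <= Q u v) ->
  \sum_(u < n) \sum_(v < n) Q u v <= B ->
  forall u v : 'I_n, 0 <= kpow M q u v <= 2 * (10 * a + 2 * B) ^+ q.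
Proof.
move=> a0 MQ Q0 QB u v.
have B0 : 0 <= B.
  by apply: le_trans QB; apply: sumr_ge0 => i _; apply: sumr_ge0 => j _; exact: Q0.
have c0 : 0 <= 10 * a + 2 * B by rewrite addr_ge0// mulr_ge0.
pose g q (w : nat) := if insub w is Some w then kpow M q u w else 0.
suff H : schur ((10 * a + 2 * B) ^+ q) (g q).
  by have := schur_bound H (ltn_ord v); rewrite /g valK.
elim: q => [|q IHq].
  exists (fun=> 0), (fun w => (w == u :> nat)%:R); split => //.
  - move=> w wn; rewrite /g insubT /= add0r /kpow /= mxE eq_sym -val_eqE /=.
    by case: eqP => _; rewrite ?lexx ?ler01.
  - by move=> w wn; rewrite lexx mul1r ltW// rsq_gt0.
  - rewrite (bigD1 u)//= eqxx big1 ?addr0// => i.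
    by rewrite -val_eqE /= => /negbTE ->.
have := schur_op a0 (exprn_ge0 q c0) MQ Q0 QB IHq.
rewrite -exprSr => -[g1 [g2 [h h1 h2 h3]]]; exists g1, g2; split => // w wn.
rewrite (_ : g q.+1 w = \sum_(z < n) g q z * M z w); first exact: h.
rewrite /g insubT kpowSE; apply: eq_bigr => z _.
by rewrite valK.
Qed.

End KernelPowers.

(** * Sums over placements of a unicyclic pattern *)

Section TupleSums.
Variables (R : realType) (n : nat).

(** The last entry is the innermost sum, so that a leaf can be summed out with the rest of the
    placement fixed. *)
Fixpoint tsum (j : nat) (F : seq nat -> R) : R :=
  if j is j'.+1 then tsum j' (fun s => \sum_(z < n) F (rcons s z)) else F [::].

Definition bseq (j : nat) (s : seq nat) := (size s == j) && all (fun v => v < n)%N s.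

Lemma bseq_rcons j s z : bseq j s -> (z < n)%N -> bseq j.+1 (rcons s z).
Proof.
move=> /andP[/eqP sz al] zn; rewrite /bseq size_rcons sz eqxx /=.
by rewrite all_rcons zn.
Qed.

Lemma bseq_nth j s i : bseq j s -> (i < j)%N -> (nth 0 s i < n)%N.
Proof. by move=> /andP[/eqP <- /all_nthP h] /h. Qed.

Lemma bseq_size j s : bseq j s -> size s = j.
Proof. by case/andP => /eqP. Qed.

Lemma le_tsum j F G : (forall s, bseq j s -> F s <= G s) -> tsum j F <= tsum j G.
Proof.
elim: j F G => [|j IHj] F G FG /=; first exact: FG.
by apply: IHj => s bs; apply: ler_sum => z _; apply: FG; exact: bseq_rcons.
Qed.

Lemma eq_tsum j F G : (forall s, bseq j s -> F s = G s) -> tsum j F = tsum j G.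
Proof.
elim: j F G => [|j IHj] F G FG /=; first exact: FG.
by apply: IHj => s bs; apply: eq_bigr => z _; apply: FG; exact: bseq_rcons.
Qed.

Lemma tsumZ j c F : tsum j (fun s => c * F s) = c * tsum j F.
Proof.
elim: j F => [//|j IHj] F /=.
by rewrite -IHj; apply: eq_tsum => s _; rewrite mulr_sumr.
Qed.

Definition seq_of_ffun k (x : {ffun 'I_k -> 'I_n}) : seq nat :=
  [seq val (x i) | i <- enum 'I_k].

Lemma nth_seq_of_ffun k (x : {ffun 'I_k -> 'I_n}) (i : 'I_k) :
  nth 0 (seq_of_ffun x) i = x i.
Proof. by rewrite (nth_map i) ?size_enum_ord// nth_ord_enum. Qed.

Lemma size_seq_of_ffun k (x : {ffun 'I_k -> 'I_n}) : size (seq_of_ffun x) = k.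
Proof. by rewrite size_map size_enum_ord. Qed.

Definition ext_ffun k (xz : {ffun 'I_k -> 'I_n} * 'I_n) : {ffun 'I_k.+1 -> 'I_n} :=
  [ffun i => if unlift ord_max i is Some j then xz.1 j else xz.2].

Lemma ext_ffun_bij k : bijective (@ext_ffun k).
Proof.
exists (fun y : {ffun 'I_k.+1 -> 'I_n} =>
  ([ffun i => y (lift ord_max i)] : {ffun 'I_k -> 'I_n}, y ord_max)) => [[x z]|y] /=.
  congr (_, _); last by rewrite ffunE unlift_none.
  by apply/ffunP => i; rewrite !ffunE liftK.
apply/ffunP => i; rewrite ffunE; case: unliftP => [j ->|->] //=.
by rewrite ffunE.
Qed.

Lemma seq_of_ext_ffun k x z :
  seq_of_ffun (@ext_ffun k (x, z)) = rcons (seq_of_ffun x) z.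
Proof.
apply: (@eq_from_nth _ 0) => [|i].
  by rewrite size_rcons !size_seq_of_ffun.
rewrite size_seq_of_ffun => ik.
rewrite -[i]/(val (Ordinal ik)) nth_seq_of_ffun ffunE nth_rcons size_seq_of_ffun.
case: unliftP => [j /(congr1 val) /= ->|/(congr1 val) /= ->].
  have jk : (j < k)%N := ltn_ord j.
  have -> : bump k j = j by rewrite /bump leqNgt jk.
  by rewrite jk nth_seq_of_ffun.
by rewrite ltnn eqxx.
Qed.

Lemma sum_ffun_tsum k (F : seq nat -> R) :
  \sum_(x : {ffun 'I_k -> 'I_n}) F (seq_of_ffun x) = tsum k F.
Proof.
elim: k F => [|k IHk] F /=.
  rewrite (eq_bigr (fun=> F [::])); last first.
    by move=> x _; congr F; apply: size0nil; rewrite size_map size_enum_ord.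
  by rewrite sumr_const card_ffun !card_ord expn0.
rewrite -IHk (reindex _ (onW_bij _ (ext_ffun_bij k))) /= pair_big /=.
by apply: eq_bigr => -[x z] _; rewrite seq_of_ext_ffun.
Qed.

End TupleSums.

(** * Summing out the trees, then the cycle *)

Section UnicyclicSums.
Variables (R : realType) (n l k : nat) (V : nat -> nat).
Hypothesis l_gt1 : (1 < l)%N.
Hypothesis l_le_k : (l <= k)%N.
Hypothesis V_cycle : forall i, (i < l)%N -> V i = (i.+1 %% l)%N.
Hypothesis V_tree : forall i, (l <= i < k)%N -> (V i < i)%N.
Local Notation kernel := (nat -> nat -> R).
Local Notation tsum := (@tsum R n).
Local Notation kpow := (@kpow R n).
Local Notation kmx := (@kmx R n).

Definition wprod (K : nat -> kernel) j (s : seq nat) : R :=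
  \prod_(i < j) K i (nth 0 s i) (nth 0 s (V i)).

Lemma V_lt i : (i < k)%N -> (V i < maxn l i)%N.
Proof.
move=> ik; case: (ltnP i l) => il.
  by rewrite V_cycle// ltn_mod (leq_ltn_trans _ il).
by rewrite V_tree// il.
Qed.

Lemma wprod_rcons K j s z : (l <= j < k)%N -> size s = j ->
  wprod K j.+1 (rcons s z) = wprod K j s * K j z (nth 0 s (V j)).
Proof.
move=> /andP[lj jk] sj; rewrite /wprod big_ord_recr /=.
rewrite !nth_rcons sj ltnn eqxx V_tree ?lj//; congr (_ * _).
apply: eq_bigr => i _; rewrite !nth_rcons sj ltn_ord.
have -> // : (V i < j)%N.
by apply: leq_trans (V_lt (ltn_trans (ltn_ord i) jk)) _; rewrite geq_max lj ltnW.
Qed.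

Fixpoint pathmx (K : nat -> kernel) j : 'M[R]_n :=
  if j is j'.+1 then pathmx K j' *m kmx (K j') else 1%:M.

(** The kernel [G] between the two ends is arbitrary, so that the induction can move the last edge
    of the path into it; for a cycle it is the closing edge. *)
Lemma tsum_path (K : nat -> kernel) j (G : kernel) :
  tsum j.+1 (fun s => (\prod_(i < j) K i (nth 0 s i) (nth 0 s i.+1))
                      * G (nth 0 s 0) (nth 0 s j)) =
  \sum_(u < n) \sum_(v < n) pathmx K j u v * G u v.
Proof.
elim: j G => [|j IHj] G.
  rewrite /=; apply: eq_bigr => u _; rewrite (bigD1 u)//= mxE eqxx big_ord0.
  by rewrite !mul1r big1 ?addr0// => v; rewrite mxE eq_sym => /negbTE ->; rewrite mul0r.
rewrite -[LHS]/(tsum j.+1 _).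
transitivity (tsum j.+1 (fun s => (\prod_(i < j) K i (nth 0 s i) (nth 0 s i.+1)) *
    (fun u v => \sum_(z < n) K j v z * G u z) (nth 0 s 0%N) (nth 0 s j))).
  apply: eq_tsum => s /bseq_size sj; rewrite mulr_sumr; apply: eq_bigr => z _.
  rewrite big_ord_recr /= !nth_rcons sj ltnn eqxx ltnS leqnn ltn0Sn -!mulrA.
  congr (_ * _); apply: eq_bigr => i _.
  by have ij := ltn_ord i; rewrite !nth_rcons sj !ltnS (ltnW ij) ij.
rewrite (IHj (fun u v => \sum_(z < n) K j v z * G u z)); apply: eq_bigr => u _.
under eq_bigr do rewrite mulr_sumr.
rewrite exchange_big /=; apply: eq_bigr => z _.
rewrite [X in X * _]mxE mulr_suml; apply: eq_bigr => v _.
by rewrite kmxE mulrA.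
Qed.

Lemma tsum_cycle (K : nat -> kernel) : tsum l (wprod K l) = \tr (pathmx K l).
Proof.
case: l l_gt1 V_cycle => [//|l'] l1 Vc.
transitivity (tsum l'.+1 (fun s => (\prod_(i < l') K i (nth 0 s i) (nth 0 s i.+1))
                      * (fun u v => K l' v u) (nth 0 s 0%N) (nth 0 s l'))).
  apply: eq_tsum => s _; rewrite /wprod big_ord_recr /= Vc// modnn; congr (_ * _).
  apply: eq_bigr => i _; have il := ltn_ord i.
  by rewrite Vc ?modn_small// ltnS// ltnW.
rewrite (tsum_path K l' (fun u v => K l' v u)); apply: eq_bigr => u _.
by rewrite [RHS]mxE; apply: eq_bigr => v _; rewrite kmxE.
Qed.

Definition distinguish (q : nat) (A M : kernel) (i : nat) : kernel :=
  if i == q then A else M.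

Lemma pathmx_lt q A M j : (j <= q)%N -> pathmx (distinguish q A M) j = kpow M j.
Proof.
elim: j => [//|j IHj] jq; rewrite /= IHj ?(ltnW jq)//.
by rewrite /distinguish ltn_eqF.
Qed.

Lemma pathmx_gt q A M i :
  pathmx (distinguish q A M) (q + i).+1 = kpow M q *m kmx A *m kpow M i.
Proof.
elim: i => [|i IHi].
  by rewrite addn0 /= pathmx_lt// mulmx1 /distinguish eqxx.
rewrite addnS -[LHS]/(pathmx (distinguish q A M) (q + i).+1 *m
   kmx (distinguish q A M (q + i).+1)) IHi kpowS mulmxA.
by rewrite /distinguish gtn_eqF// ltnS leq_addr.
Qed.

(** The trace is cyclic, so the distinguished edge can be moved to the front and its position on the
    cycle disappears. *)
Lemma tsum_cycle_distinguish q A M : (q < l)%N ->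
  tsum l (wprod (distinguish q A M) l) =
  \sum_(u < n) \sum_(v < n) A u v * kpow M l.-1 v u.
Proof.
move=> ql; rewrite tsum_cycle.
have -> : l = (q + (l.-1 - q)).+1.
  by rewrite subnKC ?prednK// ?(ltn_trans _ l_gt1)// -ltnS prednK// (ltn_trans _ l_gt1).
rewrite pathmx_gt -mulmxA mxtrace_mulC -mulmxA -kpowD addnC /=.
apply: eq_bigr => u _; rewrite [LHS]mxE; apply: eq_bigr => v _.
by rewrite kmxE.
Qed.

Lemma tsum_cycle_weight q (h : nat -> R) M : (q < l)%N ->
  tsum l (fun s => h (nth 0 s q) * wprod (fun=> M) l s) =
  \sum_(u < n) h u * kpow M l u u.
Proof.
move=> ql.
(* The weight of a vertex is absorbed into the kernel of the edge that leaves it. *)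
transitivity (tsum l (wprod (distinguish q (fun u v => h u * M u v) M) l)).
  apply: eq_tsum => s _; rewrite /wprod (bigD1 (Ordinal ql))//=.
  rewrite [RHS](bigD1 (Ordinal ql))//= /distinguish eqxx -mulrA; congr (_ * (_ * _)).
  by apply: eq_bigr => i; rewrite -val_eqE /= => /negbTE ->.
rewrite tsum_cycle_distinguish//; apply: eq_bigr => u _.
have -> : l = (1 + l.-1)%N by rewrite add1n prednK// (ltn_trans _ l_gt1).
rewrite kpowD kpow1 [X in _ = _ * X]mxE mulr_sumr /=; apply: eq_bigr => v _.
by rewrite kmxE mulrA.
Qed.

(* Summing over a leaf either costs a factor [L] or, when the leaf carries the
   weight [h], moves the weight to its parent through [M]. *)
Lemma peel_weight (M : kernel) (L B : R) (P : R -> (nat -> R) -> Prop) :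
  (forall u v, (u < n)%N -> (v < n)%N -> 0 <= M u v) ->
  0 <= L -> (forall v, (v < n)%N -> \sum_(z < n) M z v <= L) ->
  (forall c h, P c h -> forall v, (v < n)%N -> 0 <= h v) ->
  (forall c h, P c h -> P (L * c) (fun v => \sum_(z < n) h z * M z v)) ->
  (forall c h, P c h -> \sum_(u < n) h u * kpow M l u u <= B * c) ->
  forall d q c h, (l + d <= k)%N -> (q < l + d)%N -> P c h ->
  tsum (l + d) (fun s => h (nth 0 s q) * wprod (fun=> M) (l + d) s) <=
    B * L ^+ d * c.
Proof.
move=> M0 L0 ML P0 Pop Pbase; elim=> [|d IHd] q c h.
  by rewrite addn0 expr0 mulr1 => _ ql /Pbase; rewrite tsum_cycle_weight.
rewrite addnS => ldk qd Ph.
have lj : (l <= l + d < k)%N by rewrite leq_addr.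
have w0 s : bseq n (l + d) s -> 0 <= wprod (fun=> M) (l + d) s.
  move=> bs; apply: prodr_ge0 => i _; apply: M0; apply: bseq_nth bs _ => //.
  apply: leq_trans (V_lt (ltn_trans (ltn_ord i) ldk)) _.
  by rewrite geq_max leq_addr ltnW.
move: qd; rewrite ltnS leq_eqVlt => /predU1P[->|qd].
  rewrite /= (@eq_tsum _ _ _ _ (fun s => (fun v => \sum_(z < n) h z * M z v)
      (nth 0 s (V (l + d))) * wprod (fun=> M) (l + d) s)); last first.
    move=> s /bseq_size sj; rewrite mulr_suml; apply: eq_bigr => z _.
    by rewrite wprod_rcons// nth_rcons sj ltnn eqxx; ring.
  apply: le_trans (IHd _ _ _ _ _ (Pop _ _ Ph)) _; first exact: ltnW.
    by rewrite V_tree.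
  by rewrite exprSr !mulrA.
rewrite /=; apply: (@le_trans _ _ (tsum (l + d) (fun s =>
    L * (h (nth 0 s q) * wprod (fun=> M) (l + d) s)))).
  apply: le_tsum => s bs; have sj := bseq_size bs.
  under eq_bigr do rewrite wprod_rcons// nth_rcons sj qd mulrA.
  rewrite -mulr_sumr mulrC ler_wpM2r ?mulr_ge0 ?w0//.
    by apply: P0 Ph _ _; exact: bseq_nth bs _.
  by apply: ML; apply: bseq_nth bs _; rewrite V_tree.
rewrite tsumZ; have := IHd q c h (ltnW ldk) qd Ph.
move=> /(ler_wpM2l L0) /le_trans; apply.
by rewrite exprS le_eqVlt; apply/orP; left; apply/eqP; ring.
Qed.

Lemma wprod_ge0 (K : nat -> kernel) d s : (l + d <= k)%N -> bseq n (l + d) s ->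
  (forall i u v, (u < n)%N -> (v < n)%N -> 0 <= K i u v) ->
  0 <= wprod K (l + d) s.
Proof.
move=> ldk bs K0; apply: prodr_ge0 => i _; apply: K0; apply: bseq_nth bs _ => //.
apply: leq_trans (V_lt (leq_trans (ltn_ord i) ldk)) _.
by rewrite geq_max leq_addr ltnW.
Qed.

Lemma peel (K : nat -> kernel) (L : R) d0 d :
  (forall i u v, (u < n)%N -> (v < n)%N -> 0 <= K i u v) ->
  (forall i v, (l + d0 <= i)%N -> (v < n)%N -> \sum_(z < n) K i z v <= L) ->
  0 <= L -> (l + d0 + d <= k)%N ->
  tsum (l + d0 + d) (wprod K (l + d0 + d)) <= L ^+ d * tsum (l + d0) (wprod K (l + d0)).
Proof.
move=> K0 KL L0; elim: d => [|d IHd] ldk; first by rewrite addn0 expr0 mul1r.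
rewrite addnS in ldk *; rewrite /=.
have lj : (l <= l + d0 + d < k)%N by rewrite -addnA leq_addr addnA.
apply: (@le_trans _ _ (tsum (l + d0 + d) (fun s => L * wprod K (l + d0 + d) s))).
  apply: le_tsum => s bs; have sj := bseq_size bs.
  under eq_bigr do rewrite wprod_rcons//.
  rewrite -mulr_sumr mulrC ler_wpM2r//.
    by rewrite -addnA in ldk bs *; apply: wprod_ge0 => //; exact: ltnW.
  by apply: KL; [rewrite leq_addr|apply: bseq_nth bs _; rewrite V_tree].
rewrite tsumZ exprS -mulrA ler_wpM2l// IHd// ltnW//.
Qed.

(** The trees cost [L] per edge; the cycle then costs the trace of the [l]-th power, a harmonic sum
    by [kpow_rsq], which is the extra factor [L]. *)
Lemma tsum_unicyclic (M : kernel) (c L : R) : 0 < c ->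
  (forall u v, 0 <= M u v <= c * kap R u v) ->
  (forall v, (v < n)%N -> \sum_(z < n) M z v <= L) -> (0 < n)%N -> 1 + ln n%:R <= L ->
  tsum k (wprod (fun=> M) k) <= 2 * c * (8 * c) ^+ l.-1 * L ^+ (k - l).+1.
Proof.
move=> c0 McK ML n0 nL.
have M0 u v : 0 <= M u v by have /andP[] := McK u v.
have L0 : 0 <= L by apply: le_trans nL; rewrite addr_ge0// ln_ge0// ler1n.
have h := @peel (fun=> M) L 0 (k - l) (fun _ u v _ _ => M0 u v) (fun _ v _ => ML v) L0.
rewrite addn0 subnKC// in h; apply: le_trans (h _) _ => //.
have -> : tsum l (wprod (fun=> M) l) = \sum_(u < n) 1 * kpow M l u u.
  rewrite -(@tsum_cycle_weight 0%N (fun=> 1))//; last exact: ltnW.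
  by apply: eq_tsum => s _; rewrite mul1r.
set C := 2 * c * (8 * c) ^+ l.-1.
have C0 : 0 <= C by rewrite !mulr_ge0 ?exprn_ge0 ?mulr_ge0 ?(ltW c0).
rewrite exprSr mulrA -mulrA mulrCA ler_wpM2l ?exprn_ge0//.
apply: (@le_trans _ _ (\sum_(u < n) C * u.+1%:R^-1)).
  apply: ler_sum => u _; rewrite mul1r -rsq_sq.
  have := kpow_rsq l.-1 (ltW c0) McK u u; rewrite prednK; last exact: ltnW.
  by case/andP.
by rewrite -mulr_sumr ler_wpM2l// (le_trans _ nL)// harmonic_ub.
Qed.

(** The weight at one vertex turns the harmonic sum of the trace into the convergent sum of
    [(u + 1)^(-3/2)], at most 3, and so saves the logarithm of the cycle. From a vertex in a tree,
    Schur's test carries the weight towards the cycle at a cost [8 c <= L] per edge. *)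
Lemma tsum_unicyclic_edge (M : kernel) (c L : R) q : 0 < c ->
  (forall u v, 0 <= M u v <= c * kap R u v) ->
  (forall u v, M u v = M v u) ->
  (forall v, (v < n)%N -> \sum_(z < n) M z v <= L) -> (0 < n)%N -> 8 * c <= L -> (q < k)%N ->
  tsum k (fun s => rsq R (nth 0%N s q) * wprod (fun=> M) k s) <=
  6 * c * (8 * c) ^+ l.-1 * L ^+ (k - l).
Proof.
move=> c0 McK MC ML n0 cL qk.
have M0 u v : 0 <= M u v by have /andP[] := McK u v.
have L0 : 0 <= L by apply: le_trans cL; rewrite mulr_ge0// ltW.
have := @peel_weight M L (6 * c * (8 * c) ^+ l.-1)
  (fun c' h => forall v, (v < n)%N -> 0 <= h v <= c' * rsq R v)
  (fun u v _ _ => M0 u v) L0 ML _ _ _ (k - l) q 1 (rsq R).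
rewrite subnKC// mulr1; apply => //.
- by move=> c' h Ph v vn; have /andP[] := Ph v vn.
- move=> c' h Ph v vn; apply/andP; split.
    by apply: sumr_ge0 => z _; rewrite mulr_ge0//; have /andP[] := Ph z (ltn_ord z).
  have c'0 : 0 <= c'.
    by have /andP[h1 h2] := Ph v vn; have := le_trans h1 h2; rewrite pmulr_lge0 ?rsq_gt0.
  apply: (@le_trans _ _ (\sum_(z < n) c' * c * (kap R v z * rsq R z))).
    apply: ler_sum => z _; have /andP[h1 h2] := Ph z (ltn_ord z).
    have /andP[_ h3] := McK z v.
    apply: le_trans (ler_pM h1 (M0 z v) h2 h3) _.
    by rewrite (kapC R v z) le_eqVlt; apply/orP; left; apply/eqP; ring.
  rewrite -mulr_sumr.
  apply: (@le_trans _ _ (c' * c * (8 * rsq R v))).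
    by rewrite ler_wpM2l ?kap_rsq// mulr_ge0// ltW.
  rewrite (_ : c' * c * (8 * rsq R v) = 8 * c * (c' * rsq R v)); last by ring.
  by rewrite -(mulrA L) ler_wpM2r// mulr_ge0// ltW// rsq_gt0.
- move=> c' h Ph.
  have c'0 (v : 'I_n) : 0 <= c'.
    by have /andP[h1 h2] := Ph v (ltn_ord v); have := le_trans h1 h2; rewrite pmulr_lge0 ?rsq_gt0.
  set C := (8 * c) ^+ l.-1.
  have C0 : 0 <= C by rewrite exprn_ge0// mulr_ge0// ltW.
  apply: (@le_trans _ _ (\sum_(u < n) c' * (2 * c * C) * (rsq R u * u.+1%:R^-1))).
    apply: ler_sum => u _; have /andP[h1 h2] := Ph u (ltn_ord u).
    have := kpow_rsq l.-1 (ltW c0) McK u u; rewrite prednK; last exact: ltnW.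
    rewrite rsq_sq => /andP[h3 h4].
    apply: le_trans (ler_pM h1 h3 h2 h4) _.
    by rewrite -/C le_eqVlt; apply/orP; left; apply/eqP; ring.
  rewrite -mulr_sumr.
  apply: (@le_trans _ _ (c' * (2 * c * C) * 3)).
    by rewrite ler_wpM2l ?sum_rsq_inv// !mulr_ge0 ?(c'0 (Ordinal n0))// ltW.
  by rewrite le_eqVlt; apply/orP; left; apply/eqP; ring.
- by move=> v vn; rewrite mul1r lexx andbT ltW// rsq_gt0.
Qed.

(** If the pinned edge is on the cycle, the rest of the cycle is a bounded entry of a power of [M],
    and the edge costs [B]. If it is in a tree, summing out its leaf leaves on the parent a weight
    of total mass at most [B], which is carried down to the cycle, where the diagonal is bounded. In
    both cases the cycle costs no logarithm. *)
Lemma tsum_unicyclic_pinned (M Q : kernel) (a B L : R) q : 0 <= a ->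
  (forall u v, (u < n)%N -> (v < n)%N -> 0 <= M u v <= a * kap R u v + Q u v) ->
  (forall u v, (u < n)%N -> (v < n)%N -> 0 <= Q u v) ->
  (forall u v, M u v = M v u) ->
  \sum_(u < n) \sum_(v < n) Q u v <= B ->
  (forall v, (v < n)%N -> \sum_(z < n) M z v <= L) ->
  1 <= L -> (q < k)%N ->
  tsum k (wprod (distinguish q Q M) k) <=
  2 * (10 * a + 2 * B + 1) ^+ l * B * L ^+ (k - l).
Proof.
move=> a0 MQ Q0 MC QB ML L1 qk.
have L0 : 0 <= L by exact: le_trans L1.
have B0 : 0 <= B.
  by apply: le_trans QB; apply: sumr_ge0 => i _; apply: sumr_ge0 => j _; exact: Q0.
have M0 u v : (u < n)%N -> (v < n)%N -> 0 <= M u v.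
  by move=> un vn; have /andP[] := MQ u v un vn.
have K0 i u v : (u < n)%N -> (v < n)%N -> 0 <= distinguish q Q M i u v.
  by rewrite /distinguish; case: ifP => _; [exact: Q0|exact: M0].
(* The 1 makes [D] at least 1, so that all powers up to the [l]-th are bounded by the [l]-th. *)
set D := 10 * a + 2 * B + 1.
have D1 : 1 <= D by rewrite lerDr addr_ge0// mulr_ge0.
have pow_le j : (j <= l)%N -> forall u v : 'I_n, kpow M j u v <= 2 * D ^+ l.
  move=> jl u v; have /andP[_ h] := kpow_bounded j a0 MQ Q0 QB u v.
  apply: le_trans h _; rewrite ler_pM2l//.
  apply: (@le_trans _ _ (D ^+ j)); last by rewrite ler_weXn2l.
  by rewrite lerXn2r// ?nnegrE ?addr_ge0 ?mulr_ge0// lerDl.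
have C0 : 0 <= 2 * D ^+ l by rewrite mulr_ge0// exprn_ge0// (le_trans _ D1).
case: (ltnP q l) => ql.
  have h := @peel (distinguish q Q M) L 0 (k - l) K0.
  rewrite addn0 subnKC// in h.
  apply: le_trans (h _ L0 _) _ => //.
    by move=> i v li vn; rewrite /distinguish gtn_eqF ?ML// (leq_trans ql).
  rewrite tsum_cycle_distinguish// mulrC ler_wpM2r ?exprn_ge0//.
  apply: (@le_trans _ _ (\sum_(u < n) \sum_(v < n) 2 * D ^+ l * Q u v)).
    apply: ler_sum => u _; apply: ler_sum => v _.
    by rewrite mulrC ler_wpM2r ?Q0// pow_le// leq_pred.
  by under eq_bigr do rewrite -mulr_sumr; rewrite -mulr_sumr ler_wpM2l.
pose d0 := (q - l)%N.
have qE : q = (l + d0)%N by rewrite subnKC.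
have kE : k = (l + d0.+1 + (k - q.+1))%N by rewrite addnS -qE subnKC.
have h := @peel (distinguish q Q M) L d0.+1 (k - q.+1) K0.
rewrite -kE in h; apply: le_trans (h _ L0 _) _ => //.
  move=> i v; rewrite addnS -qE => qi vn.
  by rewrite /distinguish gtn_eqF// ML.
have Pb := @peel_weight M L (2 * D ^+ l)
  (fun c h => (forall v, (v < n)%N -> 0 <= h v) /\ \sum_(u < n) h u <= c)
  M0 L0 ML _ _ _ d0 (V q) B (fun y => \sum_(z < n) Q z y).
rewrite addnS /= (@eq_tsum _ _ _ _ (fun s => (fun y => \sum_(z < n) Q z y)
    (nth 0%N s (V (l + d0))) * wprod (fun=> M) (l + d0) s)); last first.
  move=> s /bseq_size sj; rewrite mulr_suml; apply: eq_bigr => z _.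
  rewrite wprod_rcons// -?qE ?ql//; rewrite mulrC /distinguish eqxx; congr (_ * _).
  by apply: eq_bigr => i _; rewrite ltn_eqF.
rewrite -qE in Pb *.
apply: (@le_trans _ _ (L ^+ (k - q.+1) * (2 * D ^+ l * L ^+ d0 * B))).
  rewrite ler_wpM2l ?exprn_ge0//; apply: Pb.
  - by move=> c g [].
  - move=> c g [g0 gc]; split.
      by move=> v vn; apply: sumr_ge0 => z _; rewrite mulr_ge0 ?g0 ?M0.
    rewrite exchange_big /=.
    apply: (@le_trans _ _ (\sum_(z < n) g z * L)).
      apply: ler_sum => z _; rewrite -mulr_sumr ler_wpM2l ?g0//.
      by under eq_bigr do rewrite MC; exact: ML.
    by rewrite -mulr_suml mulrC ler_wpM2l.
  - move=> c g [g0 gc].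
    apply: (@le_trans _ _ (\sum_(u < n) g u * (2 * D ^+ l))).
      by apply: ler_sum => u _; rewrite ler_wpM2l ?g0 ?pow_le.
    by rewrite -mulr_suml mulrC ler_wpM2l.
  - exact: ltnW.
  - by rewrite V_tree// ql.
  - split; last by rewrite exchange_big.
    by move=> v vn; apply: sumr_ge0 => z _; exact: Q0.
have -> : L ^+ (k - q.+1) * (2 * D ^+ l * L ^+ d0 * B) =
  2 * D ^+ l * B * L ^+ (k - q.+1 + d0) by rewrite exprD; ring.
apply: ler_wpM2l; first exact: mulr_ge0.
apply: ler_weXn2l => //; move: ql qk; rewrite /d0; clear; lia.
Qed.

End UnicyclicSums.

(** * Local dependence *)

Section LocalDependence.
Variables (R : realType) (m n : nat) (I : finType) (P : pred I).
Local Notation Om := (ua_space m n).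
Variables (X : I -> Om -> R) (ch : I -> {set ua_edge m n}) (kk : nat) (c : R).
Implicit Types D : {set ua_edge m n}.
Hypothesis X_ge0 : forall i w, 0 <= X i w.
Hypothesis X_dep : forall i, depends_on (ch i) (X i).
Hypothesis ch_card : forall i, P i -> (#|ch i| <= kk)%N.

Definition meets (D : {set ua_edge m n}) (i : I) := ~~ [disjoint ch i & D].

Definition hitsum (D : {set ua_edge m n}) (w : Om) : R :=
  \sum_(i | P i && meets D i) X i w.

Hypothesis c_ge0 : 0 <= c.
(** A bound for the conditional expectation given the choices in [D], tested on nonnegative [h]. The
    size [2 * kk] leaves room for the choices of two summands at once. *)
Hypothesis hitsum_le : forall (D : {set ua_edge m n}) (h : Om -> R), (#|D| <= 2 * kk)%N ->
  depends_on D h -> (forall w, 0 <= h w) ->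
  Ex (fun w => h w * hitsum D w) <= c * Ex h.

Definition total (w : Om) : R := \sum_(i | P i) X i w.
Local Notation mean := (Ex total).
Local Notation p i := (Ex (X i)).
Definition centred i (w : Om) : R := X i w - p i.
Definition ctotal (w : Om) : R := total w - mean.
Definition total_var : R := Ex (fun w => ctotal w ^+ 2).
Definition near_sum D (w : Om) : R := \sum_(i | P i && meets D i) centred i w.
Definition far_sum D (w : Om) : R := \sum_(i | P i && ~~ meets D i) centred i w.

Lemma mean_sum : mean = \sum_(i | P i) p i.
Proof. by rewrite /total Ex_sum. Qed.

Lemma p_ge0 i : 0 <= p i. Proof. exact: Ex_ge0. Qed.

Lemma ctotal_sum w : ctotal w = \sum_(i | P i) centred i w.
Proof. by rewrite /ctotal mean_sum /total -sumrB. Qed.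

Lemma ctotal_split D w : ctotal w = near_sum D w + far_sum D w.
Proof. by rewrite ctotal_sum (bigID (meets D)). Qed.

Lemma Ex_centred i : Ex (centred i) = 0.
Proof. by rewrite /centred ExB Ex_cst subrr. Qed.

Lemma depends_on_centred i : depends_on (ch i) (centred i).
Proof. exact: (depends_on_comp (fun x => x - p i)). Qed.

Lemma depends_on_far D : depends_on (~: D) (far_sum D).
Proof.
apply: depends_on_sum => i /andP[_]; rewrite negbK => dij.
apply: depends_onS (@depends_on_centred i).
by rewrite finset.subsets_disjoint finset.setCK.
Qed.

Lemma Ex_far D (h : Om -> R) (f : R -> R) : depends_on D h ->
  Ex (fun w => h w * f (far_sum D w)) = Ex h * Ex (fun w => f (far_sum D w)).
Proof.
by move=> dh; apply: (Ex_indep dh); apply: depends_on_comp; exact: depends_on_far.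
Qed.

Lemma covE i j : Ex (fun w => centred i w * centred j w) =
  Ex (fun w => X i w * X j w) - p i * p j.
Proof.
transitivity (Ex (fun w => X i w * X j w - p i * X j w + (- p j) * centred i w)).
  by apply: eq_Ex => w; rewrite /centred; ring.
by rewrite ExD ExB !ExZ Ex_centred mulr0 addr0.
Qed.

Lemma Ex_centred_ctotal i : Ex (fun w => centred i w * ctotal w) =
  \sum_(j | P j && meets (ch i) j) Ex (fun w => centred i w * centred j w).
Proof.
transitivity (Ex (fun w => centred i w * near_sum (ch i) w) +
              Ex (fun w => centred i w * far_sum (ch i) w)).
  by rewrite -ExD; apply: eq_Ex => w; rewrite -mulrDr -ctotal_split.
rewrite (@Ex_far (ch i) _ id); last exact: depends_on_centred.
rewrite Ex_centred mul0r addr0 -Ex_sum; apply: eq_Ex => w.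
by rewrite mulr_sumr.
Qed.

Lemma varianceE : total_var =
  \sum_(i | P i) \sum_(j | P j && meets (ch i) j)
     Ex (fun w => centred i w * centred j w).
Proof.
under [RHS]eq_bigr do rewrite -Ex_centred_ctotal.
rewrite -Ex_sum; apply: eq_Ex => w.
by rewrite -mulr_suml -ctotal_sum expr2.
Qed.

Lemma card_ch i : P i -> (#|ch i| <= 2 * kk)%N.
Proof. by move=> /ch_card h; rewrite mul2n -addnn (leq_trans h)// leq_addr. Qed.

(** The terms [- p i * p j] are dropped, and conditioning on the choices of [i] bounds the sum over
    [j] of [Ex (X i * X j)] by [c * p i]. *)
Lemma variance_le : total_var <= c * mean.
Proof.
rewrite varianceE mean_sum mulr_sumr; apply: ler_sum => i Pi.
have := hitsum_le (card_ch Pi) (@X_dep i) (X_ge0 i).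
apply: le_trans; rewrite /hitsum.
under [leRHS]eq_Ex do rewrite mulr_sumr.
rewrite Ex_sum; apply: ler_sum => j _; rewrite covE.
by rewrite gerBl mulr_ge0 ?p_ge0.
Qed.

Lemma Ex_hitsum_le D : (#|D| <= 2 * kk)%N -> Ex (hitsum D) <= c.
Proof.
move=> Dk; have := @hitsum_le D (fun=> 1) Dk (@depends_on_cst _ _ _ _ _) (fun=> ler01).
by rewrite Ex_cst mulr1; under eq_Ex do rewrite mul1r.
Qed.

Lemma norm_centred_le i w : `|centred i w| <= X i w + p i.
Proof.
rewrite /centred; apply: le_trans (ler_normB _ _) _.
by rewrite !ger0_norm// p_ge0.
Qed.

Lemma norm_near_le D w : (#|D| <= 2 * kk)%N -> `|near_sum D w| <= hitsum D w + c.
Proof.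
move=> Dk; apply: le_trans (ler_norm_sum _ _ _) _.
apply: (@le_trans _ _ (\sum_(i | P i && meets D i) (X i w + p i))).
  by apply: ler_sum => i _; exact: norm_centred_le.
rewrite big_split /= lerD2l; apply: le_trans (Ex_hitsum_le Dk).
by rewrite /hitsum Ex_sum.
Qed.

Lemma meetsS D D' i : D \subset D' -> meets D i -> meets D' i.
Proof. by move=> DD'; apply: contra; exact: disjointWr. Qed.

Lemma hitsum_sub D D' w : D \subset D' -> hitsum D w <= hitsum D' w.
Proof.
move=> DD'; rewrite /hitsum [leRHS](bigID (meets D)) /=.
rewrite [X in _ <= X + _](eq_bigl (fun i => P i && meets D i)); last first.
  move=> i; case: (P i) => //=; case: (boolP (meets D i)); last by rewrite andbF.
  by move=> /(meetsS DD') ->.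
by rewrite lerDl sumr_ge0.
Qed.

(** A nonnegative bound for the product of two centred summands, fit to serve as [h] in
    [hitsum_le]. *)
Definition pairw i j (w : Om) : R := (X i w + p i) * (X j w + p j).

Lemma pairw_ge0 i j w : 0 <= pairw i j w.
Proof. by rewrite mulr_ge0// addr_ge0// p_ge0. Qed.

Lemma depends_on_pairw i j : depends_on (ch i :|: ch j) (pairw i j).
Proof.
apply: depends_onM; apply: depends_on_comp (fun x => x + _) _.
  exact: depends_onS (finset.subsetUl _ _) (@X_dep i).
exact: depends_onS (finset.subsetUr _ _) (@X_dep j).
Qed.

Lemma card_chU i j : P i -> P j -> (#|ch i :|: ch j| <= 2 * kk)%N.
Proof.
move=> Pi Pj; rewrite cardsU (leq_trans (leq_subr _ _))//.
by rewrite mul2n -addnn leq_add ?ch_card.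
Qed.

Lemma Ex_pairw_hit i j : P i -> P j ->
  Ex (fun w => pairw i j w * (hitsum (ch i :|: ch j) w + c)) <=
  2 * c * Ex (pairw i j).
Proof.
move=> Pi Pj; under eq_Ex do rewrite mulrDr.
rewrite ExD ExZr.
have := hitsum_le (card_chU Pi Pj) (@depends_on_pairw i j) (pairw_ge0 i j).
rewrite (mulrC _ c); lra.
Qed.

Lemma sum_Ex_pairw : \sum_(i | P i) \sum_(j | P j && meets (ch i) j) Ex (pairw i j) <=
  4 * c * mean.
Proof.
rewrite mean_sum mulr_sumr; apply: ler_sum => i Pi.
pose h w := X i w + p i.
have dh : depends_on (ch i) h by exact: (depends_on_comp (fun x => x + p i)).
have h0 w : 0 <= h w by rewrite addr_ge0// p_ge0.
have Exh : Ex h = 2 * p i by rewrite /h ExD Ex_cst mulr_natl mulr2n.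
have := hitsum_le (card_ch Pi) dh h0.
have hE : Ex (hitsum (ch i)) <= c := Ex_hitsum_le (card_ch Pi).
rewrite -Ex_sum => h1.
have -> : Ex (fun w => \sum_(j | P j && meets (ch i) j) pairw i j w) =
    Ex (fun w => h w * hitsum (ch i) w) + Ex h * Ex (hitsum (ch i)).
  rewrite -ExZr -ExD; apply: eq_Ex => w; rewrite -mulrDr.
  rewrite /hitsum Ex_sum -big_split mulr_sumr /=; exact: eq_bigr.
have : Ex h * Ex (hitsum (ch i)) <= Ex h * c by rewrite ler_wpM2l ?Ex_ge0.
move: h1; rewrite Exh; lra.
Qed.

Section SteinError.
Variables (s K : R) (f f' : R -> R).
Hypothesis s_gt0 : 0 < s.
Hypothesis s_var : s ^+ 2 = total_var.
Hypothesis K_ge0 : 0 <= K.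
Hypothesis df : forall x : R, is_derive x 1 f (f' x).
Hypothesis f'_lip : forall x y, `|f' x - f' y| <= K * `|x - y|.

Lemma taylor1 x y : `|f x - f y - (x - y) * f' x| <= K * (x - y) ^+ 2.
Proof.
have cf : continuous f by exact: is_derive_continuous df.
have MV a b : a <= b -> exists2 z, a <= z <= b & f b - f a = f' z * (b - a).
  move=> ab; have [|z] := @MVT_segment R f f' a b ab (fun z _ => df z).
    exact: continuous_subspaceT.
  by rewrite in_itv /=; exists z.
have [z [zx fE]] : exists z, `|z - x| <= `|x - y| /\ f x - f y = f' z * (x - y).
  have [xy|/ltW yx] := leP x y.
    have [z /andP[z1 z2] E] := MV x y xy; exists z; split; last by lra.
    rewrite ger0_norm ?subr_ge0// distrC ger0_norm ?subr_ge0//; lra.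
  have [z /andP[z1 z2] E] := MV y x yx; exists z; split => //.
  rewrite distrC ger0_norm ?subr_ge0// ger0_norm ?subr_ge0//; lra.
rewrite fE mulrC -mulrBr normrM.
apply: (@le_trans _ _ (`|x - y| * (K * `|x - y|))).
  by rewrite ler_wpM2l// (le_trans (f'_lip _ _))// ler_wpM2l.
by rewrite mulrCA -expr2 real_normK ?num_real.
Qed.

Local Notation U w := (ctotal w / s).
Local Notation xi i w := (centred i w / s).

Lemma s3_gt0 : 0 < s^-1 ^+ 3. Proof. by rewrite exprn_gt0// invr_gt0. Qed.

(* Stein's method with [U] replaced by its part which is independent of [xi i],
   then, in [second_order], of [xi i] and [xi j]. *)
Lemma first_order i : P i ->
  `|Ex (fun w => xi i w * f (U w)) -
    \sum_(j | P j && meets (ch i) j) Ex (fun w => xi i w * xi j w * f' (U w))| <=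
  K * s^-1 ^+ 3 * (2 * c) * \sum_(j | P j && meets (ch i) j) Ex (pairw i j).
Proof.
move=> Pi; set D := ch i.
(* [far_sum D] is independent of [xi i], which has mean 0; subtracting this term leaves an increment
   of [f], to which [taylor1] applies. *)
have z0 : Ex (fun w => xi i w * f (far_sum D w / s)) = 0.
  rewrite (@Ex_far D (fun w => xi i w) (fun x => f (x / s))); last first.
    exact: (depends_on_comp (fun x => x / s) (@depends_on_centred i)).
  by rewrite ExZr Ex_centred !mul0r.
have -> : Ex (fun w => xi i w * f (U w)) =
    Ex (fun w => xi i w * f (U w) - xi i w * f (far_sum D w / s)).
  by rewrite ExB z0 subr0.
rewrite -(Ex_sum _ (fun j w => xi i w * xi j w * f' (U w))) -ExB.
rewrite mulr_sumr.
apply: le_trans (norm_Ex_le _) _.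
apply: (@le_trans _ _ (Ex (fun w => \sum_(j | P j && meets D j)
    K * s^-1 ^+ 3 * (pairw i j w * (hitsum (ch i :|: ch j) w + c))))).
  apply: le_Ex => w.
  have -> : \sum_(j | P j && meets D j) xi i w * xi j w * f' (U w) =
      xi i w * ((near_sum D w / s) * f' (U w)).
    by rewrite /near_sum mulr_suml mulr_suml mulr_sumr; apply: eq_bigr => j _; ring.
  have -> : xi i w * f (U w) - xi i w * f (far_sum D w / s) -
      xi i w * (near_sum D w / s * f' (U w)) =
    xi i w * (f (U w) - f (far_sum D w / s) - (U w - far_sum D w / s) * f' (U w)).
    by rewrite (ctotal_split D); ring.
  have := taylor1 (U w) (far_sum D w / s); rewrite (ctotal_split D) => t1.
  rewrite normrM; apply: le_trans (ler_wpM2l (normr_ge0 _) t1) _.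
  have -> : (near_sum D w + far_sum D w) / s - far_sum D w / s = near_sum D w / s by ring.
  rewrite -real_normK ?num_real// expr2.
  rewrite !normrM normfV (gtr0_norm s_gt0).
  have -> : `|centred i w| / s * (K * (`|near_sum D w| / s * (`|near_sum D w| / s))) =
     K * s^-1 ^+ 3 * (`|centred i w| * `|near_sum D w| * `|near_sum D w|) by ring.
  have K3 : 0 <= K * s^-1 ^+ 3 by rewrite mulr_ge0// ltW// s3_gt0.
  rewrite -mulr_sumr ler_wpM2l//.
  apply: (@le_trans _ _ (`|centred i w| * (\sum_(j | P j && meets D j) `|centred j w|) *
       `|near_sum D w|)).
    by rewrite ler_wpM2r// ler_wpM2l// ler_norm_sum.
  rewrite mulr_sumr mulr_suml; apply: ler_sum => j _.
  apply: ler_pM; rewrite ?mulr_ge0//.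
    by rewrite ler_pM// norm_centred_le.
  apply: le_trans (norm_near_le _ (card_ch Pi)) _.
  by rewrite lerD2r hitsum_sub// finset.subsetUl.
rewrite Ex_sum; apply: ler_sum => j /andP[Pj _].
have K3 : 0 <= K * s^-1 ^+ 3 by rewrite mulr_ge0// ltW// s3_gt0.
rewrite ExZ -[leRHS]mulrA ler_wpM2l//.
exact: Ex_pairw_hit.
Qed.

Lemma second_order i j : P i -> P j ->
  `|Ex (fun w => xi i w * xi j w * f' (U w)) -
    Ex (fun w => xi i w * xi j w) * Ex (fun w => f' (U w))| <=
  K * s^-1 ^+ 3 * (4 * c) * Ex (pairw i j).
Proof.
move=> Pi Pj; set E := ch i :|: ch j.
have Ek := card_chU Pi Pj.
have dE : depends_on E (fun w => xi i w * xi j w).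
  apply: depends_onM; apply: depends_on_comp (fun x => x / s) _.
    exact: depends_onS (finset.subsetUl _ _) (@depends_on_centred i).
  exact: depends_onS (finset.subsetUr _ _) (@depends_on_centred j).
have fl w : `|f' (U w) - f' (far_sum E w / s)| <= K * s^-1 * (hitsum E w + c).
  apply: le_trans (f'_lip _ _) _; rewrite -mulrA ler_wpM2l//.
  rewrite (ctotal_split E) -mulrBl addrK normrM normfV (gtr0_norm s_gt0) mulrC.
  by rewrite ler_wpM2l ?invr_ge0 ?(ltW s_gt0)// norm_near_le.
have xx w : `|xi i w * xi j w| <= s^-1 ^+ 2 * pairw i j w.
  rewrite !normrM normfV (gtr0_norm s_gt0).
  have -> : `|centred i w| / s * (`|centred j w| / s) =
    s^-1 ^+ 2 * (`|centred i w| * `|centred j w|) by ring.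
  rewrite ler_wpM2l ?exprn_ge0 ?invr_ge0 ?(ltW s_gt0)//.
  by rewrite ler_pM// norm_centred_le.
have p0 := Ex_ge0 (pairw_ge0 i j).
have s0 : 0 <= s^-1 by rewrite invr_ge0 ltW.
have K3 : 0 <= K * s^-1 ^+ 3 by rewrite mulr_ge0// exprn_ge0.
have T1 : `|Ex (fun w => xi i w * xi j w * f' (U w)) -
     Ex (fun w => xi i w * xi j w * f' (far_sum E w / s))| <=
     K * s^-1 ^+ 3 * (2 * c * Ex (pairw i j)).
  rewrite -ExB; apply: le_trans (norm_Ex_le _) _.
  apply: le_trans (_ : Ex (fun w => K * s^-1 ^+ 3 * (pairw i j w * (hitsum E w + c))) <= _).
    apply: le_Ex => w; rewrite -mulrBr normrM.
    apply: le_trans (ler_pM (normr_ge0 _) (normr_ge0 _) (xx w) (fl w)) _.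
    by rewrite le_eqVlt; apply/orP; left; apply/eqP; ring.
  by rewrite ExZ ler_wpM2l// Ex_pairw_hit.
rewrite (@Ex_far E (fun w => xi i w * xi j w) (fun x => f' (x / s)) dE) in T1.
have T2 : `|Ex (fun w => xi i w * xi j w) * Ex (fun w => f' (far_sum E w / s)) -
     Ex (fun w => xi i w * xi j w) * Ex (fun w => f' (U w))| <=
     K * s^-1 ^+ 3 * (2 * c * Ex (pairw i j)).
  rewrite -mulrBr normrM.
  have e1 : `|Ex (fun w => xi i w * xi j w)| <= s^-1 ^+ 2 * Ex (pairw i j).
    by apply: le_trans (norm_Ex_le _) _; rewrite -ExZ; exact: le_Ex.
  have e2 : `|Ex (fun w => f' (far_sum E w / s)) - Ex (fun w => f' (U w))| <=
      K * s^-1 * (2 * c).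
    rewrite distrC -ExB; apply: le_trans (norm_Ex_le _) _.
    apply: le_trans (le_Ex fl) _; rewrite ExZ ExD Ex_cst ler_wpM2l ?mulr_ge0//.
    have := Ex_hitsum_le Ek; lra.
  apply: le_trans (ler_pM (normr_ge0 _) (normr_ge0 _) e1 e2) _.
  by rewrite le_eqVlt; apply/orP; left; apply/eqP; ring.
have := ler_distD (Ex (fun w => xi i w * xi j w) * Ex (fun w => f' (far_sum E w / s)))
  (Ex (fun w => xi i w * xi j w * f' (U w)))
  (Ex (fun w => xi i w * xi j w) * Ex (fun w => f' (U w))).
move=> /le_trans; apply; apply: le_trans (lerD T1 T2) _.
by rewrite le_eqVlt; apply/orP; left; apply/eqP; ring.
Qed.

Lemma stein_error :
  `|Ex (fun w => f' (U w) - U w * f (U w))| <= 24 * K * c ^+ 2 * mean / s ^+ 3.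
Proof.
have s0 : s != 0 by rewrite gt_eqF.
have V1 : \sum_(i | P i) \sum_(j | P j && meets (ch i) j)
    Ex (fun w => xi i w * xi j w) = 1.
  have -> : 1 = s^-1 ^+ 2 * total_var by rewrite -s_var -exprMn mulVf// expr1n.
  rewrite varianceE mulr_sumr; apply: eq_bigr => i _; rewrite mulr_sumr.
  apply: eq_bigr => j _; rewrite -ExZ; apply: eq_Ex => w; ring.
rewrite ExB distrC.
have -> : Ex (fun w => f' (U w)) = \sum_(i | P i) \sum_(j | P j && meets (ch i) j)
    Ex (fun w => xi i w * xi j w) * Ex (fun w => f' (U w)).
  under eq_bigr do rewrite -mulr_suml; by rewrite -mulr_suml V1 mul1r.
have -> : Ex (fun w => U w * f (U w)) = \sum_(i | P i) Ex (fun w => xi i w * f (U w)).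
  by rewrite -Ex_sum; apply: eq_Ex => w; rewrite -mulr_suml -mulr_suml -ctotal_sum.
rewrite -sumrB; apply: le_trans (ler_norm_sum _ _ _) _.
(* The 6 is [2 + 4], from [first_order] and [second_order]; [sum_Ex_pairw] contributes the remaining
   factor [4 * c]. *)
apply: (@le_trans _ _ (\sum_(i | P i) K * s^-1 ^+ 3 * (6 * c) *
    \sum_(j | P j && meets (ch i) j) Ex (pairw i j))).
  apply: ler_sum => i Pi.
  apply: le_trans (ler_distD (\sum_(j | P j && meets (ch i) j)
     Ex (fun w => xi i w * xi j w * f' (U w))) _ _) _.
  have F1 := first_order Pi.
  have F2 : `|\sum_(j | P j && meets (ch i) j) Ex (fun w => xi i w * xi j w * f' (U w)) -
     \sum_(j | P j && meets (ch i) j) Ex (fun w => xi i w * xi j w) * Ex (fun w => f' (U w))|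
     <= K * s^-1 ^+ 3 * (4 * c) * \sum_(j | P j && meets (ch i) j) Ex (pairw i j).
    rewrite -sumrB mulr_sumr; apply: le_trans (ler_norm_sum _ _ _) _.
    by apply: ler_sum => j /andP[Pj _]; exact: second_order.
  apply: le_trans (lerD F1 F2) _.
  by rewrite le_eqVlt; apply/orP; left; apply/eqP; ring.
rewrite -mulr_sumr.
apply: le_trans (ler_wpM2l _ sum_Ex_pairw) _.
  have K3 : 0 <= K * s^-1 ^+ 3 by rewrite mulr_ge0// ltW// s3_gt0.
  by rewrite mulr_ge0// mulr_ge0.
by rewrite le_eqVlt; apply/orP; left; apply/eqP; field.
Qed.

End SteinError.
End LocalDependence.

(** * Occurrences of a unicyclic pattern *)

Section Model.
Variables (R : realType) (m n l k : nat) (V : nat -> nat).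
Hypothesis l_gt1 : (1 < l)%N.
Hypothesis l_le_k : (l <= k)%N.
Hypothesis V_cycle : forall i, (i < l)%N -> V i = (i.+1 %% l)%N.
Hypothesis V_tree : forall i, (l <= i < k)%N -> (V i < i)%N.
Local Notation Om := (ua_space m n).
Local Notation edge := (ua_edge m n).
Implicit Types D : {set ua_edge m n}.

Lemma V_ltk i : (i < k)%N -> (V i < k)%N.
Proof.
move=> ik; apply: leq_trans (V_lt V_cycle V_tree ik) _.
by rewrite geq_max l_le_k ltnW.
Qed.

Lemma V_neq i : (i < k)%N -> V i != i.
Proof.
move=> ik; case: (ltnP i l) => il; last by rewrite ltn_eqF// V_tree// il.
rewrite V_cycle//; case: (ltnP i.+1 l) => Sil; first by rewrite modn_small// gtn_eqF.
have -> : i.+1 = l by apply/eqP; rewrite eqn_leq il.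
by rewrite modnn; case: i ik il Sil l_gt1 => // _ _; rewrite leqNgt => /negbTE ->.
Qed.

Definition Vo (i : 'I_k) : 'I_k := insubd i (V i).

Lemma VoE i : Vo i = V i :> nat.
Proof. by rewrite val_insubd V_ltk. Qed.

(* The [i]-th edge of the pattern joins the [i]-th vertex to the [V i]-th one:
   the first component of a [conf] places the vertices and the second one the
   edges. *)
Definition conf : finType := ({ffun 'I_k -> 'I_n} * {ffun 'I_k -> ua_edge m n})%type.

Implicit Types a : conf.

Definition hi (x : {ffun 'I_k -> 'I_n}) i : nat := maxn (x i) (x (Vo i)).
Definition lo (x : {ffun 'I_k -> 'I_n}) i : nat := minn (x i) (x (Vo i)).

(** The conditions for an embedding that do not involve the outcome; those that do are the factors
    of [occurs]. *)
Definition valid a : bool :=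
  [&& injectiveb a.1, injectiveb a.2 &
      [forall i, ((val (a.2 i)).1 : nat) == hi a.1 i]].

Definition occurs a (w : Om) : R :=
  \prod_(i < k) hits R (a.2 i) (lo a.1 i) w.

Definition choices a : {set ua_edge m n} := finset (mem (codom a.2)).

Lemma validP a : reflect [/\ injective a.1, injective a.2 &
    forall i, (val (a.2 i)).1 = hi a.1 i :> nat] (valid a).
Proof.
apply: (iffP and3P) => -[].
  by move=> /injectiveP ? /injectiveP ? /forallP h; split => // i; apply/eqP.
by move=> ? ? h; split; [exact/injectiveP|exact/injectiveP|apply/forallP => i; rewrite h].
Qed.

Lemma lo_lt_hi (x : {ffun 'I_k -> 'I_n}) i : injective x -> (lo x i < hi x i)%N.
Proof.
move=> xi; have ne : x i != x (Vo i) :> nat.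
  apply/eqP => /val_inj/xi /(congr1 val) /= /esym/eqP.
  by rewrite VoE (negbTE (V_neq _)).
by rewrite /lo /hi; move: (nat_of_ord (x i)) (nat_of_ord (x (Vo i))) ne => u v; lia.
Qed.

Lemma occurs_ge0 a w : 0 <= occurs a w.
Proof. by apply: prodr_ge0 => i _; exact: hits_ge0. Qed.

Lemma mem_choices a i : a.2 i \in choices a.
Proof. by rewrite inE; exact: codom_f. Qed.

Lemma depends_on_occurs a : depends_on (choices a) (occurs a).
Proof.
move=> w w' ww'; apply: eq_bigr => i _.
by apply: (@depends_on_hits _ _ _ (a.2 i)) => e; rewrite inE => /eqP ->; exact/ww'/mem_choices.
Qed.

Lemma card_choices a : (#|choices a| <= k)%N.
Proof.
rewrite (_ : #|choices a| = #|mem (codom a.2)|); last by apply: eq_card => e; rewrite inE.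
by rewrite (leq_trans (leq_image_card _ _))// cardT size_enum_ord.
Qed.

Lemma Ex_occurs_mix a D (w0 : Om) : valid a ->
  Ex (fun w => occurs a (mix D w0 w)) =
  \prod_(i < k) (if a.2 i \in D then hits R (a.2 i) (lo a.1 i) w0
                 else (hi a.1 i)%:R^-1).
Proof.
move=> /validP[xi gi h].
rewrite /occurs (Ex_prod (g := a.2) (F := fun i w => hits R (a.2 i) (lo a.1 i) (mix D w0 w))).
- apply: eq_bigr => i _; case: ifP => giD.
    rewrite -[RHS](@Ex_cst R m n); apply: eq_Ex => w.
    by rewrite /hits mixE giD.
  rewrite -h -(@Ex_hits R m n _ (lo a.1 i)); last by rewrite h lo_lt_hi.
  by apply: eq_Ex => w; rewrite /hits mixE giD.
- by rewrite map_inj_uniq// index_enum_uniq.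
- move=> i w w' ww'; rewrite /hits !mixE; case: ifP => // _.
  by rewrite ww' ?inE.
Qed.

Lemma Ex_occurs a : valid a -> Ex (occurs a) = \prod_(i < k) (hi a.1 i)%:R^-1.
Proof.
move=> va; transitivity (Ex (fun w => occurs a (mix finset.set0 w w))).
  by apply: eq_Ex => w; congr occurs; apply/ffunP => e; rewrite mixE inE.
have w0 : Om := [ffun e : ua_edge m n => Ordinal (valP e)] : {dffun _}.
transitivity (Ex (fun w => occurs a (mix finset.set0 w0 w))).
  apply: eq_Ex => w; congr occurs; apply/ffunP => e; by rewrite !mixE inE.
by rewrite Ex_occurs_mix//; apply: eq_bigr => i _; rewrite inE.
Qed.

Definition ekernel (psi : nat -> nat -> nat -> edge -> R) i u v : R :=
  \sum_(e : edge | ((val e).1 : nat) == maxn u v) psi i u v e.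

(** Once injectivity is dropped, the edges range independently over those made at the prescribed
    vertices, and the sum of products factorises. *)
Lemma sum_valid_le (psi : nat -> nat -> nat -> edge -> R) (h : seq nat -> R) :
  (forall i u v e, 0 <= psi i u v e) -> (forall s, 0 <= h s) ->
  \sum_(a : conf | valid a) h (seq_of_ffun a.1) *
     \prod_(i < k) psi i (a.1 i) (a.1 (Vo i)) (a.2 i) <=
  tsum n k (fun s => h s * wprod V (ekernel psi) k s).
Proof.
move=> psi0 h0; rewrite -sum_ffun_tsum.
apply: (@le_trans _ _ (\sum_(x : {ffun 'I_k -> 'I_n})
   \sum_(g in family (fun i => [pred e : edge | ((val e).1 : nat) == maxn (x i) (x (Vo i))]))
     h (seq_of_ffun x) * \prod_(i < k) psi i (x i) (x (Vo i)) (g i))).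
  rewrite pair_big_dep /= [leRHS](bigID valid) /=.
  rewrite [X in _ <= X + _](_ : _ = \sum_(a : conf | valid a) h (seq_of_ffun a.1) *
     \prod_(i < k) psi i (a.1 i) (a.1 (Vo i)) (a.2 i)); last first.
    apply: eq_bigl => -[x g] /=; apply/idP/idP => [/andP[]//|va].
    rewrite va andbT; apply/familyP => i; have /validP[_ _ /(_ i) /= E] := va.
    by rewrite inE /= E.
  by rewrite lerDl sumr_ge0// => a _; rewrite mulr_ge0// prodr_ge0.
apply: ler_sum => x _; rewrite -mulr_sumr ler_wpM2l//.
rewrite -(bigA_distr_big_dep _ (fun (i : 'I_k) (e : edge) => psi i (x i) (x (Vo i)) e)).
rewrite /wprod le_eqVlt; apply/orP; left; apply/eqP; apply: eq_bigr => i _.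
by rewrite nth_seq_of_ffun -VoE nth_seq_of_ffun.
Qed.

Lemma card_edges_at c : (#|[pred e : edge | ((val e).1 : nat) == c]| <= m)%N.
Proof.
rewrite -[X in (_ <= X)%N]card_ord.
rewrite -(@card_in_imset _ _ (fun e : edge => (val e).2)); first exact: max_card.
move=> e e' /eqP h1 /eqP h2 h; apply: val_inj; case: (val e) (val e') h1 h2 h => a b [c' d] /=.
by move=> ha hc ->; congr (_, _); apply: val_inj; rewrite /= ha hc.
Qed.

Lemma bseq_V s i : bseq n k s -> (i < k)%N -> (nth 0 s i < n)%N /\ (nth 0 s (V i) < n)%N.
Proof. by move=> bs ik; rewrite !(bseq_nth bs)// V_ltk. Qed.

Lemma le_wprod (K K' : nat -> nat -> nat -> R) s : bseq n k s ->
  (forall i u v, (i < k)%N -> (u < n)%N -> (v < n)%N -> 0 <= K i u v <= K' i u v) ->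
  0 <= wprod V K k s <= wprod V K' k s.
Proof.
move=> bs KK'; apply/andP; split.
  apply: prodr_ge0 => i _; have [h1 h2] := bseq_V bs (ltn_ord i).
  by have /andP[] := KK' i _ _ (ltn_ord i) h1 h2.
apply: ler_prod => i _; have [h1 h2] := bseq_V bs (ltn_ord i).
exact: KK'.
Qed.

(** The origin of the 2 in [kap]: [1 / c <= 2 / (c + 1)] for positive [c]. The factor [m] counts the
    labels. *)
Lemma sum_edges_at_inv c : \sum_(e : edge | ((val e).1 : nat) == c) (c%:R)^-1 <=
  m%:R * (2 / c.+1%:R) :> R.
Proof.
have [->|c0] := posnP c.
  rewrite big1 ?mulr_ge0// => e _; by rewrite invr0.
rewrite sumr_const -[_ *+ #|_|]mulr_natl; apply: ler_pM; rewrite ?invr_ge0//.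
  by rewrite ler_nat (leq_trans _ (card_edges_at c)).
rewrite ler_pdivlMr// mulrC ler_pdivrMr ?ltr0n// -natrM ler_nat.
by rewrite mul2n -addnn -addn1 leq_add2l.
Qed.

(* Choices in [D] are revealed by the outcome [w0]. *)
Definition pinned D (w0 : Om) (u v : nat) : R :=
  \sum_(e : edge | (e \in D) && (((val e).1 : nat) == maxn u v)) hits R e (minn u v) w0.

Definition mixed D w0 u v : R := m%:R * kap R u v + pinned D w0 u v.

Lemma pinned_ge0 D w0 u v : 0 <= pinned D w0 u v.
Proof. by apply: sumr_ge0 => e _; exact: hits_ge0. Qed.

Lemma pinnedC D w0 u v : pinned D w0 u v = pinned D w0 v u.
Proof. by rewrite /pinned maxnC minnC. Qed.

Lemma sum_indicator (T : finType) (b : T) : \sum_(a : T) (a == b)%:R = 1 :> R.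
Proof. by rewrite (bigD1 b)//= eqxx big1 ?addr0// => a /negbTE ->. Qed.

(** Both ends of an edge of [D] are fixed by [w0], so it contributes to two ordered pairs only. *)
Lemma sum_pinned D w0 : \sum_(u < n) \sum_(v < n) pinned D w0 u v <= (2 * #|D|)%:R.
Proof.
pose a (e : edge) : 'I_n := (val e).1.
pose b (e : edge) : 'I_n := widen_ord (ltnW (ltn_ord (val e).1)) (w0 e).
apply: (@le_trans _ _ (\sum_(u < n) \sum_(v < n) \sum_(e in D)
    ((u == a e)%:R * (v == b e)%:R + (u == b e)%:R * (v == a e)%:R))).
  apply: ler_sum => u _; apply: ler_sum => v _; rewrite /pinned big_mkcondr /=.
  apply: ler_sum => e _; case: eqP => [h|_]; last by rewrite addr_ge0// mulr_ge0.
  rewrite /hits; case: eqP => [h'|_]; last by rewrite addr_ge0// mulr_ge0.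
  have [uv|/ltnW uv] := leqP u v.
    have -> : a e = v by apply: val_inj; rewrite /a /= h (maxn_idPr uv).
    have -> : b e = u by apply: val_inj; rewrite /b /= h' (minn_idPl uv).
    by rewrite !eqxx mulr1 lerDr mulr_ge0.
  have -> : a e = u by apply: val_inj; rewrite /a /= h (maxn_idPl uv).
  have -> : b e = v by apply: val_inj; rewrite /b /= h' (minn_idPr uv).
  by rewrite !eqxx mulr1 lerDl mulr_ge0.
under eq_bigr do rewrite exchange_big /=.
rewrite exchange_big /=.
under eq_bigr do under eq_bigr do rewrite big_split /= -!mulr_sumr !sum_indicator !mulr1.
under eq_bigr do rewrite big_split /= !sum_indicator.
by rewrite sumr_const -mulr2n -mulrnA.
Qed.

(** The first summand is the row bound for [m * kap], the second one that of [sum_pinned] for at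
    most [2 * k] edges. *)
Definition degree_bound : R := m%:R * (4 + 2 * ln n%:R) + (4 * k)%:R.
Local Notation L := degree_bound.

Lemma ln_n_ge0 : (0 < n)%N -> 0 <= ln (n%:R : R).
Proof. by move=> n0; rewrite ln_ge0// ler1n. Qed.

Lemma degree_bound_ge1 : (0 < n)%N -> 1 <= L.
Proof.
move=> n0; apply: (@le_trans _ _ (4 * k)%:R).
  by rewrite ler1n muln_gt0 (leq_trans _ l_le_k)// ltnW.
by rewrite lerDr mulr_ge0// addr_ge0// mulr_ge0// ln_n_ge0.
Qed.

Lemma sum_mixed D w0 v : (0 < n)%N -> (v < n)%N -> (#|D| <= 2 * k)%N ->
  \sum_(z < n) mixed D w0 z v <= L.
Proof.
move=> n0 vn Dk; rewrite /mixed big_split /= -mulr_sumr lerD//.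
  rewrite ler_wpM2l//; under eq_bigr do rewrite kapC.
  exact: kap_row.
apply: (@le_trans _ _ (\sum_(u < n) \sum_(v < n) pinned D w0 u v)).
  apply: ler_sum => z _; rewrite [leRHS](bigD1 (Ordinal vn))//= lerDl.
  by apply: sumr_ge0 => i _; exact: pinned_ge0.
apply: le_trans (sum_pinned D w0) _.
rewrite ler_nat (leq_trans (leq_mul (leqnn 2) Dk))// mulnA//.
Qed.

(** The constant of [tsum_unicyclic_pinned] for [a = m] and [B = 4 k], times the [k] positions of
    the pinned edge. *)
Definition pinned_const : R :=
  k%:R * (2 * (10 * m%:R + 2 * (4 * k)%:R + 1) ^+ l * (4 * k)%:R).

Lemma pinned_const_ge0 : 0 <= pinned_const.
Proof. by rewrite !mulr_ge0// exprn_ge0// !addr_ge0// mulr_ge0. Qed.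

Lemma Ex_hitsum_mix D w0 : (0 < n)%N -> (#|D| <= 2 * k)%N ->
  Ex (fun w => hitsum valid occurs choices D (mix D w0 w)) <=
  pinned_const * L ^+ (k - l).
Proof.
move=> n0 Dk.
pose phi (u v : nat) (e : edge) : R :=
  if e \in D then hits R e (minn u v) w0 else (maxn u v)%:R^-1.
have phi0 u v e : 0 <= phi u v e by rewrite /phi; case: ifP.
(* Union bound over the position [i0] of an edge of the copy that lies in [D]. *)
pose psi i0 (i u v : nat) (e : edge) : R := (if i == i0 then (e \in D)%:R else 1) * phi u v e.
have psi0 i0 i u v e : 0 <= psi i0 i u v e.
  by rewrite /psi mulr_ge0//; case: ifP.
apply: (@le_trans _ _ (\sum_(i0 < k) \sum_(a | valid a)
   \prod_(i < k) psi i0 i (a.1 i) (a.1 (Vo i)) (a.2 i))).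
  rewrite /hitsum Ex_sum [leRHS]exchange_big /= [leRHS](bigID (meets choices D)) /=.
  apply: le_trans (_ : _ <= \sum_(i | valid i && meets choices D i)
      \sum_(i0 < k) \prod_(i1 < k) psi i0 i1 (i.1 i1) (i.1 (Vo i1)) (i.2 i1)) _; last first.
    by rewrite lerDl; apply: sumr_ge0 => a _; apply: sumr_ge0 => i0 _; apply: prodr_ge0.
  apply: ler_sum => a /andP[va].
  rewrite /meets disjoint_subset => /fintype.subsetPn[e].
  rewrite !inE negbK => /codomP[i0 ->] iD.
  rewrite Ex_occurs_mix// [leRHS](bigD1 i0)//= -[X in X <= _]addr0 lerD//; last first.
    by apply: sumr_ge0 => ? _; apply: prodr_ge0.
  apply: ler_prod => i _; apply/andP; split; first by case: ifP => _; rewrite ?invr_ge0 ?hits_ge0.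
  rewrite /psi /phi; case: eqP => [/val_inj ->|_]; last by rewrite mul1r.
  by rewrite iD mul1r.
rewrite /pinned_const -mulrA.
rewrite [leRHS]mulr_natl -[k in leRHS]card_ord -sumr_const.
apply: ler_sum => i0 _; rewrite !card_ord.
apply: (@le_trans _ _ (tsum n k (wprod V (distinguish i0 (pinned D w0) (mixed D w0)) k))).
  have := @sum_valid_le (psi i0) (fun=> 1) (psi0 i0) (fun=> ler01).
  under eq_bigr do rewrite mul1r; move=> /le_trans; apply.
  apply: le_tsum => s bs; rewrite mul1r.
  suff H : forall i u v, (i < k)%N -> (u < n)%N -> (v < n)%N ->
     0 <= ekernel (psi i0) i u v <= distinguish i0 (pinned D w0) (mixed D w0) i u v.
    by have /andP[] := le_wprod bs H.
  move=> i u v _ _ _; apply/andP; split; first by apply: sumr_ge0 => e _; exact: psi0.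
  rewrite /ekernel /psi /distinguish; case: eqP => _.
    rewrite /pinned big_mkcondl /=; apply: ler_sum => e _.
    by rewrite /phi; case: ifP => _; rewrite ?mul1r ?mul0r.
  rewrite (bigID (mem D)) /= addrC /mixed; apply: lerD.
    apply: le_trans (_ : \sum_(e : edge | ((val e).1 : nat) == maxn u v) (maxn u v)%:R^-1 <= _).
      rewrite [leRHS](bigID (mem D)) /= addrC -[X in X <= _]addr0 lerD ?sumr_ge0//.
      by apply: ler_sum => e /andP[_ /negbTE eD]; rewrite mul1r /phi eD.
    exact: sum_edges_at_inv.
  rewrite /pinned; under [leRHS]eq_bigl do rewrite andbC.
  by apply: ler_sum => e /andP[_ eD]; rewrite mul1r /phi eD.
apply: (@tsum_unicyclic_pinned _ _ _ _ _ _ _ _ _ _ _ m%:R) => //.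
- move=> u v _ _; rewrite lexx andbT addr_ge0 ?mulr_ge0 ?kap_ge0 ?pinned_ge0//.
- by move=> u v _ _; exact: pinned_ge0.
- by move=> u v; rewrite /mixed kapC pinnedC.
- apply: le_trans (sum_pinned D w0) _.
  rewrite ler_nat (leq_trans (leq_mul (leqnn 2) Dk))// mulnA//.
- by move=> v vn; exact: sum_mixed.
- exact: degree_bound_ge1.
Qed.

Lemma hitsum_pinned D (h : Om -> R) : (0 < n)%N -> (#|D| <= 2 * k)%N ->
  depends_on D h -> (forall w, 0 <= h w) ->
  Ex (fun w => h w * hitsum valid occurs choices D w) <=
  pinned_const * L ^+ (k - l) * Ex h.
Proof.
move=> n0 Dk dh h0; rewrite (Ex_resample _ dh) mulrC -ExZr; apply: le_Ex => w0.
by rewrite ler_wpM2l// Ex_hitsum_mix.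
Qed.

Lemma sum_mkap v : (0 < n)%N -> \sum_(z < n) (m%:R * kap R z v) <= L.
Proof.
move=> n0; rewrite -mulr_sumr; under eq_bigr do rewrite kapC.
apply: (@le_trans _ _ (m%:R * (4 + 2 * ln n%:R))).
  by rewrite ler_wpM2l// kap_row.
by rewrite lerDl.
Qed.

Lemma sum_mean_weight (h : seq nat -> R) : (forall s, 0 <= h s) ->
  \sum_(a | valid a) h (seq_of_ffun a.1) * Ex (occurs a) <=
  tsum n k (fun s => h s * wprod V (fun _ u v => m%:R * kap R u v) k s).
Proof.
move=> h0; pose psi (i u v : nat) (e : edge) : R := (maxn u v)%:R^-1.
under eq_bigr => a va do rewrite Ex_occurs//.
have psi0 i u v e : 0 <= psi i u v e by rewrite invr_ge0.
apply: le_trans (@sum_valid_le psi h psi0 h0) _.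
apply: le_tsum => s bs; rewrite ler_wpM2l//.
suff H : forall i u v, (i < k)%N -> (u < n)%N -> (v < n)%N ->
     0 <= ekernel psi i u v <= m%:R * kap R u v.
  by have /andP[] := le_wprod bs H.
move=> i u v _ _ _; apply/andP; split; first by apply: sumr_ge0.
exact: sum_edges_at_inv.
Qed.

Hypothesis m_gt0 : (0 < m)%N.

Lemma mkap_bound u v : 0 <= m%:R * kap R u v <= m%:R * kap R u v.
Proof. by rewrite lexx andbT mulr_ge0// kap_ge0. Qed.

Lemma mean_le : (0 < n)%N ->
  \sum_(a | valid a) Ex (occurs a) <=
  2 * m%:R * (8 * m%:R) ^+ l.-1 * L ^+ (k - l).+1.
Proof.
move=> n0; have := @sum_mean_weight (fun=> 1) (fun=> ler01).
under eq_bigr do rewrite mul1r; move=> /le_trans; apply.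
rewrite (eq_tsum (G := wprod V (fun=> fun u v => m%:R * kap R u v) k)); last first.
  by move=> s _; rewrite mul1r.
apply: (@tsum_unicyclic _ _ l k V l_gt1 l_le_k V_cycle V_tree) => //.
- by rewrite ltr0n.
- by move=> u v; exact: mkap_bound.
- by move=> v _; exact: sum_mkap.
have := ln_n_ge0 n0; set x := ln _ => x0.
apply: (@le_trans _ _ (1 * (4 + 2 * x))); first by lra.
rewrite /degree_bound -[X in X <= _]addr0 lerD// ler_wpM2r ?ler1n//; lra.
Qed.

Lemma mean_weight_le (q : 'I_k) : (0 < n)%N ->
  \sum_(a | valid a) rsq R (a.1 q) * Ex (occurs a) <=
  6 * m%:R * (8 * m%:R) ^+ l.-1 * (2 * L) ^+ (k - l).
Proof.
move=> n0.
have := @sum_mean_weight (fun s => rsq R (nth 0%N s q)) (fun s => ltW (rsq_gt0 R _)).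
under eq_bigr do rewrite nth_seq_of_ffun; move=> /le_trans; apply.
have L1 := degree_bound_ge1 n0.
(* Doubling [L] secures the condition [8 * m <= 2 * L]. *)
apply: (@tsum_unicyclic_edge _ _ l k V l_gt1 l_le_k V_cycle V_tree) => //.
- by rewrite ltr0n.
- by move=> u v; exact: mkap_bound.
- by move=> u v; rewrite kapC.
- by move=> v _; apply: le_trans (sum_mkap v n0) _; lra.
rewrite /degree_bound; have := ln_n_ge0 n0; set x := ln _ => x0.
have m0 : 0 <= (m%:R : R) by [].
have k0 : 0 <= ((4 * k)%:R : R) by [].
nra.
Qed.

End Model.

(** * Lower bound for the variance *)

Section Covariance.
Variables (R : realType) (m n l k : nat) (V : nat -> nat).
Hypothesis l_gt1 : (1 < l)%N.
Hypothesis l_le_k : (l <= k)%N.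
Hypothesis V_cycle : forall i, (i < l)%N -> V i = (i.+1 %% l)%N.
Hypothesis V_tree : forall i, (l <= i < k)%N -> (V i < i)%N.
Hypothesis m_gt0 : (0 < m)%N.
Hypothesis n_gt0 : (0 < n)%N.
Local Notation Om := (ua_space m n).
Local Notation edge := (ua_edge m n).

Lemma V_tree0 i : (l <= i < l)%N -> (V i < i)%N.
Proof. by move=> /andP[li il]; have := leq_ltn_trans li il; rewrite ltnn. Qed.

Local Notation pk a := (Ex (occurs R V (a : conf m n k))).
Local Notation pl b := (Ex (occurs R V (b : conf m n l))).

(* The cycle of a copy, which is correlated with the copy: the covariance of the
   number of copies and the number of cycles is at least the mean up to a lower
   order term. *)
Definition restrict (a : conf m n k) : conf m n l :=
  ([ffun i => a.1 (widen_ord l_le_k i)], [ffun i => a.2 (widen_ord l_le_k i)]).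

Lemma widen_Vo i : widen_ord l_le_k (Vo V i) = Vo V (widen_ord l_le_k i).
Proof.
apply: val_inj; rewrite [LHS]/= (VoE (leqnn l) V_cycle V_tree0).
exact: (esym (VoE l_le_k V_cycle V_tree (widen_ord l_le_k i))).
Qed.

Lemma restrict_valid a : valid V a -> valid V (restrict a).
Proof.
move=> /validP[xi gi h]; apply/validP; split => [i j|i j|i] /=.
- by rewrite !ffunE => /xi /(congr1 val) /= ij; apply: val_inj.
- by rewrite !ffunE => /gi /(congr1 val) /= ij; apply: val_inj.
- by rewrite ffunE h /hi !ffunE widen_Vo.
Qed.

Lemma occurs_restrict a w : occurs R V a w * occurs R V (restrict a) w = occurs R V a w.
Proof.
have [->|nz] := eqVneq (occurs R V a w) 0; first by rewrite mul0r.
rewrite [X in _ * X]big1 ?mulr1// => i _.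
have /prodf_neq0/(_ (widen_ord l_le_k i) isT) := nz.
rewrite /hits /lo /= !ffunE widen_Vo.
by case: (_ == _ :> nat) => //; rewrite eqxx.
Qed.

Lemma restrict_meets a : meets (@choices m n l) (choices a) (restrict a).
Proof.
have l0 : (0 < l)%N by exact: ltnW.
apply/pred0Pn; exists (a.2 (widen_ord l_le_k (Ordinal l0))) => /=.
apply/andP; split; last exact: mem_choices.
by have := mem_choices (restrict a) (Ordinal l0); rewrite /= ffunE.
Qed.

Definition through_const : R := l%:R * (4 * (2 * m%:R * (8 * m%:R) ^+ l.-2)).

Lemma through_const_ge0 : 0 <= through_const.
Proof. by rewrite !mulr_ge0// exprn_ge0// mulr_ge0. Qed.

Lemma sum_le_ord (u0 : nat) : \sum_(v < n) (v <= u0)%N%:R <= u0.+1%:R :> R.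
Proof.
rewrite -natr_sum ler_nat -big_mkcond /= sum1_card -[X in (_ <= X)%N]card_ord.
rewrite -(card_in_imset (f := fun v : 'I_n => inord v : 'I_u0.+1)); first exact: max_card.
move=> v w vu wu /(congr1 val); rewrite /= !inordK//= => h.
exact: val_inj.
Qed.

(** There are at most [2 (j + 1) <= 4 j] ordered pairs of ends for [d], each with probability
    [1 / j]. The other [l - 1] edges form a walk between the ends, of weight at most a constant
    times [rsq u * rsq v <= rsq j], since one end is [j]. *)
Lemma sum_cycles_through (d : edge) :
  \sum_(b : conf m n l | valid V b && (d \in choices b)) pl b <=
  through_const * rsq R (val d).1.
Proof.
set j : nat := (val d).1; have j0 : (0 < j)%N := valP d.
pose psi (i0 i u v : nat) (e : edge) : R :=
  (if i == i0 then (e == d)%:R else 1) * (maxn u v)%:R^-1.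
have psi0 i0 i u v e : 0 <= psi i0 i u v e by rewrite /psi mulr_ge0//; case: ifP.
pose A (u v : nat) : R := (maxn u v == j)%:R / j%:R.
pose M (u v : nat) : R := m%:R * kap R u v.
apply: (@le_trans _ _ (\sum_(i0 < l) \sum_(b : conf m n l | valid V b)
   \prod_(i < l) psi i0 i (b.1 i) (b.1 (Vo V i)) (b.2 i))).
  rewrite [leRHS]exchange_big /= [leRHS](bigID (fun b : conf m n l => d \in choices b)) /=.
  apply: le_trans (_ : _ <= \sum_(b : conf m n l | valid V b && (d \in choices b))
     \sum_(i0 < l) \prod_(i < l) psi i0 i (b.1 i) (b.1 (Vo V i)) (b.2 i)) _; last first.
    by rewrite lerDl; apply: sumr_ge0 => b _; apply: sumr_ge0 => i0 _; apply: prodr_ge0.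
  apply: ler_sum => b /andP[vb]; rewrite inE => /codomP[i0 dE].
  rewrite (Ex_occurs R l_gt1 (leqnn l) V_cycle V_tree0 vb).
  rewrite [leRHS](bigD1 i0)//= -[X in X <= _]addr0 lerD//; last first.
    by apply: sumr_ge0 => ? _; apply: prodr_ge0.
  apply: ler_prod => i _; rewrite invr_ge0 ler0n /psi /hi /=.
  case: eqP => [/val_inj ->|_]; last by rewrite mul1r.
  by rewrite -dE eqxx mul1r.
rewrite /through_const -mulrA mulr_natl -[l in leRHS]card_ord -sumr_const.
apply: ler_sum => i0 _; rewrite !card_ord.
apply: (@le_trans _ _ (tsum n l (wprod V (distinguish i0 A M) l))).
  have := @sum_valid_le R m n l l V (leqnn l) V_cycle V_tree0 (psi i0) (fun=> 1) (psi0 i0) (fun=> ler01).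
  under eq_bigr do rewrite mul1r; move=> /le_trans; apply.
  apply: le_tsum => s bs; rewrite mul1r.
  suff H : forall i u v, (i < l)%N -> (u < n)%N -> (v < n)%N ->
     0 <= ekernel (psi i0) i u v <= distinguish i0 A M i u v.
    by have /andP[] := le_wprod (leqnn l) V_cycle V_tree0 bs H.
  move=> i u v _ _ _; apply/andP; split; first by apply: sumr_ge0 => e _; exact: psi0.
  rewrite /ekernel /psi /distinguish; case: eqP => _; last first.
    under eq_bigr do rewrite mul1r; exact: sum_edges_at_inv.
  rewrite /A; case: (eqVneq (maxn u v) j) => [->|ne].
    rewrite (bigD1 d)//= eqxx mul1r big1 ?addr0 ?mul1r// => e /andP[_ /negbTE ->].
    by rewrite mul0r.
  rewrite mul0r big1// => e /eqP he; case: eqP => [ed|_]; last by rewrite mul0r.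
  by move: ne; rewrite -he ed /j eqxx.
rewrite (tsum_cycle_distinguish n l_gt1 V_cycle)//.
set C := 2 * m%:R * (8 * m%:R) ^+ l.-2.
have C0 : 0 <= C by rewrite !mulr_ge0// exprn_ge0// mulr_ge0.
have kb (u v : 'I_n) : 0 <= kpow n M l.-1 v u <= C * (rsq R v * rsq R u).
  have -> : l.-1 = l.-2.+1 by case: l l_gt1 => [|[]].
  by apply: kpow_rsq => // a b; exact: mkap_bound.
have j1 : 0 < (j%:R : R) by rewrite ltr0n.
apply: (@le_trans _ _ (\sum_(u < n) \sum_(v < n)
   (((u : nat) == j)%:R * (v <= j)%N%:R + ((v : nat) == j)%:R * (u <= j)%N%:R) *
   (C * rsq R j / j%:R))).
  apply: ler_sum => u _; apply: ler_sum => v _; have /andP[k0 k1] := kb u v.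
  rewrite /A; case: (eqVneq (maxn u v) j) => [mj|_]; last first.
    by rewrite !mul0r mulr_ge0 ?addr_ge0 ?mulr_ge0// ?invr_ge0// ltW// rsq_gt0.
  rewrite mul1r; apply: (@le_trans _ _ (1 * (C * rsq R j / j%:R))).
    rewrite mul1r mulrC ler_wpM2r ?invr_ge0//; apply: le_trans k1 _; rewrite ler_wpM2l//.
    have [uv|/ltnW vu] := leqP u v.
      have <- : v = j :> nat by rewrite -mj (maxn_idPr uv).
      by rewrite ler_piMr ?(ltW (rsq_gt0 _ _))// rsq_le1.
    have <- : u = j :> nat by rewrite -mj (maxn_idPl vu).
    by rewrite ler_piMl ?(ltW (rsq_gt0 _ _))// rsq_le1.
  rewrite ler_wpM2r ?mulr_ge0 ?invr_ge0 ?(ltW (rsq_gt0 _ _))//.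
  have [uv|/ltnW vu] := leqP u v.
    have vj : v = j :> nat by rewrite -mj (maxn_idPr uv).
    by rewrite vj eqxx -vj uv mulr1 lerDr mulr_ge0.
  have uj : u = j :> nat by rewrite -mj (maxn_idPl vu).
  by rewrite uj eqxx -uj vu mulr1 lerDl mulr_ge0.
under eq_bigr do rewrite -mulr_suml.
rewrite -mulr_suml.
have S : \sum_(u < n) \sum_(v < n)
   (((u : nat) == j)%:R * (v <= j)%N%:R + ((v : nat) == j)%:R * (u <= j)%N%:R) <=
   4 * j%:R :> R.
  have jn : (j < n)%N := ltn_ord (val d).1.
  have one : \sum_(u < n) ((u : nat) == j)%:R = 1 :> R.
    rewrite -[RHS](@sum_indicator R _ (val d).1); apply: eq_bigr => u _.
    by rewrite -val_eqE.
  under eq_bigr do rewrite big_split /= -mulr_sumr -mulr_suml one mul1r.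
  rewrite big_split /= -mulr_suml one mul1r.
  have h := sum_le_ord j; apply: le_trans (lerD h h) _.
  rewrite -natrD -natrM ler_nat; lia.
apply: le_trans (ler_wpM2r _ S) _.
  by rewrite !mulr_ge0 ?invr_ge0// ltW// rsq_gt0.
rewrite le_eqVlt; apply/orP; left; apply/eqP; field.
by rewrite gt_eqF.
Qed.

Definition pair_const : R :=
  through_const * (k%:R * (6 * m%:R * (8 * m%:R) ^+ l.-1)).

Local Notation L := (degree_bound R m n k).

(** Cycles sharing the choice [a.2 i] cost [rsq] of the vertex that makes it, which is at least
    [a.1 i]; the resulting weight [rsq (a.1 i)] saves the logarithm of the cycle of [a] by
    [mean_weight_le]. *)
Lemma sum_meeting_pairs :
  \sum_(a : conf m n k | valid V a)
    \sum_(b : conf m n l | valid V b && meets (@choices m n l) (choices a) b) pk a * pl b <=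
  pair_const * (2 * L) ^+ (k - l).
Proof.
have p0 (b : conf m n l) : 0 <= pl b by apply: Ex_ge0 => w; exact: occurs_ge0.
have pk0 (a : conf m n k) : 0 <= pk a by apply: Ex_ge0 => w; exact: occurs_ge0.
apply: (@le_trans _ _ (\sum_(a : conf m n k | valid V a)
   \sum_(i < k) through_const * (rsq R (a.1 i) * pk a))).
  apply: ler_sum => a va; rewrite -mulr_sumr.
  apply: (@le_trans _ _ (pk a * \sum_(i < k) through_const * rsq R (a.1 i))); last first.
    rewrite mulr_sumr; apply: ler_sum => i _.
    by rewrite le_eqVlt; apply/orP; left; apply/eqP; ring.
  rewrite ler_wpM2l//.
  apply: (@le_trans _ _ (\sum_(i < k)
     \sum_(b : conf m n l | valid V b && (a.2 i \in choices b)) pl b)).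
    under [leRHS]eq_bigr do rewrite big_mkcondr /=.
    rewrite [leRHS]exchange_big /= [leLHS]big_mkcondr /=.
    apply: ler_sum => b vb; case: ifP => [|_]; last by apply: sumr_ge0 => i _; case: ifP.
    rewrite /meets => /pred0Pn[e /= /andP[eb]]; rewrite inE => /codomP[i eE].
    rewrite (bigD1 i)//= -eE eb lerDl; apply: sumr_ge0 => i' _; by case: ifP.
  apply: ler_sum => i _; apply: le_trans (sum_cycles_through _) _.
  rewrite ler_wpM2l ?through_const_ge0// /rsq lef_pV2 ?posrE ?sqrtS_gt0//.
  have /validP[_ _ ->] := va.
  by rewrite ler_sqrt// ler_nat ltnS leq_maxl.
rewrite exchange_big /=.
apply: (@le_trans _ _ (\sum_(i < k) through_const *
    (6 * m%:R * (8 * m%:R) ^+ l.-1 * (2 * L) ^+ (k - l)))).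
  apply: ler_sum => i _; rewrite -mulr_sumr ler_wpM2l ?through_const_ge0//.
  exact: (mean_weight_le R l_gt1 l_le_k V_cycle V_tree m_gt0).
rewrite sumr_const card_ord -mulr_natl le_eqVlt; apply/orP; left; apply/eqP.
by rewrite /pair_const; ring.
Qed.

Local Notation Nk := (total (valid V) (@occurs R m n k V)).
Local Notation Nl := (total (valid V) (@occurs R m n l V)).
Local Notation Ck := (ctotal (valid V) (@occurs R m n k V)).
Local Notation Cl := (ctotal (valid V) (@occurs R m n l V)).

Lemma Ex_ctotal_mul : Ex (fun w => Ck w * Cl w) =
  \sum_(a : conf m n k | valid V a) \sum_(b : conf m n l | valid V b)
    (Ex (fun w => occurs R V a w * occurs R V b w) - pk a * pl b).
Proof.
have -> : Ex (fun w => Ck w * Cl w) = Ex (fun w => Nk w * Nl w) - Ex Nk * Ex Nl.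
  transitivity (Ex (fun w => Nk w * Nl w - Ex Nk * Nl w + (- Ex Nl) * (Nk w - Ex Nk))).
    by apply: eq_Ex => w; rewrite /ctotal; ring.
  by rewrite ExD ExB !ExZ ExB Ex_cst subrr mulr0 addr0.
have -> : Ex (fun w => Nk w * Nl w) =
  \sum_(a : conf m n k | valid V a) \sum_(b : conf m n l | valid V b)
     Ex (fun w => occurs R V a w * occurs R V b w).
  under [RHS]eq_bigr do rewrite -Ex_sum.
  rewrite -Ex_sum; apply: eq_Ex => w; rewrite /total mulr_suml.
  by apply: eq_bigr => a _; rewrite mulr_sumr.
rewrite !mean_sum mulr_suml -sumrB; apply: eq_bigr => a _.
by rewrite mulr_sumr -sumrB.
Qed.

(** Pairs without a common choice are uncorrelated. Among the moments of the other pairs, all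
    nonnegative, only that of a copy with its own cycle is kept, and it equals [pk a]. *)
Lemma covariance_ge :
  Ex Nk - pair_const * (2 * L) ^+ (k - l) <= Ex (fun w => Ck w * Cl w).
Proof.
rewrite Ex_ctotal_mul mean_sum.
apply: (@le_trans _ _ (\sum_(a : conf m n k | valid V a) (pk a -
    \sum_(b : conf m n l | valid V b && meets (@choices m n l) (choices a) b) pk a * pl b))).
  by rewrite sumrB lerD2l lerN2 sum_meeting_pairs.
apply: ler_sum => a va.
rewrite [leRHS](bigID (fun b => meets (@choices m n l) (choices a) b)) /=.
rewrite [X in _ <= _ + X]big1 ?addr0; last first.
  move=> b /andP[vb]; rewrite /meets negbK => dis.
  rewrite (@Ex_indep _ _ _ (choices a)) ?subrr//; first exact: depends_on_occurs.
  apply: depends_onS (@depends_on_occurs R m n l V b).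
  by rewrite finset.subsets_disjoint finset.setCK.
rewrite sumrB lerD2r (bigD1 (restrict a)) /=; last first.
  by rewrite restrict_valid//= restrict_meets.
have -> : Ex (fun w => occurs R V a w * occurs R V (restrict a) w) = pk a.
  by apply: eq_Ex => w; rewrite occurs_restrict.
rewrite lerDl; apply: sumr_ge0 => b _; apply: Ex_ge0 => w.
by rewrite mulr_ge0// occurs_ge0.
Qed.

(** Expanding [(v f - c g)^2] with [c] the mean of [f g]. A positive bound [v] in place of the
    second moment of [g] avoids dividing by a quantity that may vanish. *)
Lemma Ex_cauchy_schwarz (f g : Om -> R) (v : R) : 0 < v ->
  Ex (fun w => g w ^+ 2) <= v ->
  Ex (fun w => f w * g w) ^+ 2 <= v * Ex (fun w => f w ^+ 2).
Proof.
move=> v0 gv.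
have key c : 0 <= Ex (fun w => (v * f w - c * g w) ^+ 2) by apply: Ex_ge0 => w; exact: sqr_ge0.
have E c : Ex (fun w => (v * f w - c * g w) ^+ 2) =
   v ^+ 2 * Ex (fun w => f w ^+ 2) - 2 * v * c * Ex (fun w => f w * g w) +
   c ^+ 2 * Ex (fun w => g w ^+ 2).
  by rewrite -!ExZ -ExB -ExD; apply: eq_Ex => w; ring.
move: (key (Ex (fun w => f w * g w))); rewrite E; set c := Ex (fun w => f w * g w).
have := ler_wpM2l (sqr_ge0 c) gv; rewrite -(ler_pM2l v0); nra.
Qed.

Definition cycle_variance_bound : R :=
  pinned_const R m l l * (2 * m%:R * (8 * m%:R) ^+ l.-1 * degree_bound R m n l).

(** The test variable is the number of cycles, whose variance is bounded by the case [k = l] of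
    [variance_le]: with no trees, it is of order log n. *)
Lemma variance_ge :
  0 <= Ex Nk - pair_const * (2 * L) ^+ (k - l) ->
  (Ex Nk - pair_const * (2 * L) ^+ (k - l)) ^+ 2 <=
  (cycle_variance_bound + 1) * total_var (valid V) (@occurs R m n k V).
Proof.
move=> E0.
have P0 := pinned_const_ge0 R m l l.
have D0 : 0 <= degree_bound R m n l.
  by apply: le_trans (degree_bound_ge1 R m l_gt1 (leqnn l) n_gt0).
have B0 : 0 <= cycle_variance_bound.
  by rewrite mulr_ge0// mulr_ge0// !mulr_ge0// exprn_ge0// mulr_ge0.
apply: le_trans (_ : Ex (fun w => Ck w * Cl w) ^+ 2 <= _).
  rewrite lerXn2r ?nnegrE//; last exact: covariance_ge.
  exact: le_trans covariance_ge.
apply: Ex_cauchy_schwarz; first by rewrite ltr_wpDl.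
apply: (@le_trans _ _ cycle_variance_bound); last by rewrite lerDl.
have := @variance_le R m n _ (valid V) (@occurs R m n l V) (@choices m n l) l (pinned_const R m l l).
rewrite /total_var; move=> /(_ (fun a w => occurs_ge0 R V a w) (@depends_on_occurs R m n l V)).
move=> /(_ (fun a _ => card_choices a)).
have H (D : {set ua_edge m n}) (h : Om -> R) : (#|D| <= 2 * l)%N -> depends_on D h ->
    (forall w, 0 <= h w) -> Ex (fun w => h w * hitsum (valid V) (@occurs R m n l V) (@choices m n l) D w) <=
    pinned_const R m l l * Ex h.
  move=> Dl dh h0; have := hitsum_pinned l_gt1 (leqnn l) V_cycle V_tree0 n_gt0 Dl dh h0.
  by rewrite subnn expr0 mulr1.
move=> /(_ H) /le_trans; apply; rewrite /cycle_variance_bound ler_wpM2l//.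
rewrite mean_sum; have := mean_le R l_gt1 (leqnn l) V_cycle V_tree0 m_gt0 n_gt0.
by rewrite subnn expr1.
Qed.

End Covariance.

(** * Lower bound for the mean *)

Section MeanLowerBound.
Variables (R : realType) (m n l k : nat) (V : nat -> nat).
Hypothesis l_gt1 : (1 < l)%N.
Hypothesis l_le_k : (l <= k)%N.
Hypothesis V_cycle : forall i, (i < l)%N -> V i = (i.+1 %% l)%N.
Hypothesis V_tree : forall i, (l <= i < k)%N -> (V i < i)%N.
Hypothesis m_gt1 : (1 < m)%N.
Variable q : nat.
Hypothesis q_gt0 : (0 < q)%N.
Hypothesis q_le_n : (q ^ (k - l).+1 <= n)%N.

Let k_gt0 : (0 < k)%N := leq_trans (ltnW l_gt1) l_le_k.
Let o0 : 'I_k := Ordinal k_gt0.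

(* The vertices of the cycle decrease from [y] on, one in each of [l - 1]
   consecutive blocks of length [y %/ l]; those of the trees increase, one in
   each block from a power of [q] to the next one. *)
Definition window (i y z : nat) : bool :=
  if i == 0%N then (l <= y < q)%N && (z == y)
  else if (i < l)%N then ((l.-1 - i) * (y %/ l) <= z < (l - i) * (y %/ l))%N
  else (q ^ (i - l).+1 <= z < q ^ (i - l).+2)%N.

Definition spread (x : {ffun 'I_k -> 'I_n}) : bool :=
  [forall i : 'I_k, window i (x o0) (x i)].

Lemma spread_root x : spread x -> (l <= x o0 < q)%N.
Proof. by move=> /forallP /(_ o0); rewrite /window /= => /andP[]. Qed.

Lemma spread_lt_q x (i : 'I_k) : spread x -> (i < l)%N -> (x i <= x o0)%N && (x i < q)%N.
Proof.
move=> sx il; have /andP[ly yq] := spread_root sx.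
have [i0|i0] := eqVneq (i : nat) 0%N.
  by rewrite (_ : i = o0) ?leqnn ?yq//; apply: val_inj.
have /forallP/(_ i) := sx; rewrite /window (negbTE i0) il => /andP[_ xi].
suff h : (x i <= x o0)%N by rewrite h (leq_ltn_trans h yq).
apply: ltnW; apply: leq_trans xi (leq_trans _ (leq_divM (x o0) l)).
by rewrite mulnC leq_mul2l leq_subr orbT.
Qed.

Lemma spread_monotone x (i j : 'I_k) : spread x -> (i < j)%N ->
  if (j < l)%N then (x j < x i)%N else (x i < x j)%N.
Proof.
move=> sx ij; have /andP[ly yq] := spread_root sx.
have d0 : (0 < x o0 %/ l)%N by rewrite divn_gt0// ltnW.
have j0 : (j : nat) != 0%N by rewrite -lt0n (leq_ltn_trans _ ij).
have /forallP/(_ j) := sx; rewrite /window (negbTE j0).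
case: ifP => [jl /andP[_ xj]|/negbT]; last first.
  rewrite -leqNgt => lj /andP[qj _].
  case: (ltnP i l) => il.
    have /andP[_ xi] := spread_lt_q sx il.
    by apply: leq_trans xi (leq_trans _ qj); rewrite -[X in (X <= _)%N]expn1 leq_pexp2l.
  have i0 : (i : nat) != 0%N by rewrite -lt0n (leq_trans _ il)// ltnW.
  have /forallP/(_ i) := sx; rewrite /window (negbTE i0) ltnNge il /= => /andP[_ xi].
  by apply: leq_trans xi (leq_trans _ qj); rewrite leq_pexp2l// ltnS ltn_sub2r// (leq_ltn_trans il).
have [i0|i0] := eqVneq (i : nat) 0%N.
  rewrite (_ : i = o0); last by apply: val_inj.
  apply: leq_trans xj (leq_trans _ (leq_divM (x o0) l)).
  by rewrite mulnC leq_mul2l leq_subr orbT.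
have /forallP/(_ i) := sx; rewrite /window (negbTE i0) (ltn_trans ij jl) => /andP[xi _].
apply: leq_trans xj (leq_trans _ xi); rewrite leq_mul2r; apply/orP; right; lia.
Qed.

Lemma spread_inj x : spread x -> injective x.
Proof.
move=> sx i j xij; apply: val_inj.
case: (ltngtP i j) => // /(spread_monotone sx); rewrite xij ltnn; by case: ifP.
Qed.

(** Along the cycle the positions decrease, and a tree vertex is placed after its parent, so [i] is
    the later end of its edge. The exception is the edge closing the cycle, which returns to
    [x o0]. *)
Lemma hi_spread x (i : 'I_k) : spread x ->
  hi V x i = if (i : nat) == l.-1 then val (x o0) else val (x i).
Proof.
move=> sx; rewrite /hi.
have VE : Vo V i = V i :> nat := VoE l_le_k V_cycle V_tree i.
have l0 : (0 < l)%N := ltnW l_gt1.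
case: eqP => [il|il].
  have il' : (i < l)%N by rewrite il prednK.
  have -> : Vo V i = o0 by apply: val_inj; rewrite /= VE V_cycle// il prednK// modnn.
  by have /andP[h _] := spread_lt_q sx il'; rewrite (maxn_idPr h).
case: (ltnP i l) => il'.
  have Sil : (i.+1 < l)%N by lia.
  have VS : Vo V i = i.+1 :> nat by rewrite VE V_cycle// modn_small.
  have := @spread_monotone x i (Vo V i) sx; rewrite VS ltnSn Sil => /(_ isT) /ltnW h.
  by rewrite (maxn_idPl h).
have Vi : (Vo V i < i)%N by rewrite VE V_tree// il' ltn_ord.
have := @spread_monotone x (Vo V i) i sx Vi; rewrite ltnNge il' /= => /ltnW h.
by rewrite (maxn_idPl h).
Qed.

(* The two edges of the cycle at its latest vertex need different labels. *)
Lemma spread_valid x : spread x -> exists g, valid V ((x, g) : conf m n k).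
Proof.
move=> sx; have xi := spread_inj sx.
pose a (i : 'I_k) : 'I_n := if (i : nat) == l.-1 then x o0 else x i.
have aE i : a i = hi V x i :> nat by rewrite hi_spread// /a; case: eqP.
pose c (i : 'I_k) : 'I_m := if (i : nat) == l.-1 then Ordinal m_gt1 else Ordinal (ltnW m_gt1).
have a0 i : (0 < (a i, c i).1)%N.
  by rewrite /= aE; apply: leq_ltn_trans (lo_lt_hi l_gt1 l_le_k V_cycle V_tree i xi).
exists [ffun i => Sub (a i, c i) (a0 i)]; apply/validP; split => //= [i j|i].
  rewrite !ffunE => /(congr1 val) [].
  rewrite /a /c; case: eqP => [ei|_]; case: eqP => [ej|_] //.
    by move=> _ _; apply: val_inj; rewrite /= ei ej.
  by move=> /xi.
by rewrite ffunE /= aE.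
Qed.

(** On the cycle, [1 / y] replaces the larger probability [1 / hi]; for fixed [y] each factor then
    depends on one vertex and the sum factorises. *)
Definition window_weight (i y z : nat) : R :=
  (window i y z)%:R * (if (i < l)%N then y else z)%:R^-1.

Lemma sum_spread_le :
  \sum_(x : {ffun 'I_k -> 'I_n}) \prod_(i < k) window_weight i (x o0) (x i) <=
  \sum_(a : conf m n k | valid V a) Ex (occurs R V a).
Proof.
have -> : \sum_(a : conf m n k | valid V a) Ex (occurs R V a) =
    \sum_(x : {ffun 'I_k -> 'I_n}) \sum_(g | valid V ((x, g) : conf m n k))
      \prod_(i < k) (hi V x i)%:R^-1.
  under eq_bigr => a va do rewrite (Ex_occurs R l_gt1 l_le_k V_cycle V_tree va).
  by rewrite pair_big_dep /=; apply: eq_bigl => -[].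
apply: ler_sum => x _.
have [sx|/forallPn[i wi]] := boolP (spread x); last first.
  rewrite (bigD1 i)//= {1}/window_weight (negbTE wi) mul0r mul0r.
  by apply: sumr_ge0 => g _; apply: prodr_ge0 => j _; rewrite invr_ge0.
have [g vg] := spread_valid sx.
rewrite [leRHS](bigD1 g)//= -[leLHS]addr0 lerD//; last first.
  by apply: sumr_ge0 => g' _; apply: prodr_ge0 => j _; rewrite invr_ge0.
have := spread_inj sx; move=> xi.
apply: ler_prod => i _; rewrite /window_weight.
have /forallP/(_ i) -> := sx; rewrite mul1r invr_ge0 ler0n /=.
have h0 : (0 < hi V x i)%N.
  by apply: leq_ltn_trans (lo_lt_hi l_gt1 l_le_k V_cycle V_tree i xi).
have hl : (hi V x i <= (if (i < l)%N then val (x o0) else val (x i)))%N.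
  rewrite hi_spread//; case: (ltnP i l) => il; case: eqP => // h.
    by have /andP[] := spread_lt_q sx il.
  by move: il; rewrite h leqNgt prednK ?leqnn// ltnW.
have hl0 := leq_trans h0 hl.
rewrite lef_pV2 ?posrE ?ltr0n; [by rewrite ler_nat|exact: hl0|exact: h0].
Qed.

(** The window of index 0 forces [y] to be the first vertex, so the extra sum over [y] has at most
    one nonzero term per placement. *)
Lemma sum_spread_factor :
  \sum_(x : {ffun 'I_k -> 'I_n}) \prod_(i < k) window_weight i (x o0) (x i) =
  \sum_(y < n) \prod_(i < k) \sum_(z < n) window_weight i y z.
Proof.
under [RHS]eq_bigr do rewrite bigA_distr_bigA /=.
rewrite exchange_big /=; apply: eq_bigr => x _.
rewrite [RHS](bigD1 (x o0))//= [X in _ + X]big1 ?addr0// => y yx.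
rewrite (bigD1 o0)//= /window_weight /window /= val_eqE eq_sym (negbTE yx).
by rewrite andbF !mul0r.
Qed.

Lemma sum_nat_window (a b : nat) (F : nat -> R) : (b <= n)%N ->
  \sum_(z < n) (a <= z < b)%N%:R * F z = \sum_(a <= z < b) F z.
Proof.
move=> bn; rewrite -(big_mkord xpredT (fun z => (a <= z < b)%N%:R * F z)).
have [ab|ba] := leqP a b; last first.
  rewrite [RHS]big_geq 1?ltnW// big_nat big1// => z _.
  by case: andP => [[h1 h2]|_]; [lia|rewrite mul0r].
rewrite (big_cat_nat _ (n := a)) ?(leq_trans ab)//= (big_cat_nat _ (m := a) (n := b))//=.
rewrite big_nat big1 ?add0r => [|z /andP[_ za]]; last first.
  by rewrite leqNgt za mul0r.
rewrite [X in _ + X]big_nat [X in _ + X]big1 ?addr0 => [|z /andP[bz _]]; last first.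
  by rewrite ltnNge bz andbF mul0r.
by rewrite big_nat [RHS]big_nat; apply: eq_bigr => z ->; rewrite mul1r.
Qed.

(** On the cycle, [y %/ l >= y / (2 l)] because [l <= y]. In a tree, the harmonic sum from a power
    of [q] to the next one is at least [ln q]. *)
Lemma window_sum_ge (i : 'I_k) (y : nat) : (l <= y < q)%N ->
  (if (i : nat) == 0%N then y%:R^-1 else if (i < l)%N then (2 * l)%:R^-1 else ln q%:R)
  <= \sum_(z < n) window_weight i y z.
Proof.
move=> /andP[ly yq]; rewrite /window_weight /window.
have y0 : 0 < (y%:R : R) by rewrite ltr0n (leq_trans _ ly)// ltnW.
have qn : (q <= n)%N.
  by apply: leq_trans q_le_n; rewrite -[X in (X <= _)%N]expn1 leq_pexp2l.
have [i0|i0] := eqVneq (i : nat) 0%N.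
  rewrite (bigD1 (Ordinal (leq_trans yq qn)))//= ly yq eqxx i0 (ltnW l_gt1) mul1r lerDl.
  by apply: sumr_ge0 => z _; rewrite mulr_ge0// invr_ge0.
case: ifP => il.
  rewrite (sum_nat_window _ (fun=> y%:R^-1)); last first.
    apply: leq_trans qn; apply: leq_trans (ltnW yq); apply: leq_trans (leq_divM y l).
    by rewrite mulnC leq_mul2l leq_subr orbT.
  rewrite big_const_nat iter_addr addr0 -mulnBl.
  have -> : (l - i - (l.-1 - i) = 1)%N by lia.
  rewrite mul1n -[X in _ <= X]mulr_natl ler_pdivlMr// ler_pdivrMl ?ltr0n ?muln_gt0 1?ltnW//; last by rewrite ltnW.
  rewrite -natrM ler_nat.
  have := divn_eq y l; have := ltn_pmod y (ltnW l_gt1).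
  have : (0 < y %/ l)%N by rewrite divn_gt0// ltnW.
  by move: (y %/ l)%N (y %% l)%N => d r; nia.
have i1 : (i - l < k - l)%N.
  by rewrite ltn_sub2r// ?(leq_ltn_trans _ (ltn_ord i))// leqNgt il.
rewrite (sum_nat_window _ (fun z => z%:R^-1)); last first.
  by apply: leq_trans q_le_n; rewrite leq_pexp2l.
apply: le_trans (harmonic_lb R _ _); rewrite ?expn_gt0 ?q_gt0 ?leq_pexp2l//.
have Q0 : 0 < (q%:R : R) by rewrite ltr0n.
by rewrite !natrX !lnXn// [_ *+ (i - l).+2]mulrS addrK.
Qed.

Lemma mean_ge_ln :
  (2 * l)%:R^-1 ^+ l.-1 * ln q%:R ^+ (k - l) * (ln q%:R - ln l%:R) <=
  \sum_(a : conf m n k | valid V a) Ex (occurs R V a).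
Proof.
apply: le_trans sum_spread_le; rewrite sum_spread_factor.
have q1 : 1 <= (q%:R : R) by rewrite ler1n.
have lnq : 0 <= ln (q%:R : R) by rewrite ln_ge0.
set c := _ * _ ^+ (k - l).
have c0 : 0 <= c by rewrite mulr_ge0// exprn_ge0// invr_ge0.
have F0 i y z : 0 <= window_weight i y z by rewrite mulr_ge0// invr_ge0.
have G0 (y : 'I_n) : 0 <= \prod_(i < k) \sum_(z < n) window_weight i y z.
  by apply: prodr_ge0 => i _; apply: sumr_ge0.
(* For [q < l] there is no room for the first vertex, and the claimed lower bound is not
   positive. *)
have [ql|lq] := ltnP q l.
  apply: le_trans (_ : 0 <= _); last by apply: sumr_ge0.
  rewrite mulr_ge0_le0// subr_le0 ler_ln ?posrE ?ltr0n ?ler_nat ?(ltnW ql)//.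
  exact: ltnW.
have qn : (q <= n)%N.
  by apply: leq_trans q_le_n; rewrite -[X in (X <= _)%N]expn1 leq_pexp2l.
apply: le_trans (_ : c * \sum_(l <= y < q) y%:R^-1 <= _).
  by rewrite ler_wpM2l// harmonic_lb// ltnW.
rewrite -(sum_nat_window _ _ qn) mulr_sumr; apply: ler_sum => y _.
have [lyq|_] := boolP (l <= y < q)%N; last by rewrite mul0r mulr0.
rewrite mul1r; apply: le_trans (_ : \prod_(i < k)
  (if (i : nat) == 0%N then y%:R^-1 else if (i < l)%N then (2 * l)%:R^-1 else ln q%:R) <= _).
  rewrite -(big_mkord xpredT (fun i => if i == 0%N then y%:R^-1 else if (i < l)%N then (2 * l)%:R^-1 else ln q%:R)).
  rewrite (big_cat_nat _ (n := l))//= big_ltn ?(ltnW l_gt1)//= -mulrA mulrC.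
  rewrite (eq_big_nat _ _ (F2 := fun=> (2 * l)%:R^-1)); last first.
    by move=> i /andP[i0 ->]; rewrite gtn_eqF.
  rewrite [X in _ * (_ * X)](eq_big_nat _ _ (F2 := fun=> ln q%:R)); last first.
    by move=> i /andP[li _]; rewrite gtn_eqF ?(leq_trans (ltnW l_gt1) li)// ltnNge li.
  by rewrite !prodr_const_nat subn1 /c.
apply: ler_prod => i _; rewrite window_sum_ge// andbT.
by case: ifP => _; [rewrite invr_ge0|case: ifP => _; rewrite ?invr_ge0].
Qed.

End MeanLowerBound.

Lemma exists_root (t n : nat) : (0 < n)%N -> exists q, (q ^ t.+1 <= n < q.+1 ^ t.+1)%N.
Proof.
move=> n0.
have ex : exists q, (q ^ t.+1 <= n)%N by exists 0%N; rewrite exp0n.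
have ub q : (q ^ t.+1 <= n)%N -> (q <= n)%N.
  apply: leq_trans; case: q => // q; rewrite -[X in (X <= _)%N]expn1 leq_pexp2l//.
exists (ex_maxn ex ub); case: ex_maxnP => q -> /= max.
by rewrite ltnNge; apply/negP => /max; rewrite ltnn.
Qed.

(** From [mean_ge_ln], with [ln q >= ln n / (2 (t + 1))] used [t + 1] times and
    [ln q - ln l >= ln q / 2]. *)
Definition mean_const (R : realType) (l t : nat) : R :=
  (2 * l)%:R^-1 ^+ l.-1 * (2 * t.+1)%:R^-1 ^+ t.+1 / 2.

Lemma mean_const_gt0 (R : realType) l t : (0 < l)%N -> 0 < mean_const R l t.
Proof.
by move=> l0; rewrite !mulr_gt0// ?exprn_gt0// ?invr_gt0// ltr0n muln_gt0.
Qed.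

Lemma mean_ge (R : realType) (m n l t : nat) (V : nat -> nat) :
  (1 < l)%N -> (forall i, (i < l)%N -> V i = (i.+1 %% l)%N) ->
  (forall i, (l <= i < l + t)%N -> (V i < i)%N) -> (1 < m)%N ->
  ((l ^ 2).+1 ^ t.+1 <= n)%N ->
  mean_const R l t * ln n%:R ^+ t.+1 <=
  \sum_(a : conf m n (l + t) | valid V a) Ex (occurs R V a).
Proof.
move=> l1 Vc Vt m1 nl.
have n0 : (0 < n)%N by apply: leq_trans nl; rewrite expn_gt0.
have [q /andP[qn nq]] := exists_root t n0.
(* Hence [2 ln l <= ln q], and subtracting [ln l] loses at most half. *)
have lq : (l ^ 2 <= q)%N.
  by have := leq_ltn_trans nl nq; rewrite ltn_exp2r// ltnS => /ltnW.
have q2 : (2 <= q)%N by apply: leq_trans lq; nia.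
have q0 : (0 < q)%N by exact: ltnW.
have lk : (l <= l + t)%N by rewrite leq_addr.
have := @mean_ge_ln R m n l (l + t) V l1 lk Vc Vt m1 q q0.
rewrite addKn => /(_ qn); apply: le_trans.
have l0 : 0 < (l%:R : R) by rewrite ltr0n ltnW.
have Q0 : 0 < (q%:R : R) by rewrite ltr0n.
have lnl : 2 * ln (l%:R : R) <= ln (q%:R : R).
  by rewrite mulr_natl -lnXn// -natrX ler_ln ?posrE ?ler_nat// ltr0n expn_gt0 ltnW.
have lnl0 : 0 <= ln (l%:R : R) by rewrite ln_ge0// ler1n ltnW.
have lnn0 : 0 <= ln (n%:R : R) by rewrite ln_ge0// ler1n.
have lnq : (2 * t.+1)%:R^-1 * ln (n%:R : R) <= ln (q%:R : R).
  rewrite ler_pdivrMl ?ltr0n// natrM -mulrA -(mulrCA _ 2).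
  rewrite [2 * ln _]mulr_natl [_%:R * _]mulr_natl -lnXn// -lnXn//; last by rewrite exprn_gt0.
  rewrite -!natrX ler_ln ?posrE ?ltr0n ?expn_gt0 ?q0// ler_nat.
  (* As [q >= 2], one has [q + 1 <= q ^ 2]: rounding the root down costs the factor 2 in
     [2 * t.+1]. *)
  apply: leq_trans (ltnW nq) _; rewrite leq_exp2r//; nia.
rewrite /mean_const [ln n%:R ^+ _]exprS; set x := ln q%:R in lnl lnq *; set y := ln n%:R in lnn0 lnq *.
set z := ln l%:R in lnl lnl0 *.
set c := _ ^+ l.-1; have c0 : 0 <= c by rewrite exprn_ge0// invr_ge0.
set b := _^-1 in lnq *; have b0 : 0 <= b by rewrite invr_ge0.
have x0 : 0 <= x by apply: le_trans lnq; rewrite mulr_ge0.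
have -> : c * b ^+ t.+1 / 2 * (y * y ^+ t) = c * ((b * y) ^+ t * (b * y / 2)).
  by rewrite exprMn exprS; ring.
rewrite -[leRHS]mulrA ler_wpM2l//.
have by0 : 0 <= b * y by rewrite mulr_ge0.
apply: ler_pM; rewrite ?exprn_ge0 ?divr_ge0//; first by rewrite lerXn2r// nnegrE.
by lra.
Qed.

(** * Copies *)

Section CopyCount.
Variables (R : realType) (m n : nat) (Lambda : mgraph).
Local Notation Om := (ua_space m n).
Local Notation W := (@W R Lambda m n).

Lemma mu_Ex : mu R Lambda m n = Ex W.
Proof. by rewrite /mu unlock integral_ua_prob. Qed.

Lemma sigma2_Ex : sigma2 R Lambda m n = Ex (fun w => (W w - Ex W) ^+ 2).
Proof.
rewrite /sigma2 /probability_theory.random_variable.variance unlock unlock -mu_Ex /mu unlock.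
by rewrite integral_ua_prob.
Qed.

Lemma wasserstein_le (delta : R) :
  (forall f f' : R -> R, (forall x : R, is_derive x 1 f (f' x)) ->
     (forall x y, `|f' x - f' y| <= stein_const R * `|x - y|) ->
     `|Ex (fun w : Om => f' (Y R Lambda w) - Y R Lambda w * f (Y R Lambda w))| <= delta) ->
  (wasserstein (law_Y R Lambda m n) (normal_prob 0 1) <= delta%:E)%E.
Proof.
move=> H; apply: ge_ereal_sup => _ [h hl <-].
have mh : measurable_fun [set: R] h.
  by apply: continuous_measurable_fun; exact: lip1_continuous.
have mhE : measurable_fun [set: measurableTypeR R] (EFin \o h).
  by apply/measurable_EFinP; exact: mh.
rewrite (integral_normal_probE mh (lip1_growth hl)).
rewrite /law_Y (integral_distribution mhE (Ex_integrable (fun w => h (Y R Lambda w)))).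
rewrite (integral_ua_prob (fun w => h (Y R Lambda w))) -EFinB lee_fin.
exact: (stein_lipschitz_bound (@pmf_ge0 R m n) (@pmf_sum1 R m n) H hl).
Qed.

End CopyCount.

(** * The number of copies as a sum of indicators *)

Section StandardCopies.
Variables (R : realType) (m n l k : nat) (V : nat -> nat) (Lambda : mgraph).
Variables (ve : 'I_k -> vertex Lambda) (ed : 'I_k -> edge Lambda).
Hypothesis l_le_k : (l <= k)%N.
Hypothesis V_cycle : forall i, (i < l)%N -> V i = (i.+1 %% l)%N.
Hypothesis V_tree : forall i, (l <= i < k)%N -> (V i < i)%N.
Hypotheses (ve_bij : bijective ve) (ed_bij : bijective ed).
Hypothesis ends_ed : forall i j : 'I_k, j = V i :> nat ->
  ends (ed i) = finset.setU [set ve i]%SET [set ve j]%SET.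
Local Notation Om := (ua_space m n).
Local Notation N := (total (valid V) (@occurs R m n k V)).

Lemma card_emb_total (w : Om) : (#|emb Lambda (ua_graph w)|)%:R = N w.
Proof.
have [ve' veK ve'K] := ve_bij; have [ed' edK ed'K] := ed_bij.
have ends_Vo i : ends (ed i) = finset.setU [set ve i]%SET [set ve (Vo V i)]%SET.
  by apply: ends_ed; rewrite (VoE l_le_k V_cycle V_tree).
rewrite -sum1_card natr_sum (reindex _ (onW_bij _ (emb_of_tuples_bij veK ve'K edK ed'K w))) /=.
rewrite /total big_mkcond [RHS]big_mkcond /=; apply: eq_bigr => a _.
rewrite (emb_of_tuplesE veK ve'K edK ed'K ends_Vo) /valid.
case: (injectiveb a.1) => //=; case: (injectiveb a.2) => //=.
case: forallP => [h|nh]; case: forallP => [h'|nh'] //.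
- by rewrite /occurs big1// => i _; have /andP[_ e] := h i; rewrite /hits /lo e.
- by case: nh' => i; have /andP[] := h i.
- have [[i ni]|] := pselect (exists i, ~ (w (a.2 i) == lo V a.1 i :> nat)).
    by rewrite /occurs (bigD1 i)//= /hits; case: eqP ni => [_ []//|_ _]; rewrite mul0r.
  by move=> ne; case: nh => i; rewrite (h' i) /=; apply: contrapT => ni; case: ne; exists i.
Qed.

Local Notation Aut := (#|emb Lambda Lambda|%:R : R).

Lemma Aut_gt0 : 0 < Aut. Proof. by rewrite ltr0n card_emb_gt0. Qed.

Lemma W_total (w : Om) : W R Lambda w = N w / Aut.
Proof.
by rewrite -card_emb_total card_emb natrM mulfK// gt_eqF// Aut_gt0.
Qed.

Lemma mu_total : mu R Lambda m n = Ex N / Aut.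
Proof. by rewrite mu_Ex -ExZr; apply: eq_Ex => w; rewrite W_total. Qed.

Lemma sigma2_total : sigma2 R Lambda m n = total_var (valid V) (@occurs R m n k V) / Aut ^+ 2.
Proof.
rewrite sigma2_Ex -mu_Ex mu_total -[RHS]ExZr; apply: eq_Ex => w.
by rewrite W_total -mulrBl exprMn exprVn.
Qed.

(** The number of automorphisms cancels, which is why the rate depends on the pattern only through
    [l] and [t]. *)
Lemma Y_total (w : Om) : Y R Lambda w =
  ctotal (valid V) (@occurs R m n k V) w / Num.sqrt (total_var (valid V) (@occurs R m n k V)).
Proof.
rewrite /Y W_total mu_total sigma2_total -mulrBl /ctotal.
have A0 := Aut_gt0; set v := total_var _ _.
have v0 : 0 <= v by apply: Ex_ge0 => w'; exact: sqr_ge0.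
rewrite sqrtrM// sqrtrV ?exprn_ge0// ?ltW// sqrtr_sqr gtr0_norm//.
by rewrite invfM invrK mulrACA mulVf ?gt_eqF// mulr1.
Qed.

End StandardCopies.

(** * Asymptotics *)

Section Rates.
Variables (R : realType) (m l t : nat).
Hypothesis m_gt1 : (1 < m)%N.
Hypothesis l_gt1 : (1 < l)%N.

Definition degree_const (k : nat) : R := 6 * m%:R + (4 * k)%:R.

Lemma degree_const_ge0 k : 0 <= degree_const k.
Proof. by rewrite addr_ge0// mulr_ge0. Qed.

Lemma degree_bound_le (n k : nat) : 1 <= ln (n%:R : R) ->
  degree_bound R m n k <= degree_const k * ln n%:R.
Proof.
rewrite /degree_bound /degree_const; set x := ln _ => x1.
have m0 : 0 <= (m%:R : R) by [].
have k0 : 0 <= ((4 * k)%:R : R) by [].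
by nra.
Qed.

Definition cycle_const : R := 2 * m%:R * (8 * m%:R) ^+ l.-1.

Lemma cycle_const_gt0 : 0 < cycle_const.
Proof. by rewrite !mulr_gt0 ?exprn_gt0 ?mulr_gt0// ltr0n ltnW. Qed.

Definition mean_upper : R := cycle_const * degree_const (l + t) ^+ t.+1.

Definition hit_const : R := pinned_const R m l (l + t) * degree_const (l + t) ^+ t.

Definition var_upper : R := hit_const * mean_upper.

Definition mean_defect : R := pair_const R m l (l + t) * (2 * degree_const (l + t)) ^+ t.

Definition var_lower : R :=
  (mean_const R l t / 2) ^+ 2 /
  (pinned_const R m l l * (cycle_const * degree_const l) + 1).

Definition normal_rate : R :=
  24 * stein_const R * hit_const ^+ 2 * mean_upper / (var_lower * Num.sqrt var_lower).

Lemma stein_const_ge0 : 0 <= stein_const R.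
Proof. by rewrite /stein_const addr_ge0// mulr_ge0// normal_abs_moment_ge0. Qed.

Lemma hit_const_ge0 : 0 <= hit_const.
Proof. by rewrite mulr_ge0 ?pinned_const_ge0// exprn_ge0// degree_const_ge0. Qed.

Lemma mean_upper_ge0 : 0 <= mean_upper.
Proof. apply: mulr_ge0; first exact: ltW cycle_const_gt0.
by rewrite exprn_ge0// degree_const_ge0. Qed.

Lemma mean_defect_ge0 : 0 <= mean_defect.
Proof.
have t0 : 0 <= through_const R m l by rewrite !mulr_ge0// exprn_ge0// mulr_ge0.
by rewrite !mulr_ge0// ?exprn_ge0// ?mulr_ge0// degree_const_ge0.
Qed.

Let a_gt0 : 0 < mean_const R l t. Proof. by apply: mean_const_gt0; exact: ltnW. Qed.

Let d_gt0 : 0 < pinned_const R m l l * (cycle_const * degree_const l) + 1.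
Proof.
rewrite ltr_wpDl// mulr_ge0 ?pinned_const_ge0//.
by rewrite mulr_ge0 ?degree_const_ge0// ltW// cycle_const_gt0.
Qed.

Lemma var_lower_gt0 : 0 < var_lower.
Proof. by rewrite divr_gt0// exprn_gt0// divr_gt0. Qed.

Lemma normal_rate_ge0 : 0 <= normal_rate.
Proof.
have s0 := stein_const_ge0; have h0 := hit_const_ge0; have u0 := mean_upper_ge0.
have v0 := var_lower_gt0.
apply: divr_ge0; last by rewrite mulr_ge0 ?sqrtr_ge0// ltW.
apply: mulr_ge0 => //; apply: mulr_ge0; last exact: exprn_ge0.
by rewrite mulr_ge0.
Qed.

(** The first condition is that of [mean_ge]; the second one makes the defect of the covariance, of
    order [(ln n)^t], at most half the lower bound for the mean, and gives [1 <= ln n]. *)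
Definition large (n : nat) : Prop :=
  ((l ^ 2).+1 ^ t.+1 <= n)%N /\ 1 + 2 * mean_defect / mean_const R l t <= ln (n%:R : R).

Lemma near_large : \forall n \near \oo, large n.
Proof.
near=> n; split; first by near: n; exact: nbhs_infty_ge.
rewrite -[leLHS]expRK ler_ln ?posrE ?expR_gt0//.
  by near: n; exact: nbhs_infty_ger.
by rewrite ltr0n; near: n; exact: nbhs_infty_gt.
Unshelve. all: by end_near. Qed.

Lemma large_gt0 n : large n -> (0 < n)%N.
Proof. by case=> h _; apply: leq_trans h; rewrite expn_gt0. Qed.

Lemma large_ge1 n : large n -> 1 <= ln (n%:R : R).
Proof.
case=> _; apply: le_trans; rewrite lerDl; apply: divr_ge0; last exact: ltW.
by apply: mulr_ge0; rewrite ?mean_defect_ge0.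
Qed.

Section Bounds.
Variables (V : nat -> nat) (n : nat).
Hypothesis V_cycle : forall i, (i < l)%N -> V i = (i.+1 %% l)%N.
Hypothesis V_tree : forall i, (l <= i < l + t)%N -> (V i < i)%N.
Hypothesis n_large : large n.
Local Notation x := (ln (n%:R : R)).
Local Notation X := (@occurs R m n (l + t) V).
Local Notation P := (valid V).
Local Notation L := (degree_bound R m n (l + t)).

Let n_gt0 : (0 < n)%N := large_gt0 n_large.
Let x_ge1 : 1 <= x := large_ge1 n_large.
Let x_ge0 : 0 <= x := le_trans ler01 x_ge1.
Let l_le_k : (l <= l + t)%N := leq_addr t l.
Let m_gt0 : (0 < m)%N := ltnW m_gt1.

Let L_ge0 : 0 <= L.
Proof. exact: le_trans (degree_bound_ge1 R m l_gt1 l_le_k n_gt0). Qed.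

Lemma total_mean_le : Ex (total P X) <= mean_upper * x ^+ t.+1.
Proof.
rewrite mean_sum.
apply: le_trans (mean_le R l_gt1 l_le_k V_cycle V_tree m_gt0 n_gt0) _.
rewrite addKn -/cycle_const /mean_upper -mulrA -exprMn.
rewrite ler_wpM2l ?(ltW cycle_const_gt0)// lerXn2r ?nnegrE//.
  by rewrite mulr_ge0 ?degree_const_ge0.
exact: degree_bound_le.
Qed.

Lemma total_mean_ge : mean_const R l t * x ^+ t.+1 <= Ex (total P X).
Proof. by rewrite mean_sum mean_ge// (proj1 n_large). Qed.

Let c := pinned_const R m l (l + t) * L ^+ t.

Let c_ge0 : 0 <= c. Proof. by rewrite mulr_ge0 ?pinned_const_ge0// exprn_ge0. Qed.

Let c_le : c <= hit_const * x ^+ t.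
Proof.
rewrite /c /hit_const -mulrA -exprMn ler_wpM2l ?pinned_const_ge0//.
rewrite lerXn2r ?nnegrE//; first by rewrite mulr_ge0 ?degree_const_ge0.
exact: degree_bound_le.
Qed.

Let X_ge0 a w : 0 <= X a w. Proof. exact: occurs_ge0. Qed.

Let X_dep a : depends_on (choices a) (X a). Proof. exact: depends_on_occurs. Qed.

Let ch_card (a : conf m n (l + t)) : P a -> (#|choices a| <= l + t)%N.
Proof. by move=> _; exact: card_choices. Qed.

Let hitsum_le (D : {set ua_edge m n}) (h : ua_space m n -> R) : (#|D| <= 2 * (l + t))%N ->
  depends_on D h -> (forall w, 0 <= h w) ->
  Ex (fun w => h w * hitsum P X (@choices m n (l + t)) D w) <= c * Ex h.
Proof.
move=> Dk dh h0; have := hitsum_pinned l_gt1 l_le_k V_cycle V_tree n_gt0 Dk dh h0.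
by rewrite addKn.
Qed.

Lemma total_variance_le : total_var P X <= var_upper * x ^+ (2 * t).+1.
Proof.
apply: le_trans (variance_le X_ge0 X_dep ch_card hitsum_le) _.
have -> : (2 * t).+1 = (t + t.+1)%N by lia.
rewrite exprD /var_upper mulrACA.
apply: ler_pM; rewrite ?total_mean_le//.
by apply: Ex_ge0 => w; apply: sumr_ge0.
Qed.

Lemma total_variance_ge : var_lower * x ^+ (2 * t).+1 <= total_var P X.
Proof.
have xt0 : 0 <= x ^+ t by rewrite exprn_ge0.
have pc0 : 0 <= pair_const R m l (l + t).
  by rewrite !mulr_ge0// ?exprn_ge0// ?mulr_ge0.
have defect : pair_const R m l (l + t) * (2 * L) ^+ t <= mean_defect * x ^+ t.
  rewrite /mean_defect -mulrA -exprMn ler_wpM2l// lerXn2r ?nnegrE//.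
  - by rewrite mulr_ge0.
  - by rewrite !mulr_ge0// degree_const_ge0.
  - by rewrite -mulrA ler_wpM2l// degree_bound_le.
have half : mean_const R l t / 2 * x ^+ t.+1 <=
    Ex (total P X) - pair_const R m l (l + t) * (2 * L) ^+ t.
  rewrite lerBrDr; apply: le_trans total_mean_ge; rewrite -lerBrDl -mulrBl.
  have -> : mean_const R l t - mean_const R l t / 2 = mean_const R l t / 2 by field.
  apply: le_trans defect _; rewrite exprS mulrA ler_wpM2r//.
  have a0 := a_gt0; have [_ /(ler_wpM2l (ltW a0))] := n_large; set a := mean_const R l t in a0 *.
  have -> : a * (1 + 2 * mean_defect / a) = a + 2 * mean_defect by field; rewrite gt_eqF.
  by move: a0; lra.
have half0 : 0 <= mean_const R l t / 2 * x ^+ t.+1.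
  by rewrite mulr_ge0 ?exprn_ge0// divr_ge0// ltW.
have := variance_ge l_gt1 l_le_k V_cycle V_tree m_gt0 n_gt0 (R := R).
rewrite addKn => /(_ (le_trans half0 half)) H.
have {}H : (mean_const R l t / 2 * x ^+ t.+1) ^+ 2 <=
    (cycle_variance_bound R m n l + 1) * total_var P X.
  by apply: le_trans H; rewrite lerXn2r ?nnegrE// (le_trans half0).
have v0 : 0 <= total_var P X by apply: Ex_ge0 => w; exact: sqr_ge0.
(* The variance of the number of cycles takes one factor [ln n] off the exponent [2 t + 2]. *)
have cvb : cycle_variance_bound R m n l + 1 <=
    (pinned_const R m l l * (cycle_const * degree_const l) + 1) * x.
  rewrite mulrDl mul1r lerD// /cycle_variance_bound -/cycle_const -mulrA.
  rewrite ler_wpM2l ?pinned_const_ge0// -mulrA ler_wpM2l ?(ltW cycle_const_gt0)//.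
  exact: degree_bound_le.
have {}H := le_trans H (ler_wpM2r v0 cvb).
rewrite /var_lower mulrAC ler_pdivrMr// -(ler_pM2r (lt_le_trans ltr01 x_ge1)).
move: H; rewrite exprMn -exprM => H.
apply: le_trans (le_trans H _); rewrite le_eqVlt; apply/orP; left; apply/eqP.
  have -> : (t.+1 * 2 = (2 * t).+2)%N by rewrite mulnC mulnS.
  by rewrite [_ ^+ (2 * t).+2]exprSr mulrA.
by rewrite mulrC -[RHS]mulrA.
Qed.

Lemma total_variance_gt0 : 0 < total_var P X.
Proof.
apply: lt_le_trans total_variance_ge.
by rewrite mulr_gt0 ?var_lower_gt0// exprn_gt0// (lt_le_trans ltr01).
Qed.

Lemma total_stein_error (f f' : R -> R) :
  (forall y : R, is_derive y 1 f (f' y)) ->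
  (forall y z, `|f' y - f' z| <= stein_const R * `|y - z|) ->
  `|Ex (fun w => f' (ctotal P X w / Num.sqrt (total_var P X)) -
      ctotal P X w / Num.sqrt (total_var P X) * f (ctotal P X w / Num.sqrt (total_var P X)))|
  <= normal_rate * x `^ (- 2^-1).
Proof.
move=> df f'l; have v0 := total_variance_gt0.
have x0 : 0 < x by apply: lt_le_trans x_ge1.
set s := Num.sqrt _; have s0 : 0 < s by rewrite sqrtr_gt0.
have s2 : s ^+ 2 = total_var P X by rewrite sqr_sqrtr// ltW.
apply: le_trans (stein_error X_ge0 X_dep ch_card c_ge0 hitsum_le s0 s2 stein_const_ge0 df f'l) _.
have b0 := var_lower_gt0; have sb0 : 0 < Num.sqrt var_lower by rewrite sqrtr_gt0.
have sx0 : 0 < Num.sqrt x by rewrite sqrtr_gt0.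
have xt0 : 0 < x ^+ t by rewrite exprn_gt0.
have s_ge : Num.sqrt var_lower * (x ^+ t * Num.sqrt x) <= s.
  rewrite /s -(ger0_norm (ltW xt0)) -sqrtr_sqr -sqrtrM ?exprn_ge0 ?(ltW xt0)//.
  rewrite -sqrtrM ?(ltW b0)// ler_sqrt ?(ltW v0)//.
  by rewrite -exprM -exprSr mulnC; exact: total_variance_ge.
(* The exponent [3 t + 3 / 2], against [3 t + 1] in the numerator, leaves [- 1 / 2]. *)
have s3_ge : var_lower * Num.sqrt var_lower * (x ^+ t.+1 * x ^+ t ^+ 2 * Num.sqrt x) <= s ^+ 3.
  rewrite [s ^+ 3]exprSr s2; apply: le_trans (_ : var_lower * x ^+ (2 * t).+1 *
     (Num.sqrt var_lower * (x ^+ t * Num.sqrt x)) <= _).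
    rewrite le_eqVlt; apply/orP; left; apply/eqP.
    by rewrite !exprS mulnC exprM; ring.
  apply: ler_pM; rewrite ?total_variance_ge// mulr_ge0 ?exprn_ge0 ?(ltW b0)//.
  by rewrite mulr_ge0// ltW.
rewrite powRN powR12_sqrt// /normal_rate.
have K0 := stein_const_ge0; have h0 := hit_const_ge0; have u0 := mean_upper_ge0.
rewrite ler_pdivrMr ?exprn_gt0//.
apply: le_trans (_ : 24 * stein_const R * (hit_const * x ^+ t) ^+ 2 *
  (mean_upper * x ^+ t.+1) <= _).
  have EN0 : 0 <= Ex (total P X) by apply: Ex_ge0 => w; apply: sumr_ge0.
  apply: ler_pM => //; last exact: total_mean_le.
    by rewrite mulr_ge0 ?exprn_ge0// mulr_ge0.
  by rewrite ler_wpM2l ?mulr_ge0// lerXn2r ?nnegrE// mulr_ge0// ltW.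
apply: le_trans (ler_wpM2l _ s3_ge); last first.
  by rewrite divr_ge0 ?normal_rate_ge0// ltW.
rewrite le_eqVlt; apply/orP; left; apply/eqP; field.
by rewrite !gt_eqF.
Qed.

End Bounds.
End Rates.

Theorem theorem3p5 (R : realType) (m l t : nat)
    (m_ge2 : (2 <= m)%N) (l_ge2 : (2 <= l)%N) :
  exists C : R, 0 < C /\
  forall (s : nat) (ts : 'I_s -> nat) (T : 'I_s -> mgraph)
    (root : forall i, vertex (T i)) (p : 'I_s -> vertex (cycle_graph l_ge2))
    (Lambda : mgraph),
    (forall i, (1 <= ts i)%N) ->
    t = (\sum_i ts i)%N ->
    (forall i, is_tree (T i) /\ #|edge (T i)| = ts i) ->
    injective p ->
    connected_mgraph Lambda ->
    unicyclic Lambda ->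
    isomorphic (attach root p) Lambda ->
    [/\ is_Theta (fun n => mu R Lambda m n) (fun n => ln n%:R ^+ t.+1),
        is_Theta (fun n => sigma2 R Lambda m n) (fun n => ln n%:R ^+ (2 * t).+1) &
        \forall n \near \oo,
          (wasserstein (law_Y R Lambda m n) (normal_prob 0 1)
             <= (C * ln n%:R `^ (- 2^-1))%:E)%E].
Proof.
have l_gt0 : (0 < l)%N by exact: ltnW.
(* [normal_rate_ge0] gives nonnegativity; the 1 makes the constant positive. *)
exists (normal_rate R m l t + 1); split.
  by rewrite ltr_wpDl// normal_rate_ge0.
move=> s ts T root p Lambda _ tE treeT _ conn _ iso.
have [V [ve [ed [Vc Vt veb edb ends_ed]]]] := standard_form tE treeT conn iso.
have l_le_k : (l <= l + t)%N := leq_addr t l.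
have A0 : 0 < #|emb Lambda Lambda|%:R :> R := Aut_gt0 R Lambda.
have vl0 := var_lower_gt0 R t m_ge2 l_ge2.
have mc0 := mean_const_gt0 R t l_gt0.
have ends_ed' : forall i j : 'I_(l + t), j = V i :> nat ->
  ends (ed i) = finset.setU [set ve i]%SET [set ve j]%SET := ends_ed.
have muE n := @mu_total R m n l (l + t) V Lambda ve ed l_le_k Vc Vt veb edb ends_ed'.
have s2E n := @sigma2_total R m n l (l + t) V Lambda ve ed l_le_k Vc Vt veb edb ends_ed'.
have YE n := @Y_total R m n l (l + t) V Lambda ve ed l_le_k Vc Vt veb edb ends_ed'.
have big := near_large R m l t.
split.
(* The lower constant is added to the upper one, so that [c <= c'] holds without comparing them. *)
- exists (mean_const R l t / #|emb Lambda Lambda|%:R),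
    (mean_upper R m l t / #|emb Lambda Lambda|%:R + mean_const R l t / #|emb Lambda Lambda|%:R).
  split; first by rewrite divr_gt0.
    by rewrite lerDr divr_ge0// ?mean_upper_ge0// ltW.
  near=> n; have ln_n : large R m l t n by near: n.
  have lo := total_mean_ge m_ge2 l_ge2 Vc Vt ln_n.
  have up := total_mean_le m_ge2 l_ge2 Vc Vt ln_n.
  have x0 : 0 <= ln (n%:R : R) by apply: le_trans (large_ge1 l_ge2 ln_n).
  rewrite muE mulrAC ler_pM2r ?invr_gt0// lo /= mulrDl.
  rewrite mulrAC -[leLHS]addr0 lerD ?ler_pM2r ?invr_gt0//.
  by apply: mulr_ge0; [apply: divr_ge0; exact: ltW|exact: exprn_ge0].
- exists (var_lower R m l t / #|emb Lambda Lambda|%:R ^+ 2),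
    (var_upper R m l t / #|emb Lambda Lambda|%:R ^+ 2 + var_lower R m l t / #|emb Lambda Lambda|%:R ^+ 2).
  have A2 : 0 < #|emb Lambda Lambda|%:R ^+ 2 :> R by rewrite exprn_gt0.
  split; first by rewrite divr_gt0.
    by rewrite lerDr divr_ge0 ?(ltW A2)// mulr_ge0 ?hit_const_ge0 ?mean_upper_ge0.
  near=> n; have ln_n : large R m l t n by near: n.
  have lo := total_variance_ge m_ge2 l_ge2 Vc Vt ln_n.
  have up := total_variance_le m_ge2 l_ge2 Vc Vt ln_n.
  have x0 : 0 <= ln (n%:R : R) by apply: le_trans (large_ge1 l_ge2 ln_n).
  rewrite s2E mulrAC ler_pM2r ?invr_gt0// lo /= mulrDl.
  rewrite mulrAC -[leLHS]addr0 lerD ?ler_pM2r ?invr_gt0//.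
  by apply: mulr_ge0; [apply: divr_ge0; exact: ltW|exact: exprn_ge0].
- near=> n; have ln_n : large R m l t n by near: n.
  apply: wasserstein_le => f f' df f'l.
  apply: le_trans (_ : normal_rate R m l t * ln n%:R `^ (- 2^-1) <= _); last first.
    by rewrite ler_wpM2r ?powR_ge0// lerDl.
  under eq_Ex do rewrite YE.
  exact: total_stein_error.
Unshelve. all: by end_near. Qed.
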